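(* Let $N\ge 2$ be an integer and $\lambda>0$ real, and let $$H=-\sum_{j=1}^N\frac{\partial^2}{\partial x_j^2}+2\lambda(\lambda-1)\sum_{1\le j<k\le N}V(x_j-x_k),\qquad V(r)=\frac{1}{4\sin^2(r/2)}.$$ For $\mathbf n=(n_1,\dots,n_N)\in\mathbb Z^N$ put $$\hat F(\mathbf x;\mathbf n)=\mathcal P_{\mathbf n}(\mathbf x)\,\Psi_0(\mathbf x),$$ where $$\Psi_0(\mathbf x)=\prod_{1\le j<k\le N}\sin\bigl((x_k-x_j)/2\bigr)^\lambda$$ and $$\mathcal P_{\mathbf n}(\mathbf x)=\lim_{\varepsilon\downarrow0}\int_{-\pi}^{\pi}\frac{dy_1}{2\pi}e^{i n_1y_1}\cdots\int_{-\pi}^{\pi}\frac{dy_N}{2\pi}e^{i n_Ny_N}\;\frac{\prod_{1\le j<k\le N}\bigl(1-e^{i(y_j-y_k)-(k-j)\varepsilon}\bigr)^\lambda}{\prod_{j,k=1}^N\bigl(1-e^{i(x_k-y_j)-j\varepsilon}\bigr)^\lambda}.$$ Then for every $\mathbf n\in\mathbb Z^N$, $$H\hat F(\mathbf x;\mathbf n)=E_{\mathbf n}\hat F(\mathbf x;\mathbf n)-\gamma\sum_{1\le j<k\le N}\sum_{\nu=1}^\infty\nu\,\hat F(\mathbf x;\mathbf n+\nu\mathbf E_{jk}),$$ where $(\mathbf E_{jk})_\ell=\delta_{j\ell}-\delta_{k\ell}$ for $\ell=1,\dots,N$, $\gamma=2\lambda(\lambda-1)$, and $$E_{\mathbf 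n}=\sum_{j=1}^N\Bigl(n_j+\lambda\bigl[\tfrac12(N+1)-j\bigr]\Bigr)^2.$$
   Context: The variables $\mathbf x=(x_1,\dots,x_N)$ are real, and differential identities are understood at points where the $x_j$ are pairwise distinct modulo $2\pi$. In $\mathcal P_{\mathbf n}$ the powers $(1-w)^{\pm\lambda}$ with $|w|<1$ are principal branches (given by the binomial series). In $\Psi_0$, $\sin(r/2)^\lambda$ is any fixed choice of branch, i.e. $|\sin(r/2)|^\lambda$ times a phase factor that is locally constant on $\mathbb R\setminus2\pi\mathbb Z$; the choice of phase is irrelevant. *)

(* Defs.v *)
(* Analysis is over the Stdlib reals with Coquelicot; MathComp is used only for
   finite index types and big operators. *)
From Stdlib Require Import Reals ZArith.
From Coquelicot Require Import Coquelicot.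
From mathcomp Require Import ssreflect ssrfun ssrbool eqtype ssrnat fintype bigop.

Set Implicit Arguments.
Unset Strict Implicit.
Unset Printing Implicit Defensive.

Local Open Scope R_scope.

Definition Cexp (z : C) : C := (exp (Re z) * cos (Im z), exp (Re z) * sin (Im z)).

(* Principal argument, with values in (-PI, PI]; meaningful for z <> 0. *)
Definition Carg (z : C) : R :=
  if Rle_dec 0 (Im z) then acos (Re z / Cmod z) else - acos (Re z / Cmod z).

(* Principal branch of z ^ s for z <> 0. *)
Definition Cpower (z : C) (s : R) : C :=
  Cmult (RtoC (Rpower (Cmod z) s)) (Cexp (0, s * Carg z)).

(* Sites are numbered from 0 in 'I_N: the mathematical index of [j : 'I_N]
   is [j.+1]. *)

Definition fcons (N : nat) (t : R) (y : 'I_N -> R) : 'I_N.+1 -> R :=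
  fun i => if unlift ord0 i is Some j then y j else t.

(* [is_iterated_integral n f v]: the iterated Riemann integral
     int_{-PI}^{PI} dy_1/(2 PI) e^{i n_1 y_1} ...
       int_{-PI}^{PI} dy_N/(2 PI) e^{i n_N y_N} f(y_1, ..., y_N)
   exists (each inner integral exists for all values of the outer variables)
   and equals v. *)
Fixpoint is_iterated_integral (N : nat) :
    ('I_N -> Z) -> (('I_N -> R) -> C) -> C -> Prop :=
  match N return ('I_N -> Z) -> (('I_N -> R) -> C) -> C -> Prop with
  | 0%N => fun _ f v => v = f (fun _ => 0)
  | N'.+1 => fun n f v =>
      exists g : R -> C,
        (forall t, - PI <= t <= PI ->
           is_iterated_integral (fun j => n (lift ord0 j))
             (fun y => f (fcons t y)) (g t)) /\
        is_RInt (V := C_R_NormedModule)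
          (fun t => Cmult (Cmult (RtoC (/ (2 * PI)))
                                 (Cexp (0, IZR (n ord0) * t)))
                          (g t))
          (- PI) PI v
  end.

Definition kernel (N : nat) (lam eps : R) (x y : 'I_N -> R) : C :=
  Cdiv
    (\big[Cmult/RtoC 1]_(j < N) \big[Cmult/RtoC 1]_(k < N | (j < k)%N)
       Cpower (Cminus (RtoC 1)
                 (Cexp (- ((INR k - INR j) * eps), y j - y k))) lam)
    (\big[Cmult/RtoC 1]_(j < N) \big[Cmult/RtoC 1]_(k < N)
       Cpower (Cminus (RtoC 1)
                 (Cexp (- (INR j.+1 * eps), x k - y j))) lam).

(* The integral exists for every eps > 0 and tends to p as eps decreases
   to 0. *)
Definition is_calP (N : nat) (lam : R) (n : 'I_N -> Z) (x : 'I_N -> R)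
    (p : C) : Prop :=
  exists I : R -> C,
    (forall eps, 0 < eps ->
       is_iterated_integral n (kernel lam eps x) (I eps)) /\
    filterlim I (at_right 0) (locally (p : C_R_NormedModule)).

(* As in Coquelicot's [RInt], [iota] selects the unique value satisfying a
   predicate and is unspecified when there is none. *)
Definition calP (N : nat) (lam : R) (n : 'I_N -> Z) (x : 'I_N -> R) : C :=
  iota (T := C_R_CompleteNormedModule) (is_calP lam n x).

(* Factor by which a branch of sin(r/2)^lam may differ from |sin(r/2)|^lam. *)
Definition is_phase (sigma : R -> C) : Prop :=
  forall r : R, (forall m : Z, r <> 2 * PI * IZR m) ->
    Cmod (sigma r) = 1 /\ locally r (fun s => sigma s = sigma r).

Definition Psi0 (N : nat) (lam : R) (sigma : R -> C) (x : 'I_N -> R) : C :=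
  \big[Cmult/RtoC 1]_(j < N) \big[Cmult/RtoC 1]_(k < N | (j < k)%N)
    Cmult (RtoC (Rpower (Rabs (sin ((x k - x j) / 2))) lam))
          (sigma (x k - x j)).

Definition Fhat (N : nat) (lam : R) (sigma : R -> C) (n : 'I_N -> Z)
    (x : 'I_N -> R) : C :=
  Cmult (calP lam n x) (Psi0 lam sigma x).

Definition is_partial (N : nat) (j : 'I_N) (f : ('I_N -> R) -> C)
    (x : 'I_N -> R) (l : C) : Prop :=
  is_derive (K := R_AbsRing) (V := C_R_NormedModule)
    (fun t : R => f [eta x with j |-> t]) (x j) l.

Definition partial (N : nat) (j : 'I_N) (f : ('I_N -> R) -> C)
    (x : 'I_N -> R) : C :=
  iota (T := C_R_CompleteNormedModule) (is_partial j f x).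

Definition V (r : R) : R := / (4 * sin (r / 2) ^ 2).

Definition Ham (N : nat) (lam : R) (f : ('I_N -> R) -> C) (x : 'I_N -> R) : C :=
  Cplus
    (Copp (\big[Cplus/RtoC 0]_(j < N) partial j (partial j f) x))
    (Cmult
       (RtoC (2 * lam * (lam - 1) *
              \big[Rplus/0]_(j < N) \big[Rplus/0]_(k < N | (j < k)%N)
                V (x j - x k)))
       (f x)).

Definition distinct_mod_2pi (N : nat) (x : 'I_N -> R) : Prop :=
  forall j k : 'I_N, j <> k -> forall m : Z, x j - x k <> 2 * PI * IZR m.

Definition shiftE (N : nat) (n : 'I_N -> Z) (nu : nat) (j k : 'I_N) :
    'I_N -> Z :=
  fun l => (n l + Z.of_nat nu *
              ((if j == l then 1 else 0) - (if k == l then 1 else 0)))%Z.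

Definition En (N : nat) (lam : R) (n : 'I_N -> Z) : R :=
  \big[Rplus/0]_(j < N)
    (IZR (n j) + lam * (/ 2 * (INR N + 1) - INR j.+1)) ^ 2.

Definition gam (lam : R) : R := 2 * lam * (lam - 1).

(* The series over nu >= 1, reindexed by nu = m.+1. *)
Definition is_shift_series (N : nat) (lam : R) (sigma : R -> C)
    (n : 'I_N -> Z) (x : 'I_N -> R) (j k : 'I_N) (s : C) : Prop :=
  is_series (K := R_AbsRing) (V := C_R_NormedModule)
    (fun m : nat => Cmult (RtoC (INR m.+1))
                      (Fhat lam sigma (shiftE n m.+1 j k) x)) s.

Definition shift_series (N : nat) (lam : R) (sigma : R -> C)
    (n : 'I_N -> Z) (x : 'I_N -> R) (j k : 'I_N) : C :=
  iota (T := C_R_CompleteNormedModule) (is_shift_series lam sigma n x j k).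

(* Main.v *)
(* Regularized at any fixed [eps > 0] the integrand is a smooth periodic function of
   the integration variables [y], and translating [y] by imaginary amounts shows that
   the regularized integral depends on [eps] only through the factor
   [exp (- eps * sum_j j n_j)]. Hence P_n is, up to this factor, the integral at
   [eps = 1], and it can be differentiated under the integral sign in [x], while
   [d/dy_a] acts under it as multiplication by [- i n_a].

   Write [z_k = exp (i x_k)], [xi_j = exp (i y_j + j)]. All logarithmic derivatives of
   the kernel are sums of [c (p, q) = (q + p) / (2 (q - p))] over pairs of these 2 N
   points, and [c] satisfies the cotangent relation
   [c (a, b) c (a, c) + c (b, a) c (b, c) + c (c, a) c (c, b) = 1 / 4].
   With it, the conjugate of H by Psi_0 in the variables [x] equals, on the kernel, an
   operator of the same type in the variables [y], up to
   [- gamma sum_(j < k) u / (1 - u) ^ 2] with [u = xi_j / xi_k]. The expansion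
   [u / (1 - u) ^ 2 = sum_nu nu u ^ nu] converges uniformly as [|u| <= exp (-1)], and
   multiplying the kernel by [u ^ nu] shifts n by [nu E_jk]. *)
Require Import Defs.
From Stdlib Require Import Reals ZArith Lra Lia FunctionalExtensionality ClassicalEpsilon.
From Coquelicot Require Import Coquelicot.
From HB Require Import structures.
From mathcomp Require Import ssreflect ssrfun ssrbool eqtype ssrnat fintype bigop.

Local Open Scope R_scope.

(** As [eps] tends to 0 the denominator of the kernel acquires zeros on the domain of integration,
    so no estimate is attempted inside the limit. At [eps = 1] every exponent has real part at most
    -1: the bases of all powers stay in the half-plane Re > 0, away from the branch cut, and every
    bound is uniform in [y]. Differentiation under the iterated integral rests on Taylor remainders
    of size [D * s ^ 2] with one [D] for all [y]; such a bound survives integration because each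
    normalized weight has total mass one. Origin of E_n: the geometric term u / (1 - u) equals c -
    1/2, and the halves collected at the index a add up to s_a = (N + 1) / 2 - a. The operator in
    [y] is therefore - sum_a (d/dy_a - i lam s_a)^2, which integration by parts turns into sum_a
    (n_a + lam s_a)^2. Origin of gamma: when that operator acts on the kernel, u / (1 - u)^2 appears
    once per pair with coefficient 2 lam^2 from the squares of logarithmic derivatives and - 2 lam
    from their derivatives. *)

HB.instance Definition _ :=
  Monoid.isComLaw.Build C (RtoC 0) Cplus Cplus_assoc Cplus_comm Cplus_0_l.
HB.instance Definition _ :=
  Monoid.isComLaw.Build R 0 Rplus
    (fun a b c => esym (Rplus_assoc a b c)) Rplus_comm Rplus_0_l.
HB.instance Definition _ :=
  Monoid.isComLaw.Build C (RtoC 1) Cmult Cmult_assoc Cmult_comm Cmult_1_l.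
HB.instance Definition _ :=
  Monoid.isMulLaw.Build C (RtoC 0) Cmult Cmult_0_l Cmult_0_r.
HB.instance Definition _ :=
  Monoid.isAddLaw.Build C Cmult Cplus Cmult_plus_distr_r Cmult_plus_distr_l.

(** * Complex-valued functions of a real variable *)

Ltac cring := lazymatch goal with |- ?a = ?b => change (@eq C a b); ring end.

Lemma norm_C (z : C_R_NormedModule) : norm z = Cmod z.
Proof.
rewrite /norm /= /prod_norm /Cmod /=; congr sqrt.
by rewrite -!/(Rsqr _) /norm /= /abs /= !Rmult_1_r -!/(Rsqr _) -!Rsqr_abs.
Qed.

Lemma Cmod_le_add (z : C) : Cmod z <= Rabs (fst z) + Rabs (snd z).
Proof.
have p1 := Rabs_pos (fst z); have p2 := Rabs_pos (snd z).
rewrite -[X in _ <= X]sqrt_Rsqr; last by lra.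
apply: sqrt_le_1_alt; rewrite -!Rsqr_pow2 (Rsqr_abs (fst z)) (Rsqr_abs (snd z)) /Rsqr.
nra.
Qed.

Lemma Cmod_triangle_sub (a b : C) : Cmod (Cminus a b) <= Cmod a + Cmod b.
Proof. by rewrite -(Cmod_opp b); exact: Cmod_triangle. Qed.

Lemma Cexp_add (a b : C) : Cexp (Cplus a b) = Cmult (Cexp a) (Cexp b).
Proof.
by rewrite /Cexp /Cmult /Re /Im /= exp_plus cos_plus sin_plus; congr pair; ring.
Qed.

Lemma Cexp_0 : Cexp (RtoC 0) = RtoC 1.
Proof. by rewrite /Cexp /= exp_0 cos_0 sin_0 /RtoC; congr pair; ring. Qed.

Lemma Cmod_Cexp (a : C) : Cmod (Cexp a) = exp (Re a).
Proof.
rewrite /Cmod /Cexp /=.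
have h := exp_pos (Re a); have h2 := sin2_cos2 (Im a); rewrite /Rsqr in h2.
rewrite -[RHS]sqrt_Rsqr; last by lra.
congr sqrt; rewrite /Rsqr; set e := exp _ in h *.
transitivity (e * e * (sin (Im a) * sin (Im a) + cos (Im a) * cos (Im a))); first by ring.
rewrite h2; ring.
Qed.

Lemma Cexp_neq0 (a : C) : Cexp a <> RtoC 0.
Proof.
move=> h; have := Cmod_Cexp a; rewrite h Cmod_0 => h'.
have := exp_pos (Re a); lra.
Qed.

Lemma Cexp_opp (a : C) : Cexp (Copp a) = Cinv (Cexp a).
Proof.
have h := Cexp_neq0 a; have := Cexp_add a (Copp a).
rewrite Cplus_opp_r Cexp_0 => h2.
by rewrite -[LHS]Cmult_1_l -(Cinv_l _ h) -Cmult_assoc -h2 Cmult_1_r.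
Qed.

Lemma Cexp_2PI_period (r t : R) (m : Z) : Cexp (r, t + 2 * PI * IZR m) = Cexp (r, t).
Proof.
rewrite /Cexp /=.
have hn (k : nat) u : cos (u + 2 * PI * INR k) = cos u /\ sin (u + 2 * PI * INR k) = sin u.
  rewrite -(cos_period u k) -(sin_period u k).
  by split; congr (_ _); ring.
case: (Z_le_gt_dec 0 m) => hm.
  case: (hn (Z.to_nat m) t); rewrite INR_IZR_INZ Z2Nat.id // => -> ->; by [].
case: (hn (Z.to_nat (- m)%Z) (t + 2 * PI * IZR m)).
rewrite INR_IZR_INZ Z2Nat.id; last by lia.
rewrite opp_IZR.
have -> : t + 2 * PI * IZR m + 2 * PI * - IZR m = t by ring.
by move=> -> ->.
Qed.

Local Notation cderive := (is_derive (K := R_AbsRing) (V := C_R_NormedModule)).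

Lemma cderive_fst {f : R -> C} {t : R} {l : C} :
  cderive f t l -> is_derive (fun s => fst (f s)) t (fst l).
Proof.
move=> h; apply: (filterdiff_comp f fst _ fst h).
exact: filterdiff_linear (is_linear_fst).
Qed.

Lemma cderive_snd {f : R -> C} {t : R} {l : C} :
  cderive f t l -> is_derive (fun s => snd (f s)) t (snd l).
Proof.
move=> h; apply: (filterdiff_comp f snd _ snd h).
exact: filterdiff_linear (is_linear_snd).
Qed.

Lemma cderive_pair {f g : R -> R} {t a b : R} :
  is_derive f t a -> is_derive g t b ->
  cderive (fun s => (f s, g s) : C) t ((a, b) : C).
Proof.
move=> hf hg.
apply: (filterdiff_comp_2 f g (fun x y => (x, y)) _ _ (fun x y => (x, y)) hf hg).
apply: (filterdiff_ext_lin _ (fun t => t)); last by case.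
apply: (filterdiff_ext_loc (fun t => t)); first by apply: filter_forall; case.
- by case.
- exact: filterdiff_id.
Qed.

Lemma cderive_eq {f : R -> C} {t : R} {l l' : C} : cderive f t l -> l = l' -> cderive f t l'.
Proof. by move=> h <-. Qed.

Lemma cderive_mult {f g : R -> C} {t : R} {a b : C} :
  cderive f t a -> cderive g t b ->
  cderive (fun s => Cmult (f s) (g s)) t (Cplus (Cmult a (g t)) (Cmult (f t) b)).
Proof.
move=> hf hg.
have [f1 f2] := (cderive_fst hf, cderive_snd hf).
have [g1 g2] := (cderive_fst hg, cderive_snd hg).
have hm u v t0 a0 b0 : is_derive u t0 a0 -> is_derive v t0 b0 ->
    is_derive (fun s => u s * v s) t0 (a0 * v t0 + u t0 * b0).
  by move=> hu hv; apply: (is_derive_mult u v) => // x y; rewrite /mult /=; ring.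
apply: (@cderive_eq _ _ (_, _) _ (cderive_pair
  (is_derive_minus _ _ _ _ _ (hm _ _ _ _ _ f1 g1) (hm _ _ _ _ _ f2 g2))
  (is_derive_plus _ _ _ _ _ (hm _ _ _ _ _ f1 g2) (hm _ _ _ _ _ f2 g1)))).
rewrite /Cplus /Cmult /= /minus /plus /opp /=; congr pair; ring.
Qed.

Lemma cderive_plus {f g : R -> C} {t : R} {a b : C} :
  cderive f t a -> cderive g t b ->
  cderive (fun s => Cplus (f s) (g s)) t (Cplus a b).
Proof. exact: (@is_derive_plus R_AbsRing C_R_NormedModule). Qed.

Lemma cderive_const (a : C) (t : R) : cderive (fun _ => a) t (RtoC 0).
Proof. exact: (@is_derive_const R_AbsRing C_R_NormedModule). Qed.

Lemma cderive_scal {f : R -> C} {t : R} {l : C} (a : C) :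
  cderive f t l -> cderive (fun s => Cmult a (f s)) t (Cmult a l).
Proof.
move=> h; apply: (cderive_eq (cderive_mult (cderive_const a t) h)).
by rewrite Cmult_0_l Cplus_0_l.
Qed.

Lemma cderive_Cexp {g : R -> C} {t : R} {l : C} :
  cderive g t l -> cderive (fun s => Cexp (g s)) t (Cmult l (Cexp (g t))).
Proof.
move=> hg; have [g1 g2] := (cderive_fst hg, cderive_snd hg).
have e1 := is_derive_comp exp _ _ _ _ (is_derive_exp _) g1.
have e2 := is_derive_comp cos _ _ _ _ (is_derive_cos _) g2.
have e3 := is_derive_comp sin _ _ _ _ (is_derive_sin _) g2.
have hm u v t0 a0 b0 : is_derive u t0 a0 -> is_derive v t0 b0 ->
    is_derive (fun s => u s * v s) t0 (a0 * v t0 + u t0 * b0).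
  by move=> hu hv; apply: (is_derive_mult u v) => // x y; rewrite /mult /=; ring.
apply: (cderive_eq (cderive_pair (hm _ _ _ _ _ e1 e2) (hm _ _ _ _ _ e1 e3))).
by rewrite /Cexp /Cmult /Re /Im /scal /= /mult /=; congr pair; ring.
Qed.

Lemma cderive_affine (z c : C) (t : R) :
  cderive (fun s => Cplus z (Cmult (RtoC s) c)) t c.
Proof.
have h : cderive (fun s => RtoC s) t (RtoC 1).
  apply: cderive_pair; [exact: is_derive_id | exact: is_derive_const].
apply: (cderive_eq (cderive_plus (cderive_const z t)
  (cderive_mult h (cderive_const c t)))).
by rewrite Cmult_0_r Cmult_1_l Cplus_0_r Cplus_0_l.
Qed.

(** The mean value inequality is applied to the real and imaginary parts separately, which costs the
    factor 2. *)
Lemma cderive_bound {h dh : R -> C} {D x y : R} :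
  (forall t, Rabs (t - x) <= Rabs (y - x) ->
     cderive h t (dh t) /\ Cmod (dh t) <= D) ->
  Cmod (Cminus (h y) (h x)) <= 2 * D * Rabs (y - x).
Proof.
move=> H.
apply: Rle_trans (Cmod_le_add _) _.
have h1 : Rabs (fst (h y) - fst (h x)) <= D * Rabs (y - x).
  apply: (bounded_variation (fun s => fst (h s)) (fun s => fst (dh s))) => t /H [d b].
  split; first exact: cderive_fst d.
  apply: Rle_trans b; apply: Rle_trans (Rmax_Cmod _); exact: Rmax_l.
have h2 : Rabs (snd (h y) - snd (h x)) <= D * Rabs (y - x).
  apply: (bounded_variation (fun s => snd (h s)) (fun s => snd (dh s))) => t /H [d b].
  split; first exact: cderive_snd d.
  apply: Rle_trans b; apply: Rle_trans (Rmax_Cmod _); exact: Rmax_r.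
rewrite /Cminus /Cplus /= -!/(Rminus _ _); lra.
Qed.

(** [cderive_bound] is used twice, once for [dh] and once for [h] minus its linear part; the two
    factors 2 make the 4. The constant depends on [h] only through [D], so one bound can serve a
    whole family. *)
Lemma cderive_taylor {h dh ddh : R -> C} {D eta s : R} :
  (forall t, Rabs t <= eta ->
     [/\ cderive h t (dh t), cderive dh t (ddh t) & Cmod (ddh t) <= D]) ->
  Rabs s <= eta ->
  Cmod (Cminus (Cminus (h s) (h 0)) (Cmult (RtoC s) (dh 0))) <= 4 * D * s ^ 2.
Proof.
move=> H hs.
have hb t : Rabs t <= Rabs s -> Cmod (Cminus (dh t) (dh 0)) <= 2 * D * Rabs s.
  move=> ht.
  have D0 : 0 <= D.
    have [|_ _ hc] := H 0; first by rewrite Rabs_R0; have := Rabs_pos s; lra.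
    have := Cmod_ge_0 (ddh 0); lra.
  apply: Rle_trans (@cderive_bound dh ddh D 0 t _) _.
    move=> u; rewrite !Rminus_0_r => hu.
    by have [|_ ? ?] := H u; first lra.
  rewrite Rminus_0_r; apply: Rmult_le_compat_l; lra.
have := @cderive_bound (fun t => Cminus (h t) (Cmult (RtoC t) (dh 0)))
  (fun t => Cminus (dh t) (dh 0)) (2 * D * Rabs s) 0 s.
have -> : Cminus (Cminus (h s) (Cmult (RtoC s) (dh 0)))
     (Cminus (h 0) (Cmult (RtoC 0) (dh 0))) =
   Cminus (Cminus (h s) (h 0)) (Cmult (RtoC s) (dh 0)) by ring.
move=> h1; apply: Rle_trans (h1 _) _.
  move=> t; rewrite !Rminus_0_r => ht; split; last exact: hb.
  have [|d _ _] := H t; first lra.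
  apply: (is_derive_ext (fun s => Cplus (h s) (Cplus (RtoC 0) (Cmult (RtoC s) (Copp (dh 0)))))).
    by move=> u; cring.
  exact: (cderive_plus d (cderive_affine (RtoC 0) (Copp (dh 0)) t)).
rewrite Rminus_0_r -(Rsqr_pow2 s) (Rsqr_abs s) /Rsqr; apply: Req_le; ring.
Qed.

(** * Powers of [1 - exp z] and their flows *)

(** Every factor of the kernel is of this form, with [a = lam] in the numerator and [a = - lam] for
    the denominator. *)
Definition psi (a : R) (z : C) : C := Cpower (Cminus (RtoC 1) (Cexp z)) a.

(** With u = exp z this is u / (1 - u), minus the logarithmic derivative of 1 - exp z. Its
    derivative is geo + geo^2 = u / (1 - u)^2, the combination that recurs below. *)
Definition geo (z : C) : C := Cdiv (Cexp z) (Cminus (RtoC 1) (Cexp z)).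

Lemma Carg_atan (z : C) : 0 < Re z -> Carg z = atan (Im z / Re z).
Proof.
case: z => p q; rewrite /Carg /Cmod /= => hp.
set m := sqrt _.
have hm2 : m * m = p * p + q * q.
  by rewrite /m sqrt_sqrt; [ring | nra].
have hm : 0 < m by apply: sqrt_lt_R0; nra.
have hac : acos (p / m) = atan (Rabs q / p).
  rewrite acos_atan; last exact: Rdiv_lt_0_compat.
  congr atan.
  have -> : 1 - (p / m)² = (q / m)².
    rewrite /Rsqr; apply: (Rmult_eq_reg_r (m * m)); last nra.
    have -> : (1 - p / m * (p / m)) * (m * m) = m * m - p * p by field; lra.
    have -> : q / m * (q / m) * (m * m) = q * q by field; lra.
    lra.
  rewrite sqrt_Rsqr_abs /Rdiv Rabs_mult (Rabs_pos_eq (/ m)).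
    by field; split; lra.
  by left; exact: Rinv_0_lt_compat.
rewrite hac; case: Rle_dec => hq.
  by rewrite Rabs_pos_eq.
rewrite -atan_opp Rabs_left; last lra.
congr atan; field; lra.
Qed.

(** On the right half-plane the principal logarithm has the smooth components ln |z| and atan (Im z
    / Re z), so the power can be differentiated by the chain rule. *)
Lemma Cpower_Cexp (z : C) (a : R) : 0 < Re z ->
  Cpower z a = Cexp (Cmult (RtoC a) (ln (Cmod z), atan (Im z / Re z))).
Proof.
move=> hz; rewrite /Cpower Carg_atan // /Cexp /Rpower /Cmult /RtoC /= exp_0.
congr pair.
  by rewrite !Rmult_0_l !Rminus_0_r Rplus_0_r; ring.
by rewrite !Rmult_0_l Rminus_0_r !Rplus_0_r; ring.
Qed.

Lemma Cmod_Cpower (z : C) (a : R) : Cmod (Cpower z a) = Rpower (Cmod z) a.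
Proof.
rewrite /Cpower Cmod_mult Cmod_Cexp /= exp_0 Rmult_1_r Cmod_R Rabs_pos_eq //.
by left; exact: exp_pos.
Qed.

Lemma Cpower_opp (z : C) (a : R) : Cpower z (- a) = Cinv (Cpower z a).
Proof.
rewrite /Cpower; have -> : (0, - a * Carg z) = Copp (0, a * Carg z) :> C.
  by rewrite /Copp /=; congr pair; ring.
have h : Rpower (Cmod z) a <> 0 by apply: Rgt_not_eq; exact: exp_pos.
rewrite Cexp_opp Rpower_Ropp RtoC_inv //.
have h2 := Cexp_neq0 (0, a * Carg z).
by field; split=> //; move=> /RtoC_inj.
Qed.

Lemma is_derive_ln_norm (u v : R -> R) (t a b : R) :
  is_derive u t a -> is_derive v t b -> 0 < u t ->
  is_derive (fun s => ln (sqrt (u s ^ 2 + v s ^ 2))) t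
    ((u t * a + v t * b) / (u t ^ 2 + v t ^ 2)).
Proof.
move=> hu hv hp.
have h2 : 0 < u t ^ 2 + v t ^ 2 by nra.
have hs := sqrt_lt_R0 _ h2.
auto_derive.
  split; first by exists a.
  split; first by exists b.
  by rewrite -!/(pow _ 2) in hs *.
rewrite (is_derive_unique _ _ _ hu) (is_derive_unique _ _ _ hv).
have hs2 := sqrt_sqrt _ (Rlt_le _ _ h2).
rewrite /= in hs hs2 *.
set w := sqrt _ in hs hs2 *.
have -> : u t * (u t * 1) + v t * (v t * 1) = w * w by [].
field; lra.
Qed.

Lemma is_derive_atan_div (u v : R -> R) (t a b : R) :
  is_derive u t a -> is_derive v t b -> 0 < u t ->
  is_derive (fun s => atan (v s / u s)) t
    ((u t * b - v t * a) / (u t ^ 2 + v t ^ 2)).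
Proof.
move=> hu hv hp; auto_derive.
  split; first by exists b.
  split; first by exists a.
  by split=> //; lra.
rewrite (is_derive_unique _ _ _ hu) (is_derive_unique _ _ _ hv).
field; split; nra.
Qed.

Lemma is_derive_div_norm2 (u v : R -> R) (t a b : R) :
  is_derive u t a -> is_derive v t b -> u t ^ 2 + v t ^ 2 <> 0 ->
  is_derive (fun s => u s / (u s ^ 2 + v s ^ 2)) t
    ((a * (v t ^ 2 - u t ^ 2) - 2 * u t * v t * b) / (u t ^ 2 + v t ^ 2) ^ 2).
Proof.
move=> hu hv hp; have hua : ex_derive u t by exists a.
have hvb : ex_derive v t by exists b.
auto_derive; first by repeat split.
rewrite (is_derive_unique _ _ _ hu) (is_derive_unique _ _ _ hv).
by field.
Qed.

Lemma cderive_Cpower (f : R -> C) (t : R) (l : C) (a : R) :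
  0 < Re (f t) -> cderive f t l ->
  cderive (fun s => Cpower (f s) a) t
    (Cmult (Cmult (RtoC a) (Cdiv l (f t))) (Cpower (f t) a)).
Proof.
move=> hp hf; have [f1 f2] := (cderive_fst hf, cderive_snd hf).
have hloc : locally t (fun s => 0 < Re (f s)).
  have c1 := ex_derive_continuous _ _ (ex_intro _ _ f1).
  exact: (c1 (fun u => 0 < u) (open_gt 0 _ hp)).
apply: (is_derive_ext_loc (fun s => Cexp (Cmult (RtoC a)
   (ln (Cmod (f s)), atan (Im (f s) / Re (f s)))))).
  by apply: filter_imp hloc => s hs; rewrite Cpower_Cexp.
have dln := is_derive_ln_norm _ _ _ _ _ f1 f2 hp.
have dat := is_derive_atan_div _ _ _ _ _ f1 f2 hp.
apply: (cderive_eq (cderive_Cexp (cderive_scal (RtoC a) (cderive_pair dln dat)))).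
rewrite -Cpower_Cexp //; congr Cmult; congr Cmult.
rewrite /Cdiv /Cinv /Cmult /=.
by congr pair; field; rewrite /Re in hp; nra.
Qed.

Lemma Re_one_minus_Cexp (z : C) : Re z < 0 -> 0 < Re (Cminus (RtoC 1) (Cexp z)).
Proof.
move=> hz; rewrite /Re /= -/(Re z).
have h1 : exp (Re z) < 1 by rewrite -exp_0; exact: exp_increasing.
have h2 := exp_pos (Re z); have [h3 h4] := COS_bound (Im z); nra.
Qed.

Lemma one_minus_Cexp_neq0 {z : C} : Re z < 0 -> Cminus (RtoC 1) (Cexp z) <> RtoC 0.
Proof. by move=> /Re_one_minus_Cexp h h0; rewrite h0 /= in h; lra. Qed.

Lemma cderive_one_minus_Cexp (z c : C) (t : R) :
  cderive (fun s => Cminus (RtoC 1) (Cexp (Cplus z (Cmult (RtoC s) c)))) t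
    (Copp (Cmult c (Cexp (Cplus z (Cmult (RtoC t) c))))).
Proof.
apply: (is_derive_ext (fun s => Cplus (RtoC 1)
   (Cmult (Copp (RtoC 1)) (Cexp (Cplus z (Cmult (RtoC s) c)))))).
  by move=> s; cring.
apply: (cderive_eq (cderive_plus (cderive_const (RtoC 1) t)
  (cderive_scal (Copp (RtoC 1)) (cderive_Cexp (cderive_affine z c t))))).
by cring.
Qed.

Lemma cderive_psi (a : R) (z c : C) (t : R) :
  Re (Cplus z (Cmult (RtoC t) c)) < 0 ->
  cderive (fun s => psi a (Cplus z (Cmult (RtoC s) c))) t
    (Cmult (Cmult (Copp (Cmult (RtoC a) c)) (geo (Cplus z (Cmult (RtoC t) c))))
       (psi a (Cplus z (Cmult (RtoC t) c)))).
Proof.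
move=> hz; apply: (cderive_eq (cderive_Cpower _ _ _ a (Re_one_minus_Cexp _ hz)
  (cderive_one_minus_Cexp z c t))).
have h := one_minus_Cexp_neq0 hz.
by rewrite /psi /geo; congr Cmult; field.
Qed.

Lemma cderive_inv {f : R -> C} {t : R} {l : C} :
  f t <> RtoC 0 -> cderive f t l ->
  cderive (fun s => Cinv (f s)) t (Copp (Cdiv l (Cmult (f t) (f t)))).
Proof.
move=> h0 hf; have [f1 f2] := (cderive_fst hf, cderive_snd hf).
have hm : fst (f t) ^ 2 + snd (f t) ^ 2 <> 0.
  move=> h; apply: h0; rewrite [LHS]surjective_pairing.
  have -> : fst (f t) = 0 by nra.
  by have -> : snd (f t) = 0 by nra.
have hm' : snd (f t) ^ 2 + fst (f t) ^ 2 <> 0 by rewrite Rplus_comm.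
have d2 := is_derive_opp _ _ _ (is_derive_div_norm2 _ _ _ _ _ f2 f1 hm').
apply: (is_derive_ext (fun s => (fst (f s) / (fst (f s) ^ 2 + snd (f s) ^ 2),
    - (snd (f s) / (snd (f s) ^ 2 + fst (f s) ^ 2))) : C)).
  by move=> s; rewrite /Cinv Rplus_comm (Rplus_comm (snd _ ^ 2)) -Rdiv_opp_l.
apply: (cderive_eq (cderive_pair (is_derive_div_norm2 _ _ _ _ _ f1 f2 hm) d2)).
rewrite /Cdiv /Cinv /Cmult /Copp /opp /=; congr pair; field; split=> //; nra.
Qed.

Lemma cderive_geo (z c : C) (t : R) :
  Re (Cplus z (Cmult (RtoC t) c)) < 0 ->
  cderive (fun s => geo (Cplus z (Cmult (RtoC s) c))) t
    (let g := geo (Cplus z (Cmult (RtoC t) c)) in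
     Cmult c (Cplus g (Cmult g g))).
Proof.
move=> hz.
have h := one_minus_Cexp_neq0 hz.
apply: (cderive_eq (cderive_mult (cderive_Cexp (cderive_affine z c t))
  (cderive_inv h (cderive_one_minus_Cexp z c t)))).
by rewrite /geo /=; lazymatch goal with |- ?a = ?b => change (@eq C a b) end; field.
Qed.

(** With q = exp (- d), the modulus of 1 - exp z lies between 1 - q and 2. Bounding the absolute
    value of its logarithm by [k] covers both signs of [a] at once. *)
Lemma psi_geo_bound (a d : R) : 0 < d -> exists M : R, 0 <= M /\
  forall z : C, Re z <= - d -> Cmod (psi a z) <= M /\ Cmod (geo z) <= M.
Proof.
move=> hd; set q := exp (- d).
have hq : 0 < q < 1.
  split; first exact: exp_pos.
  by rewrite /q -exp_0; apply: exp_increasing; lra.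
set k := Rabs (ln (1 - q)) + Rabs (ln 2).
exists (Rmax (exp (Rabs a * k)) (/ (1 - q))).
have hk : 0 <= Rmax (exp (Rabs a * k)) (/ (1 - q)).
  by apply: Rle_trans (Rmax_l _ _); left; exact: exp_pos.
split=> // z hz.
have he : Cmod (Cexp z) <= q.
  by rewrite Cmod_Cexp; case: hz => [h|->]; [left; apply: exp_increasing | right].
have hlow : 1 - q <= Cmod (Cminus (RtoC 1) (Cexp z)).
  have := Cmod_triangle (Cminus (RtoC 1) (Cexp z)) (Cexp z).
  have -> : Cplus (Cminus (RtoC 1) (Cexp z)) (Cexp z) = RtoC 1 by ring.
  rewrite Cmod_1; lra.
have hup : Cmod (Cminus (RtoC 1) (Cexp z)) <= 2.
  by apply: Rle_trans (Cmod_triangle_sub _ _) _; rewrite Cmod_1; lra.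
split.
  apply: Rle_trans (Rmax_l _ _).
  rewrite /psi Cmod_Cpower /Rpower.
  have hln : Rabs (ln (Cmod (Cminus (RtoC 1) (Cexp z)))) <= k.
    have l1 : ln (1 - q) <= ln (Cmod (Cminus (RtoC 1) (Cexp z))).
      by apply: ln_le; lra.
    have l2 : ln (Cmod (Cminus (RtoC 1) (Cexp z))) <= ln 2 by apply: ln_le; lra.
    have := Rabs_maj2 (ln (1 - q)); have := Rle_abs (ln 2).
    have := Rabs_pos (ln (1 - q)); have := Rabs_pos (ln 2).
    by rewrite /k => *; apply: Rabs_le; lra.
  have h : a * ln (Cmod (Cminus (RtoC 1) (Cexp z))) <= Rabs a * k.
    apply: Rle_trans (Rle_abs _) _; rewrite Rabs_mult.
    by apply: Rmult_le_compat_l => //; exact: Rabs_pos.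
  by case: h => [h|->]; [left; apply: exp_increasing | right].
apply: Rle_trans (Rmax_r _ _).
have h0 : Cminus (RtoC 1) (Cexp z) <> RtoC 0 by apply: one_minus_Cexp_neq0; lra.
rewrite /geo Cmod_div // -[X in _ <= X]Rmult_1_l.
apply: Rmult_le_compat; [exact: Cmod_ge_0 | | lra |].
  by left; apply: Rinv_0_lt_compat; lra.
by apply: Rinv_le_contravar; lra.
Qed.

(** * Uniform differentiation of families *)

(** A derivative at s = 0 whose quadratic remainder is uniform in the parameter. The bounds on [f 0]
    and [f'] are included so that the notion is stable under products. *)
Definition unif_deriv {Y : Type} (f : R -> Y -> C) (f' : Y -> C) : Prop :=
  exists D eta : R, [/\ 0 <= D, 0 < eta & forall y : Y,
    [/\ Cmod (f 0 y) <= D, Cmod (f' y) <= D &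
      forall s : R, Rabs s <= eta ->
        Cmod (Cminus (Cminus (f s y) (f 0 y)) (Cmult (RtoC s) (f' y))) <= D * s ^ 2]].

Lemma unif_deriv_eq {Y : Type} {f g : R -> Y -> C} {f' g' : Y -> C} :
  unif_deriv f f' -> (forall s y, f s y = g s y) -> (forall y, f' y = g' y) ->
  unif_deriv g g'.
Proof.
by move=> [D [eta [h1 h2 H]]] e e'; exists D, eta; split=> // y;
   have [a b c] := H y; rewrite -!e -e'; split=> // s hs; rewrite -!e; exact: c.
Qed.

Lemma unif_deriv_const {Y : Type} (c : C) :
  unif_deriv (fun _ (_ : Y) => c) (fun _ => RtoC 0).
Proof.
exists (Cmod c), 1; split; [exact: Cmod_ge_0 | lra |] => y; split.
- exact: Rle_refl.
- rewrite Cmod_0; exact: Cmod_ge_0.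
move=> s _; have -> : Cminus (Cminus c c) (Cmult (RtoC s) (RtoC 0)) = RtoC 0 by ring.
rewrite Cmod_0; apply: Rmult_le_pos; [exact: Cmod_ge_0 | nra].
Qed.

Lemma unif_deriv_plus {Y : Type} {f g : R -> Y -> C} {f' g' : Y -> C} :
  unif_deriv f f' -> unif_deriv g g' ->
  unif_deriv (fun s y => Cplus (f s y) (g s y)) (fun y => Cplus (f' y) (g' y)).
Proof.
move=> [D [e [D0 e0 F]]] [D' [e' [D0' e0' G]]].
exists (D + D'), (Rmin e e'); split; [lra | exact: Rmin_pos |] => y.
have [f1 f2 f3] := F y; have [g1 g2 g3] := G y; split.
- apply: Rle_trans (Cmod_triangle _ _) _; lra.
- apply: Rle_trans (Cmod_triangle _ _) _; lra.
move=> s hs.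
have F3 := f3 s (Rle_trans _ _ _ hs (Rmin_l _ _)).
have G3 := g3 s (Rle_trans _ _ _ hs (Rmin_r _ _)).
set u := Cminus _ _ in F3; set v := Cminus _ _ in G3.
have -> : Cminus (Cminus (Cplus (f s y) (g s y)) (Cplus (f 0 y) (g 0 y)))
   (Cmult (RtoC s) (Cplus (f' y) (g' y))) = Cplus u v by rewrite /u /v; ring.
apply: Rle_trans (Cmod_triangle _ _) _; lra.
Qed.

Lemma unif_deriv_mult {Y : Type} {f g : R -> Y -> C} {f' g' : Y -> C} :
  unif_deriv f f' -> unif_deriv g g' ->
  unif_deriv (fun s y => Cmult (f s y) (g s y))
    (fun y => Cplus (Cmult (f' y) (g 0 y)) (Cmult (f 0 y) (g' y))).
Proof.
move=> [D [e [D0 e0 F]]] [D' [e' [D0' e0' G]]].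
(* For |s| <= 1 the remainder of [g] is at most D' |s| and [g s] at most 3 D'. The four error terms
   then contribute at most 3, 1, 1 and 1 times D D' s^2, which 8 D D' covers. *)
exists (8 * D * D'), (Rmin 1 (Rmin e e')); split.
- apply: Rmult_le_pos => //; lra.
- apply: Rmin_pos; [lra | exact: Rmin_pos].
move=> y.
have DD : 0 <= D * D' by exact: Rmult_le_pos.
have bm (a b : C) A B : Cmod a <= A -> Cmod b <= B -> Cmod (Cmult a b) <= A * B.
  by move=> *; rewrite Cmod_mult; apply: Rmult_le_compat => //; exact: Cmod_ge_0.
have [f1 f2 f3] := F y; have [g1 g2 g3] := G y; split.
- have := bm _ _ _ _ f1 g1; lra.
- apply: Rle_trans (Cmod_triangle _ _) _.
  have := bm _ _ _ _ f1 g2; have := bm _ _ _ _ f2 g1; lra.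
move=> s hs.
have hs1 := Rle_trans _ _ _ hs (Rmin_l _ _).
have hs2 := Rle_trans _ _ _ hs (Rmin_r _ _).
have F3 := f3 s (Rle_trans _ _ _ hs2 (Rmin_l _ _)).
have G3 := g3 s (Rle_trans _ _ _ hs2 (Rmin_r _ _)).
set u := Cminus _ _ in F3; set v := Cminus _ _ in G3.
have hv : Cmod v <= D' * Rabs s.
  apply: Rle_trans G3 _; rewrite -Rsqr_pow2 Rsqr_abs /Rsqr.
  by apply: Rmult_le_compat_l => //; have := Rabs_pos s; nra.
have hs0 : Cmod (RtoC s) <= Rabs s by rewrite Cmod_R; lra.
have G4 : Cmod (g s y) <= 3 * D'.
  have -> : g s y = Cplus (Cplus (g 0 y) (Cmult (RtoC s) (g' y))) v by rewrite /v; ring.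
  apply: Rle_trans (Cmod_triangle _ _) _.
  have := Cmod_triangle (g 0 y) (Cmult (RtoC s) (g' y)).
  have := bm _ _ _ _ hs0 g2; have := Rabs_pos s; nra.
have -> : Cminus (Cminus (Cmult (f s y) (g s y)) (Cmult (f 0 y) (g 0 y)))
    (Cmult (RtoC s) (Cplus (Cmult (f' y) (g 0 y)) (Cmult (f 0 y) (g' y)))) =
  Cplus (Cplus (Cmult u (g s y)) (Cmult (f 0 y) v))
    (Cplus (Cmult (Cmult (RtoC s) (RtoC s)) (Cmult (f' y) (g' y)))
       (Cmult (Cmult (RtoC s) (f' y)) v)).
  by rewrite /u /v; ring.
have b1 := bm _ _ _ _ F3 G4.
have b2 := bm _ _ _ _ f1 G3.
have b3 := bm _ _ _ _ (bm _ _ _ _ hs0 hs0) (bm _ _ _ _ f2 g2).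
have b4 := bm _ _ _ _ (bm _ _ _ _ hs0 f2) hv.
have hss : Rabs s * Rabs s = s ^ 2 by rewrite -Rsqr_pow2 Rsqr_abs.
apply: Rle_trans (Cmod_triangle _ _) _.
apply: Rle_trans (Rplus_le_compat _ _ _ _ (Cmod_triangle _ _) (Cmod_triangle _ _)) _.
apply: Rle_trans (Rplus_le_compat _ _ _ _ (Rplus_le_compat _ _ _ _ b1 b2)
  (Rplus_le_compat _ _ _ _ b3 b4)) _.
rewrite hss; have -> : Rabs s * D * (D' * Rabs s) = D * D' * s ^ 2 by rewrite -hss; ring.
have : 0 <= s ^ 2 by nra.
nra.
Qed.

Lemma unif_deriv_scal {Y : Type} {f : R -> Y -> C} {f' : Y -> C} (c : C) :
  unif_deriv f f' -> unif_deriv (fun s y => Cmult c (f s y)) (fun y => Cmult c (f' y)).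
Proof.
move=> h; apply: (unif_deriv_eq (unif_deriv_mult (unif_deriv_const c) h)) => // y.
by rewrite Cmult_0_l Cplus_0_l.
Qed.

Lemma unif_deriv_sum {Y I : Type} (r : seq.seq I) (P : pred I)
    (f : I -> R -> Y -> C) (f' : I -> Y -> C) :
  (forall i, P i -> unif_deriv (f i) (f' i)) ->
  unif_deriv (fun s y => \big[Cplus/RtoC 0]_(i <- r | P i) f i s y)
    (fun y => \big[Cplus/RtoC 0]_(i <- r | P i) f' i y).
Proof.
move=> H; elim: r => [|i r IH].
  apply: (unif_deriv_eq (unif_deriv_const (RtoC 0))) => [s y|y]; by rewrite big_nil.
case hP: (P i); last first.
  by apply: (unif_deriv_eq IH) => [s y|y]; rewrite big_cons hP.
by apply: (unif_deriv_eq (unif_deriv_plus (H i hP) IH)) => [s y|y]; rewrite big_cons hP.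
Qed.

(** Derivatives are kept in logarithmic form, so a product of factors gives the sum of the [g i] and
    no product with an omitted factor ever has to be written. *)
Lemma unif_deriv_prod {Y I : Type} (r : seq.seq I) (P : pred I)
    (f : I -> R -> Y -> C) (g : I -> Y -> C) :
  (forall i, P i -> unif_deriv (f i) (fun y => Cmult (g i y) (f i 0 y))) ->
  unif_deriv (fun s y => \big[Cmult/RtoC 1]_(i <- r | P i) f i s y)
    (fun y => Cmult (\big[Cplus/RtoC 0]_(i <- r | P i) g i y)
       (\big[Cmult/RtoC 1]_(i <- r | P i) f i 0 y)).
Proof.
move=> H; elim: r => [|i r IH].
  apply: (unif_deriv_eq (unif_deriv_const (RtoC 1))) => [s y|y]; rewrite !big_nil //.
  by rewrite Cmult_0_l.
case hP: (P i); last first.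
  by apply: (unif_deriv_eq IH) => [s y|y]; rewrite !big_cons hP.
apply: (unif_deriv_eq (unif_deriv_mult (H i hP) IH)) => [s y|y]; rewrite !big_cons hP //=.
ring.
Qed.

(** The step length moves the real part by at most d / 2; the [+ 1] keeps the quotient meaningful
    when c = 0. *)
Lemma Re_flow (z c : C) (d s : R) : Re z <= - d -> Rabs s <= d / (2 * (Cmod c + 1)) ->
  Re (Cplus z (Cmult (RtoC s) c)) <= - (d / 2).
Proof.
move=> hz hs.
have c0 := Cmod_ge_0 c.
have hc : Rabs (Re c) <= Cmod c by apply: Rle_trans (Rmax_Cmod c); exact: Rmax_l.
have -> : Re (Cplus z (Cmult (RtoC s) c)) = Re z + s * Re c.
  by rewrite /Re /=; ring.
have h1 : s * Re c <= Rabs s * (Cmod c + 1).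
  apply: Rle_trans (Rle_abs _) _; rewrite Rabs_mult.
  apply: Rmult_le_compat_l; [exact: Rabs_pos | lra].
have h2 : Rabs s * (Cmod c + 1) <= d / (2 * (Cmod c + 1)) * (Cmod c + 1).
  by apply: Rmult_le_compat_r => //; lra.
have h3 : d / (2 * (Cmod c + 1)) * (Cmod c + 1) = d / 2 by field; lra.
lra.
Qed.

(** Uniformity in [y] holds because [zeta y] enters only through the half-plane Re <= - d: by
    [Re_flow] the flow stays in Re <= - d / 2, where the second derivative has a common bound. *)
Lemma unif_deriv_flow {Y : Type} (phi dphi ddphi : C -> C) (c : C) (zeta : Y -> C) (d : R) :
  0 < d ->
  (exists M, 0 <= M /\ forall z, Re z <= - (d / 2) ->
     [/\ Cmod (phi z) <= M, Cmod (dphi z) <= M & Cmod (ddphi z) <= M]) ->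
  (forall z t, Re (Cplus z (Cmult (RtoC t) c)) < 0 ->
     cderive (fun s => phi (Cplus z (Cmult (RtoC s) c))) t
       (dphi (Cplus z (Cmult (RtoC t) c))) /\
     cderive (fun s => dphi (Cplus z (Cmult (RtoC s) c))) t
       (ddphi (Cplus z (Cmult (RtoC t) c)))) ->
  (forall y, Re (zeta y) <= - d) ->
  unif_deriv (fun s y => phi (Cplus (zeta y) (Cmult (RtoC s) c)))
    (fun y => dphi (zeta y)).
Proof.
move=> hd [M [M0 HM]] H hz.
have c0 := Cmod_ge_0 c.
exists (4 * M), (d / (2 * (Cmod c + 1))); split; [lra | |] => [|y].
  by apply: Rdiv_lt_0_compat => //; lra.
have e0 : Cplus (zeta y) (Cmult (RtoC 0) c) = zeta y by ring.
have [|b1 b2 b3] := HM (zeta y); first by have := hz y; lra.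
split; [rewrite e0; lra | lra |] => s hs.
have := @cderive_taylor (fun s => phi (Cplus (zeta y) (Cmult (RtoC s) c)))
  (fun s => dphi (Cplus (zeta y) (Cmult (RtoC s) c)))
  (fun s => ddphi (Cplus (zeta y) (Cmult (RtoC s) c))) M _ s _ hs.
rewrite e0; apply=> t ht.
have hr := Re_flow _ _ _ _ (hz y) ht.
have [|h1 h2] := H (zeta y) t; first lra.
by have [_ _ ?] := HM _ hr; split.
Qed.

Lemma Cmod_mult_le (a b : C) (A B : R) :
  Cmod a <= A -> Cmod b <= B -> Cmod (Cmult a b) <= A * B.
Proof.
by move=> *; rewrite Cmod_mult; apply: Rmult_le_compat => //; exact: Cmod_ge_0.
Qed.

Lemma unif_deriv_psi {Y : Type} (a : R) (c : C) (zeta : Y -> C) (d : R) :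
  0 < d -> (forall y, Re (zeta y) <= - d) ->
  unif_deriv (fun s y => psi a (Cplus (zeta y) (Cmult (RtoC s) c)))
    (fun y => Cmult (Cmult (Copp (Cmult (RtoC a) c)) (geo (zeta y))) (psi a (zeta y))).
Proof.
move=> hd; set e := Copp (Cmult (RtoC a) c).
apply: (unif_deriv_flow (psi a) (fun z => Cmult (Cmult e (geo z)) (psi a z))
  (fun z => Cplus
     (Cmult (Cmult e (Cmult c (Cplus (geo z) (Cmult (geo z) (geo z))))) (psi a z))
     (Cmult (Cmult e (geo z)) (Cmult (Cmult e (geo z)) (psi a z)))) c zeta d hd) => //.
  have [|M [M0 HM]] := psi_geo_bound a (d / 2); first lra.
  exists (M + Cmod e * M * M + (Cmod e * (Cmod c * (M + M * M)) * M + Cmod e * M * (Cmod e * M * M))).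
  have e0 := Cmod_ge_0 e; have c0 := Cmod_ge_0 c.
  have MM := Rmult_le_pos _ _ M0 M0.
  have eM := Rmult_le_pos _ _ e0 M0; have eMM := Rmult_le_pos _ _ eM M0.
  have p1 : 0 <= Cmod e * (Cmod c * (M + M * M)) * M.
    by do !(apply: Rmult_le_pos => //); lra.
  have p2 : 0 <= Cmod e * M * (Cmod e * M * M) by exact: Rmult_le_pos.
  split=> [|z hz]; first lra.
  have [h1 h2] := HM z hz.
  have h3 : Cmod (Cmult e (geo z)) <= Cmod e * M by apply: Cmod_mult_le => //; lra.
  have h4 : Cmod (Cmult (Cmult e (geo z)) (psi a z)) <= Cmod e * M * M.
    exact: Cmod_mult_le.
  split; [lra | lra |].
  apply: Rle_trans (Cmod_triangle _ _) _.
  have h5 := Cmod_mult_le _ _ _ _ h3 h4.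
  have h6 : Cmod (Cmult (Cmult e (Cmult c (Cplus (geo z) (Cmult (geo z) (geo z))))) (psi a z))
      <= Cmod e * (Cmod c * (M + M * M)) * M.
    do 2 ?apply: Cmod_mult_le => //; try lra.
    apply: Cmod_mult_le; first lra.
    apply: Rle_trans (Cmod_triangle _ _) _.
    have := Cmod_mult_le _ _ _ _ h2 h2; lra.
  lra.
move=> z t ht; split; first exact: cderive_psi.
exact: (cderive_mult (cderive_scal e (cderive_geo _ _ _ ht)) (cderive_psi _ _ _ _ ht)).
Qed.

Lemma unif_deriv_geo {Y : Type} (c : C) (zeta : Y -> C) (d : R) :
  0 < d -> (forall y, Re (zeta y) <= - d) ->
  unif_deriv (fun s y => geo (Cplus (zeta y) (Cmult (RtoC s) c)))
    (fun y => Cmult c (Cplus (geo (zeta y)) (Cmult (geo (zeta y)) (geo (zeta y))))).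
Proof.
move=> hd.
pose dg (z : C) := Cmult c (Cplus (geo z) (Cmult (geo z) (geo z))).
apply: (unif_deriv_flow geo dg
  (fun z => Cmult c (Cplus (dg z) (Cplus (Cmult (dg z) (geo z)) (Cmult (geo z) (dg z)))))
  c zeta d hd) => //.
  have [|M [M0 HM]] := psi_geo_bound 0 (d / 2); first lra.
  set B := Cmod c * (M + M * M).
  exists (M + B + Cmod c * (B + (B * M + M * B))).
  have c0 := Cmod_ge_0 c; have MM := Rmult_le_pos _ _ M0 M0.
  have B0 : 0 <= B by apply: Rmult_le_pos => //; lra.
  have BM := Rmult_le_pos _ _ B0 M0.
  have p : 0 <= Cmod c * (B + (B * M + M * B)) by apply: Rmult_le_pos => //; lra.
  split=> [|z hz]; first lra.
  have [_ h2] := HM z hz.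
  have h3 : Cmod (dg z) <= B.
    apply: Cmod_mult_le; first lra.
    apply: Rle_trans (Cmod_triangle _ _) _.
    have := Cmod_mult_le _ _ _ _ h2 h2; lra.
  split; [lra | lra |].
  have h4 : Cmod (Cmult c (Cplus (dg z) (Cplus (Cmult (dg z) (geo z)) (Cmult (geo z) (dg z)))))
      <= Cmod c * (B + (B * M + M * B)).
    apply: Cmod_mult_le; first lra.
    apply: Rle_trans (Cmod_triangle _ _) _; apply: Rplus_le_compat => //.
    apply: Rle_trans (Cmod_triangle _ _) _.
    by apply: Rplus_le_compat; exact: Cmod_mult_le.
  lra.
move=> z t ht; have hg := cderive_geo _ _ _ ht; split; first exact: hg.
exact: (cderive_scal c (cderive_plus hg (cderive_mult hg hg))).
Qed.

(** * Iterated integrals of Lipschitz periodic functions *)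

Lemma cderive_quadratic (F : R -> C) (t0 : R) (v : C) (D eta : R) : 0 < eta ->
  (forall s, Rabs s <= eta ->
     Cmod (Cminus (Cminus (F (t0 + s)) (F t0)) (Cmult (RtoC s) v)) <= D * s ^ 2) ->
  cderive F t0 v.
Proof.
move=> he H; split; first exact: is_linear_scal_l.
move=> x /(is_filter_lim_locally_unique t0 x) <- eps.
have hD : 0 < Rabs D + 1 by have := Rabs_pos D; lra.
have hd : 0 < Rmin eta (eps / (Rabs D + 1)).
  by apply: Rmin_pos => //; apply: Rdiv_lt_0_compat => //; exact: cond_pos.
exists (mkposreal _ hd) => y /=.
rewrite /ball /= /AbsRing_ball /abs /minus /plus /opp /= -/(Rminus y t0) => hy.
rewrite norm_C /norm /= /abs /=.
have := H (y - t0); have -> : t0 + (y - t0) = y by ring.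
have -> : scal (y + - t0) v = Cmult (RtoC (y - t0)) v :> C.
  by rewrite /scal /= /prod_scal /scal /= /mult /= /Cmult /=; congr pair; ring.
rewrite -/(Rminus y t0); set s := y - t0 in hy *.
move=> h; apply: Rle_trans (h _) _.
  by left; apply: Rlt_le_trans hy (Rmin_l _ _).
have hs : Rabs s <= eps / (Rabs D + 1).
  by left; apply: Rlt_le_trans hy (Rmin_r _ _).
rewrite -Rsqr_pow2 Rsqr_abs /Rsqr -Rmult_assoc.
apply: Rmult_le_compat_r; first exact: Rabs_pos.
apply: Rle_trans (_ : (Rabs D + 1) * (eps / (Rabs D + 1)) <= _); last first.
  by right; field; lra.
apply: Rle_trans (_ : (Rabs D + 1) * Rabs s <= _).
  by apply: Rmult_le_compat_r; [exact: Rabs_pos | have := Rle_abs D; lra].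
by apply: Rmult_le_compat_l => //; lra.
Qed.

Lemma lipschitz_continuous (h : R -> C) (K t : R) :
  (forall s, Cmod (Cminus (h s) (h t)) <= K * Rabs (s - t)) ->
  continuous (U := C_R_NormedModule) h t.
Proof.
move=> H; apply/filterlim_locally_ball_norm => eps.
have hK : 0 < Rabs K + 1 by have := Rabs_pos K; lra.
have hd : 0 < eps / (Rabs K + 1) by apply: Rdiv_lt_0_compat => //; exact: cond_pos.
exists (mkposreal _ hd) => s.
rewrite /ball /= /AbsRing_ball /abs /minus /plus /opp /= -/(Rminus s t) => hs.
rewrite /ball_norm norm_C; apply: Rle_lt_trans (H s) _.
apply: Rle_lt_trans (_ : (Rabs K + 1) * Rabs (s - t) < _).
  by apply: Rmult_le_compat_r; [exact: Rabs_pos | have := Rle_abs K; lra].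
have -> : pos eps = (Rabs K + 1) * (eps / (Rabs K + 1)) by field; lra.
exact: Rmult_lt_compat_l.
Qed.

Lemma is_RInt_Cmult (c : C) (f : R -> C) (a b : R) (v : C) :
  is_RInt (V := C_R_NormedModule) f a b v ->
  is_RInt (V := C_R_NormedModule) (fun t => Cmult c (f t)) a b (Cmult c v).
Proof.
move=> h; have h1 := is_RInt_fct_extend_fst f a b v h.
have h2 := is_RInt_fct_extend_snd f a b v h.
apply: (is_RInt_fct_extend_pair (fun t => Cmult c (f t)) a b).
- by apply: (is_RInt_minus (fun t => fst c * fst (f t)) (fun t => snd c * snd (f t)));
    exact: is_RInt_scal.
- by apply: (is_RInt_plus (fun t => fst c * snd (f t)) (fun t => snd c * fst (f t)));
    exact: is_RInt_scal.
Qed.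

Lemma fcons_0 (N : nat) (t : R) (y : 'I_N -> R) : fcons t y ord0 = t.
Proof. by rewrite /fcons unlift_none. Qed.

Lemma fcons_lift (N : nat) (t : R) (y : 'I_N -> R) (j : 'I_N) :
  fcons t y (lift ord0 j) = y j.
Proof. by rewrite /fcons liftK. Qed.

Definition translate {N : nat} (a : 'I_N) (h : R) (y : 'I_N -> R) : 'I_N -> R :=
  fun j => y j + (if j == a then h else 0).

Lemma translate_fcons_0 (N : nat) (h t : R) (y : 'I_N -> R) :
  translate ord0 h (fcons t y) = fcons (t + h) y.
Proof.
apply: functional_extensionality => j; rewrite /translate.
by case: (unliftP ord0 j) => [i ->|->]; rewrite ?fcons_lift ?fcons_0 //= Rplus_0_r.
Qed.

Lemma translate_fcons_lift (N : nat) (a : 'I_N) (h t : R) (y : 'I_N -> R) :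
  translate (lift ord0 a) h (fcons t y) = fcons t (translate a h y).
Proof.
apply: functional_extensionality => j; rewrite /translate.
case: (unliftP ord0 j) => [i ->|->].
  by rewrite !fcons_lift (inj_eq lift_inj).
by rewrite !fcons_0 /= Rplus_0_r.
Qed.

Lemma iterated_unique (N : nat) (n : 'I_N -> Z) (f : ('I_N -> R) -> C) (v w : C) :
  is_iterated_integral n f v -> is_iterated_integral n f w -> v = w.
Proof.
elim: N n f v w => [|N IH] n f v w; first by move=> /= -> ->.
move=> [g [hg iv]] [g' [hg' iw]].
rewrite -(is_RInt_unique (V := C_R_CompleteNormedModule) _ _ _ _ iv).
apply: (is_RInt_unique (V := C_R_CompleteNormedModule)).
apply: is_RInt_ext iw => t ht; congr Cmult.
have ht' : - PI <= t <= PI.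
  have hpi := PI_RGT_0; move: ht; rewrite Rmin_left ?Rmax_right; lra.
exact: IH (hg' t ht') (hg t ht').
Qed.

Lemma iterated_plus (N : nat) (n : 'I_N -> Z) (f g : ('I_N -> R) -> C) (v w : C) :
  is_iterated_integral n f v -> is_iterated_integral n g w ->
  is_iterated_integral n (fun y => Cplus (f y) (g y)) (Cplus v w).
Proof.
elim: N n f g v w => [|N IH] n f g v w; first by move=> /= -> ->.
move=> [F [hF iv]] [G [hG iw]]; exists (fun t => Cplus (F t) (G t)); split.
  by move=> t ht; exact: IH (hF t ht) (hG t ht).
apply: is_RInt_ext (is_RInt_plus _ _ _ _ _ _ iv iw) => t _.
symmetry; exact: Cmult_plus_distr_l.
Qed.

Lemma iterated_scal (N : nat) (n : 'I_N -> Z) (c : C) (f : ('I_N -> R) -> C) (v : C) :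
  is_iterated_integral n f v ->
  is_iterated_integral n (fun y => Cmult c (f y)) (Cmult c v).
Proof.
elim: N n f v => [|N IH] n f v; first by move=> /= ->.
move=> [F [hF iv]]; exists (fun t => Cmult c (F t)); split.
  by move=> t ht; exact: IH (hF t ht).
apply: is_RInt_ext (is_RInt_Cmult c _ _ _ _ iv) => t _; cring.
Qed.

Lemma Cmod_weight (m : Z) (t : R) :
  Cmod (Cmult (RtoC (/ (2 * PI))) (Cexp (0, IZR m * t))) = / (2 * PI).
Proof.
have h := PI_RGT_0.
rewrite Cmod_mult Cmod_Cexp /= exp_0 Rmult_1_r Cmod_R Rabs_pos_eq //.
by left; apply: Rinv_0_lt_compat; lra.
Qed.

(** Each weight has modulus 1 / (2 PI) on an interval of length 2 PI, so every integration has norm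
    at most one and the bound passes through unchanged. *)
Lemma iterated_bound (N : nat) (n : 'I_N -> Z) (f : ('I_N -> R) -> C) (v : C) (M : R) :
  is_iterated_integral n f v -> (forall y, Cmod (f y) <= M) -> Cmod v <= M.
Proof.
elim: N n f v => [|N IH] n f v; first by move=> /= ->.
move=> [F [hF iv]] hM; have h := PI_RGT_0.
rewrite -norm_C; have -> : M = (PI - - PI) * (/ (2 * PI) * M) by field; lra.
apply: (norm_RInt_le_const _ _ _ _ _ _ _ iv); first by lra.
move=> t ht; rewrite norm_C Cmod_mult Cmod_weight.
apply: Rmult_le_compat_l; first by left; apply: Rinv_0_lt_compat; lra.
by apply: IH (hF t ht) _ => y; exact: hM.
Qed.

Definition lipschitz {N : nat} (f : ('I_N -> R) -> C) : Prop :=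
  exists K : R, 0 <= K /\ forall (d : R) (y y' : 'I_N -> R), 0 <= d ->
    (forall j, Rabs (y j - y' j) <= d) -> Cmod (Cminus (f y) (f y')) <= K * d.

Lemma lipschitz_fcons (N : nat) (f : ('I_N.+1 -> R) -> C) (t : R) :
  lipschitz f -> lipschitz (fun y => f (fcons t y)).
Proof.
move=> [K [K0 H]]; exists K; split=> // d y y' hd hy; apply: H => // j.
case: (unliftP ord0 j) => [i ->|->]; first by rewrite !fcons_lift.
by rewrite !fcons_0 Rminus_diag Rabs_R0.
Qed.

Lemma cderive_weight (m : Z) (t : R) :
  cderive (fun s => Cmult (RtoC (/ (2 * PI))) (Cexp (0, IZR m * s))) t
    (Cmult (0, IZR m) (Cmult (RtoC (/ (2 * PI))) (Cexp (0, IZR m * t)))).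
Proof.
have e s : (0, IZR m * s) = Cplus (RtoC 0) (Cmult (RtoC s) (0, IZR m)) :> C.
  by rewrite /Cplus /Cmult /=; congr pair; ring.
apply: (is_derive_ext (fun s => Cmult (RtoC (/ (2 * PI)))
   (Cexp (Cplus (RtoC 0) (Cmult (RtoC s) (0, IZR m)))))) => [s|]; first by rewrite e.
apply: (cderive_eq (cderive_scal _ (cderive_Cexp (cderive_affine _ _ _)))).
rewrite e; cring.
Qed.

Lemma weight_continuous (m : Z) (g : R -> C) (K t : R) :
  (forall s, Cmod (Cminus (g s) (g t)) <= K * Rabs (s - t)) ->
  continuous (U := C_R_NormedModule)
    (fun s => Cmult (Cmult (RtoC (/ (2 * PI))) (Cexp (0, IZR m * s))) (g s)) t.
Proof.
move=> H; set w := fun s => Cmult (RtoC (/ (2 * PI))) (Cexp (0, IZR m * s)).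
have hw s : Cmod (Cminus (w s) (w t)) <=
    2 * (Cmod (0, IZR m) * / (2 * PI)) * Rabs (s - t).
  apply: (cderive_bound (dh := fun u => Cmult (0, IZR m) (w u))) => u _.
  by split; [exact: cderive_weight | rewrite Cmod_mult Cmod_weight; lra].
apply: (lipschitz_continuous _
  (/ (2 * PI) * K + 2 * (Cmod (0, IZR m) * / (2 * PI)) * Cmod (g t))) => s.
have -> : Cminus (Cmult (w s) (g s)) (Cmult (w t) (g t)) =
  Cplus (Cmult (w s) (Cminus (g s) (g t))) (Cmult (Cminus (w s) (w t)) (g t)) by ring.
apply: Rle_trans (Cmod_triangle _ _) _.
have h1 : Cmod (w s) <= / (2 * PI) by rewrite Cmod_weight; lra.
have h2 := Cmod_mult_le _ _ _ _ h1 (H s).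
have h3 := Cmod_mult_le _ _ _ _ (hw s) (Rle_refl (Cmod (g t))).
lra.
Qed.

(** The Lipschitz constant of the integrand is inherited by the inner integral as a function of the
    outer variable; this makes the outer integrand continuous, hence integrable. *)
Lemma iterated_fcons_lipschitz (N : nat) (n : 'I_N -> Z) (f : ('I_N.+1 -> R) -> C)
    (g : R -> C) :
  lipschitz f -> (forall t, is_iterated_integral n (fun y => f (fcons t y)) (g t)) ->
  exists K, forall s t, Cmod (Cminus (g s) (g t)) <= K * Rabs (s - t).
Proof.
move=> [K [K0 HK]] hg; exists K => s t.
have hm := iterated_plus _ _ _ _ _ _ (hg s) (iterated_scal _ _ (Copp (RtoC 1)) _ _ (hg t)).
have -> : Cminus (g s) (g t) = Cplus (g s) (Cmult (Copp (RtoC 1)) (g t)) by ring.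
apply: (iterated_bound _ _ _ _ _ hm) => y.
have -> : Cplus (f (fcons s y)) (Cmult (Copp (RtoC 1)) (f (fcons t y))) =
  Cminus (f (fcons s y)) (f (fcons t y)) by ring.
apply: HK => [|j]; first exact: Rabs_pos.
case: (unliftP ord0 j) => [i ->|->]; last by rewrite !fcons_0; lra.
rewrite !fcons_lift Rminus_diag Rabs_R0; exact: Rabs_pos.
Qed.

Lemma iterated_exists (N : nat) (n : 'I_N -> Z) (f : ('I_N -> R) -> C) :
  lipschitz f -> exists v, is_iterated_integral n f v.
Proof.
elim: N n f => [|N IH] n f hf; first by eexists.
have H t := IH (fun j => n (lift ord0 j)) _ (lipschitz_fcons _ _ t hf).
pose g t := proj1_sig (constructive_indefinite_description _ (H t)).
have hg t : is_iterated_integral (fun j => n (lift ord0 j)) (fun y => f (fcons t y)) (g t).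
  exact: proj2_sig (constructive_indefinite_description _ (H t)).
have [K hl] := iterated_fcons_lipschitz _ _ _ _ hf hg.
have [v hv] : ex_RInt (V := C_R_CompleteNormedModule) (fun t =>
    Cmult (Cmult (RtoC (/ (2 * PI))) (Cexp (0, IZR (n ord0) * t))) (g t)) (- PI) PI.
  apply: ex_RInt_continuous => t _.
  exact: (weight_continuous _ g K t (fun s => hl s t)).
by exists v, g.
Qed.

Definition Lint {N : nat} (n : 'I_N -> Z) (f : ('I_N -> R) -> C) : C :=
  epsilon (inhabits (RtoC 0)) (is_iterated_integral n f).

Lemma iterated_Lint {N : nat} {n : 'I_N -> Z} {f : ('I_N -> R) -> C} :
  lipschitz f -> is_iterated_integral n f (Lint n f).
Proof. by move=> hf; apply: epsilon_spec; exact: iterated_exists. Qed.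

(** Moving the interval by h removes the integral [w] over [- PI, - PI + h] and adds the one over
    [PI, PI + h], which is the same by periodicity. *)
Lemma is_RInt_period (F : R -> C) (h : R) (v : C) :
  (forall t, continuous (U := C_R_NormedModule) F t) ->
  (forall t, F (t + 2 * PI) = F t) ->
  is_RInt (V := C_R_NormedModule) F (- PI) PI v ->
  is_RInt (V := C_R_NormedModule) (fun t => F (t + h)) (- PI) PI v.
Proof.
move=> hc hp hv.
have ex a b : ex_RInt (V := C_R_CompleteNormedModule) F a b.
  by apply: ex_RInt_continuous => t _.
have hs u a b l : is_RInt (V := C_R_NormedModule) F (a + u) (b + u) l ->
    is_RInt (V := C_R_NormedModule) (fun t => F (t + u)) a b l.
  move=> hl; have := is_RInt_comp_lin F 1 u a b l; rewrite !Rmult_1_l => /(_ hl).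
  apply: is_RInt_ext => t _; rewrite Rmult_1_l.
  exact: (scal_one (K := R_AbsRing) (V := C_R_NormedModule)).
have [w hw] := ex (- PI) (- PI + h).
have hw2 : is_RInt (V := C_R_NormedModule) F PI (PI + h) w.
  apply: (is_RInt_ext (fun t => F ((t + 2 * PI) + - (2 * PI)))).
    by move=> t _; congr F; ring.
  have -> : PI = - PI + 2 * PI by ring.
  have hw' : is_RInt (V := C_R_NormedModule) (fun t => F (t + - (2 * PI)))
      (- PI + 2 * PI) (- PI + h + 2 * PI) w.
    apply: hs.
    have -> : - PI + 2 * PI + - (2 * PI) = - PI by ring.
    by have -> : - PI + h + 2 * PI + - (2 * PI) = - PI + h by ring.
  apply: (is_RInt_ext (fun t => F (t + - (2 * PI)))).
    by move=> t _; rewrite -[F (t + - (2 * PI))]hp; congr F; ring.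
  have -> : - PI + 2 * PI + h = - PI + h + 2 * PI by ring.
  exact: hw'.
apply: hs.
have := is_RInt_Chasles _ _ _ _ _ _ (is_RInt_Chasles _ _ _ _ _ _
  (is_RInt_swap _ _ _ _ hw) hv) hw2.
have -> // : plus (plus (opp w) v) w = v.
by change (Cplus (Cplus (Copp w) v) w = v); ring.
Qed.

Definition periodic {N : nat} (f : ('I_N -> R) -> C) : Prop :=
  forall a y, f (translate a (2 * PI) y) = f y.

(** The whole integrand, weight included, is periodic in y_a because n_a is an integer. Undoing the
    translation in the weight exp (i n_a y_a) leaves the phase. *)
Lemma iterated_translate (N : nat) (n : 'I_N -> Z) (f : ('I_N -> R) -> C) (a : 'I_N)
    (h : R) (v : C) :
  lipschitz f -> periodic f -> is_iterated_integral n f v ->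
  is_iterated_integral n (fun y => f (translate a h y))
    (Cmult (Cexp (0, - (IZR (n a) * h))) v).
Proof.
elim: N n f a v => [|N IH] n f a v; first by case: a.
move=> hf hp hv.
have hg t := @iterated_Lint _ (fun j => n (lift ord0 j)) _ (lipschitz_fcons _ _ t hf).
(* The inner integral supplied by [hv] is constrained only on [- PI, PI]. Translation needs it for
   every real t, and periodic in t, so it is replaced by [Lint]. *)
set g := (fun t => Lint (fun j => n (lift ord0 j)) (fun y => f (fcons t y))) in hg.
have iv : is_RInt (V := C_R_NormedModule) (fun t => Cmult (Cmult (RtoC (/ (2 * PI)))
    (Cexp (0, IZR (n ord0) * t))) (g t)) (- PI) PI v.
  have [g' [hg' iv]] := hv; apply: is_RInt_ext iv => t ht; congr Cmult.
  apply: iterated_unique (hg' t _) (hg t).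
  have hpi := PI_RGT_0; move: ht; rewrite Rmin_left ?Rmax_right; lra.
case: (unliftP ord0 a) => [b ->|->].
  exists (fun t => Cmult (Cexp (0, - (IZR (n (lift ord0 b)) * h))) (g t)); split.
    move=> t _.
    have -> : (fun y => f (translate (lift ord0 b) h (fcons t y))) =
        (fun y => f (fcons t (translate b h y))).
      by apply: functional_extensionality => y; rewrite translate_fcons_lift.
    apply: (IH (fun j => n (lift ord0 j)) (fun y => f (fcons t y))) => //.
      exact: lipschitz_fcons.
    by move=> c y; rewrite -(hp (lift ord0 c) (fcons t y)) translate_fcons_lift.
  apply: is_RInt_ext (is_RInt_Cmult _ _ _ _ _ iv) => t _; cring.
exists (fun t => g (t + h)); split.
  move=> t _; have -> : (fun y => f (translate ord0 h (fcons t y))) =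
        (fun y => f (fcons (t + h) y)).
    by apply: functional_extensionality => y; rewrite translate_fcons_0.
  exact: hg.
set F := fun t => _ in iv.
have hF : is_RInt (V := C_R_NormedModule) (fun t => F (t + h)) (- PI) PI v.
  apply: is_RInt_period iv => t.
    have [K hl] := iterated_fcons_lipschitz _ _ _ _ hf hg.
    exact: (weight_continuous _ g K t (fun s => hl s t)).
  rewrite /F; congr Cmult.
    congr Cmult; rewrite -(Cexp_2PI_period 0 (IZR (n ord0) * t) (n ord0)).
    by congr Cexp; congr pair; ring.
  congr (Lint _ _); apply: functional_extensionality => y.
  by rewrite -(hp ord0 (fcons t y)) translate_fcons_0.
apply: is_RInt_ext (is_RInt_Cmult (Cexp (0, - (IZR (n ord0) * h))) _ _ _ _ hF) => t _.
rewrite /F.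
have -> : (0, IZR (n ord0) * (t + h)) =
  Cplus (0, IZR (n ord0) * t) (0, IZR (n ord0) * h) :> C.
  by rewrite /Cplus /=; congr pair; ring.
have -> : (0, - (IZR (n ord0) * h)) = Copp (0, IZR (n ord0) * h) :> C.
  by rewrite /Copp /=; congr pair; ring.
rewrite Cexp_add Cexp_opp.
have := Cexp_neq0 (0, IZR (n ord0) * h); set e := Cexp _ => he.
by lazymatch goal with |- ?a = ?b => change (@eq C a b) end; field.
Qed.

(** A character exp (i m.y) in the integrand is absorbed into the weights. This is how a power of
    exp (i (y_j - y_k)) becomes a shift of [n]. *)
Lemma iterated_modulate (N : nat) (n m : 'I_N -> Z) (f : ('I_N -> R) -> C) (v : C) :
  is_iterated_integral (fun j => (n j + m j)%Z) f v ->
  is_iterated_integral n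
    (fun y => Cmult (Cexp (0, \big[Rplus/0]_(j < N) (IZR (m j) * y j))) (f y)) v.
Proof.
elim: N n m f v => [|N IH] n m f v.
  by move=> /= ->; rewrite big_ord0 Cexp_0 Cmult_1_l.
move=> [g [hg iv]]; exists (fun t => Cmult (Cexp (0, IZR (m ord0) * t)) (g t)); split.
  move=> t ht.
  have := iterated_scal _ _ (Cexp (0, IZR (m ord0) * t)) _ _
    (IH (fun j => n (lift ord0 j)) (fun j => m (lift ord0 j)) _ _ (hg t ht)).
  congr is_iterated_integral; apply: functional_extensionality => y.
  rewrite big_ord_recl fcons_0 Cmult_assoc -Cexp_add; congr Cmult; congr Cexp.
  rewrite /Cplus /=; congr pair; first by ring.
  by congr Rplus; apply: eq_bigr => j _; rewrite fcons_lift.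
apply: is_RInt_ext iv => t _; rewrite Cmult_assoc; congr Cmult.
rewrite -Cmult_assoc -Cexp_add; congr Cmult; congr Cexp.
by rewrite /Cplus /= plus_IZR; congr pair; ring.
Qed.

(** Differentiation under the integral sign: the Taylor remainder of the integral is the integral of
    the remainders, so [iterated_bound] gives it the same quadratic bound. *)
Lemma cderive_iterated {N : nat} {n : 'I_N -> Z} {f : R -> ('I_N -> R) -> C}
    {f' : ('I_N -> R) -> C} {F : R -> C} {v : C} {t0 eta : R} :
  0 < eta ->
  unif_deriv (fun s y => f (t0 + s) y) f' ->
  (forall s, Rabs s <= eta -> is_iterated_integral n (f (t0 + s)) (F (t0 + s))) ->
  is_iterated_integral n f' v -> cderive F t0 v.
Proof.
move=> he [D [e [D0 e0 H]]] hF hv.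
apply: (cderive_quadratic _ _ _ D (Rmin eta e)); first exact: Rmin_pos.
move=> s hs.
have h0 : is_iterated_integral n (f t0) (F t0).
  by rewrite -[t0]Rplus_0_r; apply: hF; rewrite Rabs_R0; lra.
have h1 := hF s (Rle_trans _ _ _ hs (Rmin_l _ _)).
have := iterated_plus _ _ _ _ _ _ (iterated_plus _ _ _ _ _ _ h1
  (iterated_scal _ _ (Copp (RtoC 1)) _ _ h0)) (iterated_scal _ _ (Copp (RtoC s)) _ _ hv).
have -> : Cplus (Cplus (F (t0 + s)) (Cmult (Copp (RtoC 1)) (F t0)))
    (Cmult (Copp (RtoC s)) v) =
  Cminus (Cminus (F (t0 + s)) (F t0)) (Cmult (RtoC s) v) by ring.
move=> hi; apply: (iterated_bound _ _ _ _ _ hi) => y.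
have [_ _ h] := H y; have := h s (Rle_trans _ _ _ hs (Rmin_r _ _)).
rewrite Rplus_0_r; congr (Cmod _ <= _); ring.
Qed.

(* Translating the integration variable and differentiating at 0 amounts to
   integrating by parts. *)
Lemma iterated_by_parts {N : nat} {n : 'I_N -> Z} {f f' : ('I_N -> R) -> C}
    {a : 'I_N} {v : C} :
  lipschitz f -> periodic f -> lipschitz f' ->
  unif_deriv (fun s y => f (translate a s y)) f' ->
  is_iterated_integral n f v ->
  is_iterated_integral n f' (Cmult (0, - IZR (n a)) v).
Proof.
move=> hf hp hf' hd hv.
have h1 := iterated_Lint hf' (n := n).
suff <- : Lint n f' = Cmult (0, - IZR (n a)) v by [].
have hd' : unif_deriv (fun s y => f (translate a (0 + s) y)) f'.
  by apply: (unif_deriv_eq hd) => // s y; rewrite Rplus_0_l.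
have d1 := cderive_iterated (f := fun s y => f (translate a s y))
  (F := fun h => Cmult (Cexp (0, - (IZR (n a) * h))) v) Rlt_0_1 hd'
  (fun s _ => iterated_translate _ _ _ a (0 + s) _ hf hp hv) h1.
have d2 : cderive (fun h => Cmult (Cexp (0, - (IZR (n a) * h))) v) 0
    (Cmult (0, - IZR (n a)) v).
  have e s : (0, - (IZR (n a) * s)) =
      Cplus (RtoC 0) (Cmult (RtoC s) (0, - IZR (n a))) :> C.
    by rewrite /Cplus /Cmult /=; congr pair; ring.
  apply: (is_derive_ext (fun s => Cmult (Cexp (Cplus (RtoC 0)
     (Cmult (RtoC s) (0, - IZR (n a))))) v)) => [s|]; first by rewrite e.
  apply: (cderive_eq (cderive_mult (cderive_Cexp (cderive_affine _ _ _))
    (cderive_const v 0))).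
  by rewrite -e Rmult_0_r Ropp_0 -/(RtoC 0) Cexp_0; cring.
have f1 := is_derive_unique _ _ _ (cderive_fst d1).
have f2 := is_derive_unique _ _ _ (cderive_snd d1).
rewrite [LHS]surjective_pairing [RHS]surjective_pairing -f1 -f2.
by rewrite (is_derive_unique _ _ _ (cderive_fst d2)) (is_derive_unique _ _ _ (cderive_snd d2)).
Qed.

(** Lipschitz continuity gives existence of the integral and periodicity gives translation
    invariance; boundedness makes the class closed under multiplication. *)
Definition nice {N : nat} (f : ('I_N -> R) -> C) : Prop :=
  [/\ exists M, forall y, Cmod (f y) <= M, lipschitz f & periodic f].

Lemma nice_lipschitz {N : nat} {f : ('I_N -> R) -> C} : nice f -> lipschitz f.
Proof. by case. Qed.

Lemma nice_ext {N : nat} {f g : ('I_N -> R) -> C} :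
  nice f -> (forall y, f y = g y) -> nice g.
Proof. by move=> hf /functional_extensionality <-. Qed.

Lemma nice_const {N : nat} (c : C) : nice (fun _ : 'I_N -> R => c).
Proof.
split=> //; first by exists (Cmod c) => y; lra.
exists 0; split=> [|d y y' hd _]; first lra.
have -> : Cminus c c = RtoC 0 by ring.
by rewrite Cmod_0; lra.
Qed.

Lemma nice_plus {N : nat} {f g : ('I_N -> R) -> C} :
  nice f -> nice g -> nice (fun y => Cplus (f y) (g y)).
Proof.
move=> [[M hM] [K [K0 hK]] pf] [[M' hM'] [K' [K0' hK']] pg]; split.
- exists (M + M') => y; apply: Rle_trans (Cmod_triangle _ _) _.
  by apply: Rplus_le_compat.
- exists (K + K'); split=> [|d y y' hd h]; first lra.
  have -> : Cminus (Cplus (f y) (g y)) (Cplus (f y') (g y')) =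
     Cplus (Cminus (f y) (f y')) (Cminus (g y) (g y')) by ring.
  apply: Rle_trans (Cmod_triangle _ _) _.
  have := hK d y y' hd h; have := hK' d y y' hd h; lra.
- by move=> a y; rewrite pf pg.
Qed.

Lemma nice_mult {N : nat} {f g : ('I_N -> R) -> C} :
  nice f -> nice g -> nice (fun y => Cmult (f y) (g y)).
Proof.
move=> [[M hM] [K [K0 hK]] pf] [[M' hM'] [K' [K0' hK']] pg]; split.
- by exists (M * M') => y; exact: Cmod_mult_le.
- exists (Rabs M * K' + K * Rabs M'); split=> [|d y y' hd h].
    by have := Rmult_le_pos _ _ (Rabs_pos M) K0';
       have := Rmult_le_pos _ _ K0 (Rabs_pos M'); lra.
  have -> : Cminus (Cmult (f y) (g y)) (Cmult (f y') (g y')) =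
     Cplus (Cmult (f y) (Cminus (g y) (g y'))) (Cmult (Cminus (f y) (f y')) (g y')) by ring.
  apply: Rle_trans (Cmod_triangle _ _) _.
  have h1 := Cmod_mult_le _ _ _ _ (Rle_trans _ _ _ (hM y) (Rle_abs M)) (hK' d y y' hd h).
  have h2 := Cmod_mult_le _ _ _ _ (hK d y y' hd h) (Rle_trans _ _ _ (hM' y') (Rle_abs M')).
  lra.
- by move=> a y; rewrite pf pg.
Qed.

Lemma nice_scal {N : nat} {f : ('I_N -> R) -> C} (c : C) :
  nice f -> nice (fun y => Cmult c (f y)).
Proof. exact: nice_mult (nice_const c). Qed.

Lemma nice_sum {N : nat} {I : Type} (r : seq.seq I) (P : pred I)
    (f : I -> ('I_N -> R) -> C) :
  (forall i, P i -> nice (f i)) ->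
  nice (fun y => \big[Cplus/RtoC 0]_(i <- r | P i) f i y).
Proof.
move=> H; elim: r => [|i r IH].
  by apply: (nice_ext (nice_const (RtoC 0))) => y; rewrite big_nil.
case hP: (P i); last by apply: (nice_ext IH) => y; rewrite big_cons hP.
by apply: (nice_ext (nice_plus (H i hP) IH)) => y; rewrite big_cons hP.
Qed.

Lemma nice_prod {N : nat} {I : Type} (r : seq.seq I) (P : pred I)
    (f : I -> ('I_N -> R) -> C) :
  (forall i, P i -> nice (f i)) ->
  nice (fun y => \big[Cmult/RtoC 1]_(i <- r | P i) f i y).
Proof.
move=> H; elim: r => [|i r IH].
  by apply: (nice_ext (nice_const (RtoC 1))) => y; rewrite big_nil.
case hP: (P i); last by apply: (nice_ext IH) => y; rewrite big_cons hP.
by apply: (nice_ext (nice_mult (H i hP) IH)) => y; rewrite big_cons hP.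
Qed.

(** The functions meant are the imaginary parts of the exponents in the kernel. The constant 2
    accommodates y_j - y_k, in which both variables may move by [d]. *)
Definition angular {N : nat} (theta : ('I_N -> R) -> R) : Prop :=
  (forall d y y', (forall j, Rabs (y j - y' j) <= d) ->
     Rabs (theta y - theta y') <= 2 * d) /\
  (forall a y, exists m : Z, theta (translate a (2 * PI) y) = theta y + 2 * PI * IZR m).

Lemma nice_angular {N : nat} (phi dphi : C -> C) (r : R) (theta : ('I_N -> R) -> R) :
  (forall t, cderive (fun s => phi (r, s)) t (dphi (r, t))) ->
  (exists M, forall t, Cmod (phi (r, t)) <= M /\ Cmod (dphi (r, t)) <= M) ->
  (forall z w, Cexp z = Cexp w -> phi z = phi w) ->
  angular theta -> nice (fun y => phi (r, theta y)).
Proof.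
move=> hd [M hM] hp [ha1 ha2]; split.
- by exists M => y; have [] := hM (theta y).
- have M0 : 0 <= M by have [h _] := hM 0; have := Cmod_ge_0 (phi (r, 0)); lra.
  exists (4 * M); split=> [|d y y' hd' h]; first lra.
  have hb := @cderive_bound (fun s => phi (r, s)) (fun s => dphi (r, s)) M (theta y') (theta y).
  apply: Rle_trans (hb _) _; first by move=> t _; split; [exact: hd | have [] := hM t].
  by have := ha1 d y y' h; nra.
- move=> a y; have [m ->] := ha2 a y; apply: hp; exact: Cexp_2PI_period.
Qed.

Lemma cderive_vertical {phi dphi : C -> C} {r t : R} :
  (cderive (fun s => phi (Cplus (r, 0) (Cmult (RtoC s) Ci))) t
     (dphi (Cplus (r, 0) (Cmult (RtoC t) Ci)))) ->
  cderive (fun s => phi (r, s)) t (dphi (r, t)).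
Proof.
have e s : (r, s) = Cplus (r, 0) (Cmult (RtoC s) Ci) :> C.
  by rewrite /Cplus /Cmult /=; congr pair; ring.
rewrite -e => h; apply: (is_derive_ext _ _ _ _ _ h) => s; by rewrite -e.
Qed.

Lemma Re_vertical (r t : R) : Re (Cplus (r, 0) (Cmult (RtoC t) Ci)) = r.
Proof. rewrite /Re /=; ring. Qed.

Lemma nice_psi {N : nat} (a r : R) (theta : ('I_N -> R) -> R) :
  r < 0 -> angular theta -> nice (fun y => psi a (r, theta y)).
Proof.
move=> hr.
apply: (nice_angular (psi a)
  (fun z => Cmult (Cmult (Copp (Cmult (RtoC a) Ci)) (geo z)) (psi a z))) => [t||z w e].
- apply: (cderive_vertical (phi := psi a)
    (dphi := fun z => Cmult (Cmult (Copp (Cmult (RtoC a) Ci)) (geo z)) (psi a z))).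
  by apply: cderive_psi; rewrite Re_vertical.
- have [|M [M0 H]] := psi_geo_bound a (- r); first lra.
  set k := Cmod (Copp (Cmult (RtoC a) Ci)); have k0 : 0 <= k by exact: Cmod_ge_0.
  have kMM := Rmult_le_pos _ _ (Rmult_le_pos _ _ k0 M0) M0.
  exists (M + k * M * M) => t.
  have [|h1 h2] := H (r, t); first by rewrite /=; lra.
  split; first lra.
  have := Cmod_mult_le _ _ _ _ (Cmod_mult_le _ _ _ _ (Rle_refl k) h2) h1; lra.
- by rewrite /psi e.
Qed.

Lemma nice_geo {N : nat} (r : R) (theta : ('I_N -> R) -> R) :
  r < 0 -> angular theta -> nice (fun y => geo (r, theta y)).
Proof.
move=> hr.
apply: (nice_angular geo
  (fun z => Cmult Ci (Cplus (geo z) (Cmult (geo z) (geo z))))) => [t||z w e].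
- apply: (cderive_vertical (phi := geo)
    (dphi := fun z => Cmult Ci (Cplus (geo z) (Cmult (geo z) (geo z))))).
  by apply: cderive_geo; rewrite Re_vertical.
- have [|M [M0 H]] := psi_geo_bound 0 (- r); first lra.
  set k := Cmod Ci; have k0 : 0 <= k by exact: Cmod_ge_0.
  have p : 0 <= k * (M + M * M).
    by apply: Rmult_le_pos => //; have := Rmult_le_pos _ _ M0 M0; lra.
  exists (M + k * (M + M * M)) => t.
  have [|h1 h2] := H (r, t); first by rewrite /=; lra.
  split; first lra.
  apply: Rle_trans (_ : k * (M + M * M) <= _); last lra.
  apply: Cmod_mult_le; first exact: Rle_refl.
  apply: Rle_trans (Cmod_triangle _ _) _.
  have := Cmod_mult_le _ _ _ _ h2 h2; lra.
- by rewrite /geo e.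
Qed.

(** * The kernel and its logarithmic derivatives *)

Definition uexp {N : nat} (eps : R) (y : 'I_N -> R) (j k : 'I_N) : C :=
  (- ((INR k - INR j) * eps), y j - y k).

Definition wexp {N : nat} (eps : R) (x y : 'I_N -> R) (j k : 'I_N) : C :=
  (- (INR j.+1 * eps), x k - y j).

Lemma uexp_neg {N : nat} (j k : 'I_N) (eps : R) : (j < k)%N -> 0 < eps ->
  - ((INR k - INR j) * eps) <= - eps.
Proof.
move=> hjk he.
have : INR j.+1 <= INR k by apply: le_INR; exact/leP.
by rewrite S_INR; nra.
Qed.

Lemma wexp_neg (j : nat) (eps : R) : 0 < eps -> - (INR j.+1 * eps) <= - eps.
Proof. by move=> he; rewrite S_INR; have := pos_INR j; nra. Qed.

Lemma angular_translate {N : nat} (a j : 'I_N) (y : 'I_N -> R) (m : Z) :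
  exists m' : Z, translate a (2 * PI) y j * IZR m = y j * IZR m + 2 * PI * IZR m'.
Proof.
rewrite /translate; case: (j == a); [exists m | exists 0%Z]; ring.
Qed.

Lemma angular_uexp {N : nat} (j k : 'I_N) : angular (fun y : 'I_N -> R => y j - y k).
Proof.
split=> [d y y' h|a y].
  have -> : y j - y k - (y' j - y' k) = (y j - y' j) - (y k - y' k) by ring.
  apply: Rle_trans (Rabs_triang _ _) _; rewrite Rabs_Ropp.
  by have := h j; have := h k; lra.
have [m hm] := angular_translate a j y 1; have [m' hm'] := angular_translate a k y (-1).
exists (m + m')%Z; rewrite plus_IZR; lra.
Qed.

Lemma angular_wexp {N : nat} (j : 'I_N) (c : R) : angular (fun y : 'I_N -> R => c - y j).
Proof.
split=> [d y y' h|a y].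
  have -> : c - y j - (c - y' j) = - (y j - y' j) by ring.
  by rewrite Rabs_Ropp; have := h j; have := Rabs_pos (y j - y' j); lra.
have [m' hm'] := angular_translate a j y (-1).
exists m'; lra.
Qed.

Lemma big_Cmult_inv {I : Type} (r : seq.seq I) (P : pred I) (f : I -> C) :
  (forall i, f i <> RtoC 0) ->
  \big[Cmult/RtoC 1]_(i <- r | P i) Cinv (f i) =
    Cinv (\big[Cmult/RtoC 1]_(i <- r | P i) f i) /\
  \big[Cmult/RtoC 1]_(i <- r | P i) f i <> RtoC 0.
Proof.
move=> H; elim: r => [|i r [IH1 IH2]].
  by rewrite !big_nil; split; [field | exact: C1_nz].
rewrite !big_cons; case: (P i) => //; rewrite IH1; split.
  by have hi := H i; field.
exact: Cmult_neq_0.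
Qed.

Lemma Cpower_neq0 (z : C) (a : R) : Cpower z a <> RtoC 0.
Proof.
move=> h; have := Cmod_Cpower z a; rewrite h Cmod_0 => h'.
by have := exp_pos (a * ln (Cmod z)); rewrite -/(Rpower _ _) -h'; lra.
Qed.

Lemma kernelE {N : nat} (lam eps : R) (x y : 'I_N -> R) :
  kernel lam eps x y =
  Cmult
    (\big[Cmult/RtoC 1]_(j < N) \big[Cmult/RtoC 1]_(k < N | (j < k)%N)
       psi lam (uexp eps y j k))
    (\big[Cmult/RtoC 1]_(j < N) \big[Cmult/RtoC 1]_(k < N)
       psi (- lam) (wexp eps x y j k)).
Proof.
rewrite /kernel /Cdiv; congr Cmult.
have h j := big_Cmult_inv (index_enum 'I_N) xpredT
  (fun k => Cpower (Cminus (RtoC 1) (Cexp (wexp eps x y j k))) lam)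
  (fun k => Cpower_neq0 _ _).
rewrite -(big_Cmult_inv _ _ _ (fun j => (h j).2)).1.
apply: eq_bigr => j _; rewrite -(h j).1.
by apply: eq_bigr => k _; rewrite /psi Cpower_opp.
Qed.

Lemma nice_kernel {N : nat} (lam eps : R) (x : 'I_N -> R) :
  0 < eps -> nice (kernel lam eps x).
Proof.
move=> he; apply: (nice_ext _ (fun y => esym (kernelE lam eps x y))).
apply: nice_mult; apply: nice_prod => j _; apply: nice_prod => k hk.
  apply: nice_psi; last exact: angular_uexp.
  by have := uexp_neg _ _ _ hk he; lra.
apply: nice_psi; last exact: angular_wexp.
by have := wexp_neg j _ he; lra.
Qed.

(** The logarithmic derivative of the kernel when its exponents move with velocities [cu] and [cw];
    [logder2] is the derivative of this quantity along the same motion. Leaving the velocities free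
    treats derivatives in [x], in [y] and in [eps] together. *)
Definition logder {N : nat} (lam eps : R) (x : 'I_N -> R) (cu cw : 'I_N -> 'I_N -> C)
    (y : 'I_N -> R) : C :=
  Cplus
    (\big[Cplus/RtoC 0]_(j < N) \big[Cplus/RtoC 0]_(k < N | (j < k)%N)
       Cmult (Copp (Cmult (RtoC lam) (cu j k))) (geo (uexp eps y j k)))
    (\big[Cplus/RtoC 0]_(j < N) \big[Cplus/RtoC 0]_(k < N)
       Cmult (Cmult (RtoC lam) (cw j k)) (geo (wexp eps x y j k))).

Definition logder2 {N : nat} (lam eps : R) (x : 'I_N -> R) (cu cw : 'I_N -> 'I_N -> C)
    (y : 'I_N -> R) : C :=
  let sq z := Cplus (geo z) (Cmult (geo z) (geo z)) in
  Cplus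
    (\big[Cplus/RtoC 0]_(j < N) \big[Cplus/RtoC 0]_(k < N | (j < k)%N)
       Cmult (Copp (Cmult (RtoC lam) (cu j k))) (Cmult (cu j k) (sq (uexp eps y j k))))
    (\big[Cplus/RtoC 0]_(j < N) \big[Cplus/RtoC 0]_(k < N)
       Cmult (Cmult (RtoC lam) (cw j k)) (Cmult (cw j k) (sq (wexp eps x y j k)))).

Lemma nice_geo_uexp {N : nat} (eps : R) (j k : 'I_N) :
  0 < eps -> (j < k)%N -> nice (fun y => geo (uexp eps y j k)).
Proof.
move=> he hk; apply: nice_geo; last exact: angular_uexp.
by have := uexp_neg _ _ _ hk he; lra.
Qed.

Lemma nice_geo_wexp {N : nat} (eps : R) (x : 'I_N -> R) (j k : 'I_N) :
  0 < eps -> nice (fun y => geo (wexp eps x y j k)).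
Proof.
move=> he; apply: nice_geo; last exact: angular_wexp.
by have := wexp_neg j _ he; lra.
Qed.

Lemma nice_logder {N : nat} (lam eps : R) (x : 'I_N -> R) (cu cw : 'I_N -> 'I_N -> C) :
  0 < eps -> nice (logder lam eps x cu cw).
Proof.
move=> he; apply: nice_plus; apply: nice_sum => j _; apply: nice_sum => k hk;
  apply: nice_scal; [exact: nice_geo_uexp | exact: nice_geo_wexp].
Qed.

Lemma nice_logder2 {N : nat} (lam eps : R) (x : 'I_N -> R) (cu cw : 'I_N -> 'I_N -> C) :
  0 < eps -> nice (logder2 lam eps x cu cw).
Proof.
move=> he; apply: nice_plus; apply: nice_sum => j _; apply: nice_sum => k hk;
  do 2 apply: nice_scal.
  have h := nice_geo_uexp eps j k he hk; exact: nice_plus h (nice_mult h h).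
have h := nice_geo_wexp eps x j k he; exact: nice_plus h (nice_mult h h).
Qed.

(** The exponents are affine in (eps, x, y), so [udir] and [wdir] are their exact velocities and the
    flow identities below have no remainder. *)
Definition udir {N : nat} (de : R) (dy : 'I_N -> R) (j k : 'I_N) : C :=
  (- ((INR k - INR j) * de), dy j - dy k).

Definition wdir {N : nat} (de : R) (dx dy : 'I_N -> R) (j k : 'I_N) : C :=
  (- (INR j.+1 * de), dx k - dy j).

Lemma uexp_flow {N : nat} (eps de s : R) (y dy : 'I_N -> R) (j k : 'I_N) :
  uexp (eps + s * de) (fun l => y l + s * dy l) j k =
  Cplus (uexp eps y j k) (Cmult (RtoC s) (udir de dy j k)).
Proof. by rewrite /uexp /udir /Cplus /Cmult /=; congr pair; ring. Qed.

Lemma wexp_flow {N : nat} (eps de s : R) (x dx y dy : 'I_N -> R) (j k : 'I_N) :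
  wexp (eps + s * de) (fun l => x l + s * dx l) (fun l => y l + s * dy l) j k =
  Cplus (wexp eps x y j k) (Cmult (RtoC s) (wdir de dx dy j k)).
Proof. by rewrite /wexp /wdir /Cplus /Cmult /=; congr pair; ring. Qed.

Lemma Cplus_0_flow (z c : C) : Cplus z (Cmult (RtoC 0) c) = z.
Proof. ring. Qed.

Lemma unif_deriv_kernel {N : nat} (lam eps de : R) (x dx dy : 'I_N -> R) : 0 < eps ->
  unif_deriv
    (fun s y => kernel lam (eps + s * de) (fun l => x l + s * dx l)
                  (fun l => y l + s * dy l))
    (fun y => Cmult (logder lam eps x (udir de dy) (wdir de dx dy) y)
                (kernel lam eps x y)).
Proof.
move=> he.
have hu (j : 'I_N) := unif_deriv_prod (index_enum 'I_N) (fun k => (j < k)%N)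
  (fun k s y => psi lam (Cplus (uexp eps y j k) (Cmult (RtoC s) (udir de dy j k))))
  (fun k y => Cmult (Copp (Cmult (RtoC lam) (udir de dy j k))) (geo (uexp eps y j k))).
have hw (j : 'I_N) := unif_deriv_prod (index_enum 'I_N) xpredT
  (fun k s y => psi (- lam) (Cplus (wexp eps x y j k) (Cmult (RtoC s) (wdir de dx dy j k))))
  (fun k y => Cmult (Cmult (RtoC lam) (wdir de dx dy j k)) (geo (wexp eps x y j k))).
have Hu := unif_deriv_prod (index_enum 'I_N) xpredT _ _ (fun j _ => hu j _).
have Hw := unif_deriv_prod (index_enum 'I_N) xpredT _ _ (fun j _ => hw j _).
apply: (unif_deriv_eq (unif_deriv_mult (Hu _) (Hw _))).
- move=> j k hk; apply: (unif_deriv_eq (unif_deriv_psi lam (udir de dy j k)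
    (fun y => uexp eps y j k) eps he _)) => // y; last by rewrite Cplus_0_flow.
  exact: uexp_neg.
- move=> j k hk; apply: (unif_deriv_eq (unif_deriv_psi (- lam) (wdir de dx dy j k)
    (fun y => wexp eps x y j k) eps he _)) => // y; last first.
    by rewrite Cplus_0_flow RtoC_opp; congr Cmult; congr Cmult; ring.
  exact: wexp_neg.
- move=> s y; rewrite kernelE; congr Cmult; apply: eq_bigr => j _; apply: eq_bigr => k _.
    by rewrite uexp_flow.
  by rewrite wexp_flow.
move=> y; rewrite kernelE /logder.
set u := \big[Cmult/_]_(j < N) _; set w := \big[Cmult/_]_(j < N) _.
set u' := \big[Cmult/_]_(j < N) _; set w' := \big[Cmult/_]_(j < N) _.
have -> : u = u'.
  by apply: eq_bigr => j _; apply: eq_bigr => k _; rewrite Cplus_0_flow.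
have -> : w = w'.
  by apply: eq_bigr => j _; apply: eq_bigr => k _; rewrite Cplus_0_flow.
have key (a b p q : C) : Cplus (Cmult (Cmult a p) q) (Cmult p (Cmult b q)) =
  Cmult (Cplus a b) (Cmult p q) by ring.
exact: key.
Qed.

Lemma unif_deriv_logder {N : nat} (lam eps de : R) (x dx dy : 'I_N -> R) : 0 < eps ->
  unif_deriv
    (fun s y => logder lam (eps + s * de) (fun l => x l + s * dx l)
                  (udir de dy) (wdir de dx dy) (fun l => y l + s * dy l))
    (logder2 lam eps x (udir de dy) (wdir de dx dy)).
Proof.
move=> he.
have hu (j k : 'I_N) (hk : (j < k)%N) := unif_deriv_scal
  (Copp (Cmult (RtoC lam) (udir de dy j k)))
  (unif_deriv_geo (udir de dy j k) (fun y => uexp eps y j k) eps he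
    (fun y => uexp_neg _ _ _ hk he)).
have hw (j k : 'I_N) := unif_deriv_scal (Cmult (RtoC lam) (wdir de dx dy j k))
  (unif_deriv_geo (wdir de dx dy j k) (fun y => wexp eps x y j k) eps he
    (fun y => wexp_neg _ _ he)).
apply: (unif_deriv_eq (unif_deriv_plus
  (unif_deriv_sum (index_enum 'I_N) xpredT _ _ (fun j _ =>
     unif_deriv_sum (index_enum 'I_N) (fun k : 'I_N => (j < k)%N) _ _ (hu j)))
  (unif_deriv_sum (index_enum 'I_N) xpredT _ _ (fun j _ =>
     unif_deriv_sum (index_enum 'I_N) xpredT _ _ (fun k _ => hw j k))))) => // s y.
by rewrite /logder; congr Cplus; apply: eq_bigr => j _; apply: eq_bigr => k _;
   rewrite ?uexp_flow ?wexp_flow.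
Qed.

(** * The algebraic identity *)

Local Notation "'\csum_' i F" := (\big[Cplus/RtoC 0]_i F)
  (at level 41, i at level 0, F at level 41, right associativity).

Lemma csum_plus {I : finType} (f g : I -> C) :
  \csum_i (Cplus (f i) (g i)) = Cplus (\csum_i f i) (\csum_i g i).
Proof. exact: big_split. Qed.

Lemma csum_scal {I : finType} (c : C) (f : I -> C) :
  \csum_i (Cmult c (f i)) = Cmult c (\csum_i f i).
Proof. by rewrite big_distrr. Qed.

Lemma csum_mult {I J : finType} (f : I -> C) (g : J -> C) :
  Cmult (\csum_i f i) (\csum_j g j) = \csum_i \csum_j (Cmult (f i) (g j)).
Proof. by rewrite big_distrl; apply: eq_bigr => i _; rewrite big_distrr. Qed.

Lemma csum_delta {I : finType} (a : I) (f : I -> C) :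
  \csum_i (if i == a then f i else RtoC 0) = f a.
Proof.
by rewrite (bigD1 a) //= eqxx big1 ?Cplus_0_r // => i /negbTE ->.
Qed.

(** The value 1/12 is a third of the 1/4 of the cotangent relation, since [triple_sum] averages over
    three labellings. The sum need not be evaluated: it depends only on the index type and cancels
    between the two families of points. *)
Definition triple_const (I : finType) : C :=
  \big[Cplus/RtoC 0]_(a : I) \big[Cplus/RtoC 0]_(b : I) \big[Cplus/RtoC 0]_(c : I)
    (if [&& a != b, a != c & b != c] then RtoC (/ 12) else RtoC 0).

(** The expanded square is written three times, each with another index as the centre. Added up,
    distinct triples give the cotangent relation, while triples with two equal indices give the
    squares of [d], by antisymmetry. *)
Lemma triple_sum {I : finType} (d : I -> I -> C) :
  (forall a, d a a = RtoC 0) -> (forall a b, d b a = Copp (d a b)) ->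
  (forall a b c, a != b -> a != c -> b != c ->
     Cplus (Cplus (Cmult (d a b) (d a c)) (Cmult (d b a) (d b c)))
       (Cmult (d c a) (d c b)) = RtoC (/ 4)) ->
  \csum_a Cmult (\csum_b d a b) (\csum_b d a b) =
  Cplus (\csum_a \csum_b Cmult (d a b) (d a b)) (triple_const I).
Proof.
move=> d0 da dt.
set S := \csum_a _.
set Q := \csum_a _.
have S1 : S = \csum_a \csum_b \csum_c Cmult (d a b) (d a c).
  by apply: eq_bigr => a _; rewrite csum_mult.
have S2 : S = \csum_a \csum_b \csum_c Cmult (d b a) (d b c).
  by rewrite S1 exchange_big.
have S3 : S = \csum_a \csum_b \csum_c Cmult (d c a) (d c b).
  rewrite S2; apply: eq_bigr => a _; exact: exchange_big.
have Q1 : Q = \csum_a \csum_b \csum_c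
    (if c == b then Cmult (d a b) (d a b) else RtoC 0).
  apply: eq_bigr => a _; apply: eq_bigr => b _.
  by rewrite (csum_delta b (fun _ => _)).
have Q2 : Q = \csum_a \csum_b \csum_c
    (if c == a then Cmult (d a b) (d a b) else RtoC 0).
  apply: eq_bigr => a _; apply: eq_bigr => b _.
  by rewrite (csum_delta a (fun _ => _)).
have Q3 : Q = \csum_a \csum_b \csum_c
    (if b == a then Cmult (d a c) (d a c) else RtoC 0).
  apply: eq_bigr => a _; rewrite exchange_big; apply: eq_bigr => b _.
  by rewrite (csum_delta a (fun _ => _)).
have H : Cplus (Cplus S S) S =
    Cplus (Cplus (Cplus Q Q) Q) (Cmult (RtoC 3) (triple_const I)).
  rewrite {1}S1 {1}S2 {1}S3 {1}Q1 {1}Q2 {1}Q3 /triple_const -csum_scal -!csum_plus.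
  apply: eq_bigr => a _; rewrite -csum_scal -!csum_plus.
  apply: eq_bigr => b _; rewrite -csum_scal -!csum_plus.
  apply: eq_bigr => c _; rewrite (eq_sym b a) (eq_sym c a) (eq_sym c b).
  case: (eqVneq a b) => [<-|ab] /=.
    case: (eqVneq a c) => [<-|ac] /=; first by rewrite d0; ring.
    by rewrite d0 (da a c); ring.
  case: (eqVneq a c) => [<-|ac] /=.
    by rewrite (eq_sym b a) (negbTE ab) d0 (da a b); ring.
  case: (eqVneq b c) => [<-|bc] /=; first by rewrite d0 (da a b); ring.
  rewrite dt // !Cplus_0_l -RtoC_mult; congr RtoC; field.
have h3 : RtoC 3 <> RtoC 0 by move=> /RtoC_inj; lra.
have e3 z : Cplus (Cplus z z) z = Cmult (RtoC 3) z.
  by rewrite /Cplus /Cmult /=; congr pair; ring.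
rewrite !e3 in H; rewrite -[S]Cmult_1_l -(Cinv_l _ h3) -Cmult_assoc H.
by field.
Qed.

(** Symmetrizing the sum in a and b allows the relation to be applied to every pair a != b. The
    relation is then extended to the diagonal, where [d] vanishes, and the excess B + B^2 is
    subtracted as the last sum. *)
Lemma cross_sum {I : finType} (B d : I -> I -> C) :
  (forall a, d a a = RtoC 0) ->
  (forall a b k, a != b ->
     Cplus (Cmult (B a k) (B b k)) (Cmult (RtoC (/ 2)) (Cplus (B a k) (B b k))) =
     Cplus (Cmult (d a b) (B a k)) (Cmult (d b a) (B b k))) ->
  Cmult (RtoC 2) (\csum_a Cmult (\csum_b d a b) (\csum_k B a k)) =
  Cplus (\csum_k Cmult (\csum_a B a k) (\csum_a B a k))
    (Cminus (Cmult (\big[Cplus/RtoC 0]_(a : I) RtoC 1) (\csum_a \csum_k B a k))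
       (\csum_a \csum_k Cplus (B a k) (Cmult (B a k) (B a k)))).
Proof.
move=> d0 H.
set S := \csum_a Cmult _ _.
have S1 : S = \csum_a \csum_b \csum_k Cmult (d a b) (B a k).
  by apply: eq_bigr => a _; rewrite csum_mult.
have S2 : S = \csum_a \csum_b \csum_k Cmult (d b a) (B b k) by rewrite S1 exchange_big.
set P := \csum_k Cmult _ _; set T := \csum_a \csum_k B a k; set Q := \csum_a \csum_k Cplus _ _.
have P1 : P = \csum_a \csum_b \csum_k Cmult (B a k) (B b k).
  transitivity (\csum_k \csum_a \csum_b Cmult (B a k) (B b k)).
    by apply: eq_bigr => k _; rewrite csum_mult.
  by rewrite exchange_big; apply: eq_bigr => a _; rewrite exchange_big.
have T1 : Cmult (\big[Cplus/RtoC 0]_(a : I) RtoC 1) T =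
    \big[Cplus/RtoC 0]_(a : I) \csum_b \csum_k B b k.
  by rewrite Cmult_comm -csum_scal; apply: eq_bigr => a _; rewrite Cmult_1_r.
have T2 : Cmult (\big[Cplus/RtoC 0]_(a : I) RtoC 1) T =
    \csum_a \big[Cplus/RtoC 0]_(b : I) \csum_k B a k.
  by rewrite T1 exchange_big.
have Q1 : Q = \csum_a \csum_b
    (if b == a then \csum_k Cplus (B a k) (Cmult (B a k) (B a k)) else RtoC 0).
  by apply: eq_bigr => a _; rewrite (csum_delta a (fun _ => _)).
have e : Cplus S S = Cplus P (Cplus (Cmult (RtoC (/ 2)) (Cplus
   (Cmult (\big[Cplus/RtoC 0]_(a : I) RtoC 1) T)
   (Cmult (\big[Cplus/RtoC 0]_(a : I) RtoC 1) T))) (Cmult (Copp (RtoC 1)) Q)).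
  rewrite {1}S1 {1}S2 {1}T1 {1}T2 P1 Q1 -!csum_scal -!csum_plus.
  rewrite -csum_scal -!csum_plus.
  apply: eq_bigr => a _; rewrite -!csum_plus -!csum_scal -!csum_plus.
  apply: eq_bigr => b _; case: (eqVneq b a) => [->|ab].
    rewrite -!csum_plus -!csum_scal -!csum_plus; apply: eq_bigr => k _.
    rewrite d0 /Cplus /Cmult /Copp /=; congr pair; field.
  rewrite Cmult_0_r Cplus_0_r -!csum_plus -csum_scal -csum_plus; apply: eq_bigr => k _.
  rewrite -H; last by rewrite eq_sym.
  by ring.
have e2 : Cmult (RtoC 2) S = Cplus S S.
  by rewrite /Cplus /Cmult /=; congr pair; ring.
rewrite e2 e; set X := Cmult (bigop _ _ _) _.
have -> : Cmult (RtoC (/ 2)) (Cplus X X) = X.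
  by rewrite /Cplus /Cmult /=; congr pair; field.
ring.
Qed.

(** [cross_sum] is applied to [A] with [d] and to its transpose with the negative of [e]. The total
    sum of [A], the sum of A + A^2 and [triple_const] do not change under transposition, so they
    cancel and only row sums, column sums and squares survive. *)
Lemma sum_identity {I : finType} (A d e : I -> I -> C) :
  (forall a, d a a = RtoC 0) -> (forall a, e a a = RtoC 0) ->
  (forall a b, d b a = Copp (d a b)) -> (forall a b, e b a = Copp (e a b)) ->
  (forall a b c, a != b -> a != c -> b != c ->
     Cplus (Cplus (Cmult (d a b) (d a c)) (Cmult (d b a) (d b c)))
       (Cmult (d c a) (d c b)) = RtoC (/ 4)) ->
  (forall a b c, a != b -> a != c -> b != c ->
     Cplus (Cplus (Cmult (e a b) (e a c)) (Cmult (e b a) (e b c)))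
       (Cmult (e c a) (e c b)) = RtoC (/ 4)) ->
  (forall a b k, a != b ->
     Cplus (Cmult (A a k) (A b k)) (Cmult (RtoC (/ 2)) (Cplus (A a k) (A b k))) =
     Cplus (Cmult (d a b) (A a k)) (Cmult (d b a) (A b k))) ->
  (forall a b k, a != b ->
     Cplus (Cmult (A k a) (A k b)) (Cmult (RtoC (/ 2)) (Cplus (A k a) (A k b))) =
     Cplus (Cmult (Copp (e a b)) (A k a)) (Cmult (Copp (e b a)) (A k b))) ->
  let D a := \csum_b d a b in let E a := \csum_b e a b in
  let row j := \csum_k A j k in let col k := \csum_j A j k in
  Cplus (Cminus (\csum_k Cmult (col k) (col k))
           (Cmult (RtoC 2) (\csum_k Cmult (E k) (col k))))
    (Cminus (\csum_k Cmult (E k) (E k)) (\csum_k \csum_l Cmult (e k l) (e k l))) =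
  Cminus (\csum_a Cmult (Cplus (D a) (row a)) (Cplus (D a) (row a)))
    (\csum_a \csum_b Cmult (d a b) (d a b)).
Proof.
move=> d0 e0 da ea dt et HA HB D E row col.
have hd := triple_sum d d0 da dt.
have he := triple_sum e e0 ea et.
have h1 := cross_sum A d d0 HA.
have h2 := cross_sum (fun k j => A j k) (fun a b => Copp (e a b))
  (fun a => etrans (congr1 Copp (e0 a)) (Copp_0)) HB.
rewrite -/row -/col in h1 h2 *.
have h3 : \csum_a Cmult (\csum_b Copp (e a b)) (\csum_k A k a) =
    Cmult (Copp (RtoC 1)) (\csum_k Cmult (E k) (col k)).
  rewrite -csum_scal; apply: eq_bigr => a _; rewrite Cmult_assoc; congr Cmult.
  by rewrite -csum_scal; apply: eq_bigr => b _; ring.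
rewrite h3 in h2.
have h4 : \csum_a Cmult (Cplus (D a) (row a)) (Cplus (D a) (row a)) =
  Cplus (\csum_a Cmult (D a) (D a))
    (Cplus (Cmult (RtoC 2) (\csum_a Cmult (D a) (row a))) (\csum_a Cmult (row a) (row a))).
  rewrite -csum_scal -!csum_plus; apply: eq_bigr => a _.
  by rewrite /Cplus /Cmult /=; congr pair; ring.
rewrite h4 h1 hd he.
have -> : Cminus (\csum_k Cmult (col k) (col k))
    (Cmult (RtoC 2) (\csum_k Cmult (E k) (col k))) =
  Cplus (\csum_k Cmult (col k) (col k))
    (Cmult (RtoC 2) (Cmult (Copp (RtoC 1)) (\csum_k Cmult (E k) (col k)))) by ring.
rewrite h2.
have -> : \csum_a \csum_k A k a = \csum_a \csum_k A a k by rewrite exchange_big.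
have -> : \csum_a \csum_k Cplus (A k a) (Cmult (A k a) (A k a)) =
   \csum_a \csum_k Cplus (A a k) (Cmult (A a k) (A a k)) by rewrite exchange_big.
set s1 := \csum_k Cmult (\csum_a A k a) _.
set s2 := \csum_k Cmult (\csum_a A a k) _.
ring.
Qed.

(* With [p = exp (i s)] and [q = exp (i t)] this is [- i / 2 cot ((t - s) / 2)]. *)
Definition halfcot (p q : C) : C := Cdiv (Cplus q p) (Cmult (RtoC 2) (Cminus q p)).

(** The zero diagonal lets sums over b != a run over all indices. *)
Definition halfcots {I : eqType} (z : I -> C) (a b : I) : C :=
  if a == b then RtoC 0 else halfcot (z a) (z b).

Lemma C2_neq0 : RtoC 2 <> RtoC 0.
Proof. by move=> /RtoC_inj; lra. Qed.

Lemma C2E : RtoC 2 = Cplus (RtoC 1) (RtoC 1).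
Proof. by rewrite -RtoC_plus; congr RtoC; ring. Qed.

Lemma Cminus_neq0 (a b : C) : a <> b -> Cminus a b <> RtoC 0.
Proof.
move=> h h0; apply: h; transitivity (Cplus (Cminus a b) b); first by ring.
by rewrite h0 Cplus_0_l.
Qed.

(** * Cotangent relations for two families of points *)

Section HalfCot.

Context {I : finType} (z : I -> C).
Hypothesis z_inj : forall a b, a != b -> z a <> z b.

Lemma halfcots_opp (a b : I) : halfcots z b a = Copp (halfcots z a b).
Proof.
rewrite /halfcots eq_sym; case: eqVneq => [_|h]; first by ring.
have h1 := Cminus_neq0 _ _ (z_inj _ _ h).
have h2 : z b <> z a by move=> h0; apply: z_inj h (esym h0).
have h3 := Cminus_neq0 _ _ h2; have h4 := C2_neq0.
by rewrite /halfcot; field.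
Qed.

Lemma halfcots_triple (a b c : I) : a != b -> a != c -> b != c ->
  Cplus (Cplus (Cmult (halfcots z a b) (halfcots z a c))
           (Cmult (halfcots z b a) (halfcots z b c)))
    (Cmult (halfcots z c a) (halfcots z c b)) = RtoC (/ 4).
Proof.
move=> ab ac bc.
rewrite (halfcots_opp b c) (halfcots_opp a c) (halfcots_opp a b).
rewrite /halfcots (negbTE ab) (negbTE ac) (negbTE bc).
have h1 := Cminus_neq0 _ _ (not_eq_sym (z_inj _ _ ab)).
have h2 := Cminus_neq0 _ _ (not_eq_sym (z_inj _ _ ac)).
have h3 := Cminus_neq0 _ _ (not_eq_sym (z_inj _ _ bc)).
have h4 := C2_neq0.
have -> : RtoC (/ 4) = Cinv (Cmult (RtoC 2) (RtoC 2)).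
  by rewrite -RtoC_mult -RtoC_inv; [congr RtoC; field | lra].
rewrite /halfcot; rewrite C2E in h4 *; field; by [].
Qed.

Context (xi : I -> C).
Hypothesis xi_inj : forall a b, a != b -> xi a <> xi b.
Hypothesis xi_z : forall a b, xi a <> z b.

(** Since A + 1/2 is the half cotangent of z_l and xi_j, this is the cotangent relation for xi_a,
    xi_b and z_k: its constant 1/4 cancels the 1/4 coming from the product, and the remaining halves
    cancel by antisymmetry. *)
Lemma cauchy_relation (a b k : I) : a != b ->
  let A j l := Cdiv (z l) (Cminus (xi j) (z l)) in
  Cplus (Cmult (A a k) (A b k)) (Cmult (RtoC (/ 2)) (Cplus (A a k) (A b k))) =
  Cplus (Cmult (halfcots xi a b) (A a k)) (Cmult (halfcots xi b a) (A b k)).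
Proof.
move=> ab A; rewrite /halfcots (eq_sym b a) (negbTE ab) /A.
have h1 := Cminus_neq0 _ _ (xi_inj _ _ ab).
have h1' := Cminus_neq0 _ _ (not_eq_sym (xi_inj _ _ ab)).
have h2 := Cminus_neq0 _ _ (xi_z a k).
have h3 := Cminus_neq0 _ _ (xi_z b k).
have h4 := C2_neq0.
rewrite RtoC_inv; last lra.
rewrite /halfcot; rewrite C2E in h4 *; field; by [].
Qed.

(** The same relation for z_a, z_b and xi_k. The half cotangent is now centred at xi_k, with
    arguments in the other order, hence the opposite sign. *)
Lemma cauchy_relation' (a b k : I) : a != b ->
  let A j l := Cdiv (z l) (Cminus (xi j) (z l)) in
  Cplus (Cmult (A k a) (A k b)) (Cmult (RtoC (/ 2)) (Cplus (A k a) (A k b))) =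
  Cplus (Cmult (Copp (halfcots z a b)) (A k a)) (Cmult (Copp (halfcots z b a)) (A k b)).
Proof.
move=> ab A; rewrite /halfcots (eq_sym b a) (negbTE ab) /A.
have h1 := Cminus_neq0 _ _ (z_inj _ _ ab).
have h1' := Cminus_neq0 _ _ (not_eq_sym (z_inj _ _ ab)).
have h2 := Cminus_neq0 _ _ (xi_z k a).
have h3 := Cminus_neq0 _ _ (xi_z k b).
have h4 := C2_neq0.
rewrite RtoC_inv; last lra.
rewrite /halfcot; rewrite C2E in h4 *; field; by [].
Qed.

End HalfCot.

Lemma csum_upper {N : nat} (g : 'I_N -> 'I_N -> C) :
  (forall j k, g j k = g k j) ->
  Cmult (RtoC 2) (\big[Cplus/RtoC 0]_(j < N) \big[Cplus/RtoC 0]_(k < N | (j < k)%N) g j k) =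
  \csum_j \csum_k (if j == k then RtoC 0 else g j k).
Proof.
move=> hg; set S := \big[Cplus/_]_(j < N) _.
have S1 : S = \big[Cplus/RtoC 0]_(j < N) \big[Cplus/RtoC 0]_(k < N) (if (j < k)%N then g j k else RtoC 0).
  by apply: eq_bigr => j _; rewrite big_mkcond.
have S2 : S = \big[Cplus/RtoC 0]_(j < N) \big[Cplus/RtoC 0]_(k < N) (if (k < j)%N then g j k else RtoC 0).
  rewrite S1 exchange_big; apply: eq_bigr => j _; apply: eq_bigr => k _.
  by rewrite hg.
have -> : Cmult (RtoC 2) S = Cplus S S by rewrite C2E; ring.
rewrite {1}S1 {1}S2 -csum_plus; apply: eq_bigr => j _; rewrite -csum_plus.
apply: eq_bigr => k _; rewrite -val_eqE /=.
by case: ltngtP => _; ring.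
Qed.

(** This is the source of the shifts in E_n. The case a >= N is included because the induction on N
    passes through it before reaching a. *)
Lemma sum_half_sign (N a : nat) :
  \big[Rplus/0]_(b < N) (if (a < b)%N then / 2 else if (b < a)%N then - / 2 else 0) =
  if (a < N)%N then / 2 * (INR N + 1) - INR a.+1 else - (/ 2 * INR N).
Proof.
elim: N => [|N IH]; first by rewrite big_ord0 /=; ring.
rewrite !S_INR big_ord_recr /= IH !S_INR ltnS.
case: ltngtP => [h|h|->]; lra.
Qed.

Lemma sum_half_sign_ord (N : nat) (a : 'I_N) :
  \big[Rplus/0]_(b < N) (if (a < b)%N then / 2 else if (b < a)%N then - / 2 else 0) =
  / 2 * (INR N + 1) - INR a.+1.
Proof. by rewrite sum_half_sign ltn_ord. Qed.

Lemma RtoC_sum {I : Type} (r : seq.seq I) (P : pred I) (f : I -> R) :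
  RtoC (\big[Rplus/0]_(i <- r | P i) f i) = \big[Cplus/RtoC 0]_(i <- r | P i) RtoC (f i).
Proof. exact: (big_morph RtoC RtoC_plus (erefl _)). Qed.

(** * The points z_k and xi_j, and the logarithmic derivatives expressed in them at eps = 1 *)

Definition indic {N : nat} (k l : 'I_N) : R := if l == k then 1 else 0.

Local Notation xdir k := (wdir 0 (indic k) (fun _ => 0)).
Local Notation ydir a := (wdir 0 (fun _ => 0) (indic a)).

Definition zpt {N : nat} (x : 'I_N -> R) (k : 'I_N) : C := Cexp (0, x k).

(** The moduli exp 1, ..., exp N are distinct and greater than 1, so these points differ from each
    other and from every z_k whatever [y] is. *)
Definition xipt {N : nat} (y : 'I_N -> R) (j : 'I_N) : C := Cexp (INR j.+1, y j).

Lemma zpt_neq {N : nat} (x : 'I_N -> R) (j k : 'I_N) :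
  distinct_mod_2pi x -> j != k -> zpt x j <> zpt x k.
Proof.
move=> hx jk; rewrite /zpt /Cexp /= exp_0 !Rmult_1_l => -[h1 h2].
have h3 : cos (x j - x k) = 1.
  by rewrite cos_minus h1 h2; have := sin2_cos2 (x k); rewrite /Rsqr; lra.
have h4 : sin ((x j - x k) / 2) = 0.
  have := cos_2a_sin ((x j - x k) / 2).
  have -> : 2 * ((x j - x k) / 2) = x j - x k by field.
  by rewrite h3; nra.
have [m hm] := sin_eq_0_0 _ h4.
by apply: (hx j k (elimN eqP jk) m); lra.
Qed.

Lemma xipt_neq {N : nat} (y : 'I_N -> R) (j k : 'I_N) : j != k -> xipt y j <> xipt y k.
Proof.
move=> jk h; have := congr1 Cmod h; rewrite !Cmod_Cexp /= => /exp_inv e.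
by move/eqP: jk; apply; apply: ord_inj; apply: eq_add_S; apply: INR_eq.
Qed.

Lemma xipt_zpt_neq {N : nat} (x y : 'I_N -> R) (j k : 'I_N) : xipt y j <> zpt x k.
Proof.
move=> h; have := congr1 Cmod h; rewrite !Cmod_Cexp => /exp_inv e.
have := lt_0_INR _ (PeanoNat.Nat.lt_0_succ j); move: e; rewrite {1 2}/Re; cbn [fst]; lra.
Qed.

Lemma Cexp_minus (a b : C) : Cexp (Cminus a b) = Cdiv (Cexp a) (Cexp b).
Proof. by rewrite /Cminus Cexp_add Cexp_opp. Qed.

Lemma geo_minus (a b : C) : Cexp b <> Cexp a ->
  geo (Cminus a b) = Cdiv (Cexp a) (Cminus (Cexp b) (Cexp a)).
Proof.
move=> h; rewrite /geo Cexp_minus.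
have h1 := Cminus_neq0 _ _ h; have h2 := Cexp_neq0 b.
by field.
Qed.

Lemma geo_wexp {N : nat} (x y : 'I_N -> R) (j k : 'I_N) :
  geo (wexp 1 x y j k) = Cdiv (zpt x k) (Cminus (xipt y j) (zpt x k)).
Proof.
rewrite -geo_minus; last exact: xipt_zpt_neq.
by congr geo; rewrite /wexp /Cminus /Cplus /Copp; cbn [fst snd]; congr pair; ring.
Qed.

Lemma geo_uexp {N : nat} (y : 'I_N -> R) (j k : 'I_N) : j != k ->
  geo (uexp 1 y j k) = Cminus (halfcots (xipt y) j k) (RtoC (/ 2)).
Proof.
move=> jk; have h := not_eq_sym (xipt_neq y j k jk).
transitivity (Cdiv (xipt y j) (Cminus (xipt y k) (xipt y j))).
  rewrite -geo_minus //.
  congr geo; rewrite /uexp /Cminus /Cplus /Copp; cbn [fst snd]; rewrite !S_INR.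
  by congr pair; ring.
rewrite /halfcots (negbTE jk) /halfcot RtoC_inv; last lra.
have h1 := Cminus_neq0 _ _ h; have h2 := C2_neq0.
by rewrite C2E in h2 *; field.
Qed.

Lemma logder_x {N : nat} (lam : R) (x y : 'I_N -> R) (k : 'I_N) :
  logder lam 1 x (udir 0 (fun _ => 0)) (xdir k) y =
  Cmult (Cmult Ci (RtoC lam)) (\csum_j geo (wexp 1 x y j k)).
Proof.
rewrite /logder big1 ?Cplus_0_l; last first.
  move=> j _; rewrite big1 // => l _.
  have -> : udir 0 (fun _ => 0) j l = RtoC 0.
    by rewrite /udir /RtoC; congr pair; ring.
  ring.
rewrite -csum_scal; apply: eq_bigr => j _.
rewrite -(csum_delta k (fun l => Cmult _ (geo (wexp 1 x y j l)))).
apply: eq_bigr => l _; rewrite /wdir /indic; case: eqP => _.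
  by congr Cmult; rewrite /Ci /Cmult /=; congr pair; ring.
rewrite -[RHS](Cmult_0_l (geo (wexp 1 x y j l))); congr Cmult.
by rewrite /Cmult /RtoC /=; congr pair; ring.
Qed.

Lemma logder2_x {N : nat} (lam : R) (x y : 'I_N -> R) (k : 'I_N) :
  logder2 lam 1 x (udir 0 (fun _ => 0)) (xdir k) y =
  Cmult (Copp (RtoC lam)) (\csum_j Cplus (geo (wexp 1 x y j k))
    (Cmult (geo (wexp 1 x y j k)) (geo (wexp 1 x y j k)))).
Proof.
rewrite /logder2 big1 ?Cplus_0_l; last first.
  move=> j _; rewrite big1 // => l _.
  have -> : udir 0 (fun _ => 0) j l = RtoC 0.
    by rewrite /udir /RtoC; congr pair; ring.
  ring.
rewrite -csum_scal; apply: eq_bigr => j _.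
rewrite -(csum_delta k (fun l => Cmult _ (Cplus (geo (wexp 1 x y j l)) _))).
apply: eq_bigr => l _; set X := Cplus _ _; rewrite Cmult_assoc /wdir /indic.
case: eqP => _.
  by congr Cmult; rewrite /Cmult /Copp /=; congr pair; ring.
rewrite -[RHS](Cmult_0_l X); congr Cmult.
by rewrite /Cmult /RtoC /=; congr pair; ring.
Qed.

(** For a < b the pair contributes c(a, b) - 1/2; for b < a antisymmetry turns - (c(b, a) - 1/2)
    into c(a, b) + 1/2. The cotangents thus form a full sum over b, and the halves add up by
    [sum_half_sign_ord]. *)
Lemma logder_y {N : nat} (lam : R) (x y : 'I_N -> R) (a : 'I_N) :
  logder lam 1 x (udir 0 (indic a)) (ydir a) y =
  Cmult (Copp (Cmult Ci (RtoC lam)))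
    (Cminus (Cplus (\csum_b halfcots (xipt y) a b) (\csum_k geo (wexp 1 x y a k)))
       (RtoC (/ 2 * (INR N + 1) - INR a.+1))).
Proof.
have e1 : \csum_j \csum_k Cmult (Cmult (RtoC lam) (ydir a j k)) (geo (wexp 1 x y j k)) =
    Cmult (Copp (Cmult Ci (RtoC lam))) (\csum_k geo (wexp 1 x y a k)).
  rewrite -(csum_delta a (fun j => Cmult _ (\csum_k geo (wexp 1 x y j k)))).
  apply: eq_bigr => j _; rewrite /wdir /indic; case: eqP => _.
    rewrite -csum_scal; apply: eq_bigr => k _; congr Cmult.
    by rewrite /Ci /Cmult /Copp /=; congr pair; ring.
  rewrite big1 // => k _; rewrite -[RHS](Cmult_0_l (geo (wexp 1 x y j k))); congr Cmult.
  by rewrite /Cmult /RtoC /=; congr pair; ring.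
pose c := Copp (Cmult Ci (RtoC lam)).
pose X (j l : 'I_N) := if (j < l)%N then Cmult c (geo (uexp 1 y j l)) else RtoC 0.
have e2 : \big[Cplus/RtoC 0]_(j < N) \big[Cplus/RtoC 0]_(k < N | (j < k)%N)
     Cmult (Copp (Cmult (RtoC lam) (udir 0 (indic a) j k))) (geo (uexp 1 y j k)) =
   \csum_b Cminus (X a b) (X b a).
  transitivity (Cplus (\csum_j (if j == a then \csum_l X j l else RtoC 0))
     (\csum_j Copp (\csum_l (if l == a then X j l else RtoC 0)))).
    rewrite -csum_plus; apply: eq_bigr => j _; rewrite big_mkcond.
    have -> : (if j == a then \csum_l X j l else RtoC 0) =
        \csum_l (if j == a then X j l else RtoC 0).
      by case: (j == a) => //; rewrite big1.
    have -> z : Copp z = Cmult (Copp (RtoC 1)) z by ring.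
    rewrite -csum_scal -csum_plus; apply: eq_bigr => l _.
    rewrite /X /udir /indic /c; case: (j < l)%N; last by case: (j == a); case: (l == a); ring.
    case: (j == a); case: (l == a); set g := geo _;
      rewrite /Ci /Cmult /Cplus /Copp /RtoC /=; congr pair; ring.
  rewrite csum_delta -csum_plus; apply: eq_bigr => j _.
  by rewrite (csum_delta a (X j)).
rewrite /logder e1 e2 -(sum_half_sign_ord N a) RtoC_sum.
have -> (u v w : C) : Cminus (Cplus u v) w = Cplus (Cplus u (Cmult (Copp (RtoC 1)) w)) v.
  by ring.
rewrite Cmult_plus_distr_l; congr Cplus.
rewrite -csum_scal -csum_plus -csum_scal; apply: eq_bigr => b _; rewrite /X -/c.
case: (ltngtP a b) => h.
- rewrite geo_uexp; last by apply/eqP => h0; rewrite h0 ltnn in h.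
  ring.
- have ba : b != a by apply/eqP => h0; rewrite h0 ltnn in h.
  rewrite geo_uexp // halfcots_opp; last exact: xipt_neq.
  rewrite (RtoC_opp (/ 2)); set t := halfcots _ _ _.
  ring.
- by rewrite /halfcots (_ : a == b) //; [ring | apply/eqP/ord_inj].
Qed.

(** The exponent of a pair (j, k) moves with velocity i when a = j and - i when a = k. Both squares
    are -1, hence the factor 2, whereas an exponent joining y_j to x_k moves for a = j only. *)
Lemma logder2_y {N : nat} (lam : R) (x y : 'I_N -> R) :
  \csum_a logder2 lam 1 x (udir 0 (indic a)) (ydir a) y =
  Cminus
    (Cmult (RtoC (2 * lam))
       (\big[Cplus/RtoC 0]_(j < N) \big[Cplus/RtoC 0]_(k < N | (j < k)%N)
          Cplus (geo (uexp 1 y j k)) (Cmult (geo (uexp 1 y j k)) (geo (uexp 1 y j k)))))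
    (Cmult (RtoC lam) (\csum_j \csum_k Cplus (geo (wexp 1 x y j k))
          (Cmult (geo (wexp 1 x y j k)) (geo (wexp 1 x y j k))))).
Proof.
rewrite /logder2 csum_plus; congr Cplus.
  rewrite exchange_big -csum_scal; apply: eq_bigr => j _.
  rewrite big_distrr /= exchange_big; apply: eq_bigr => k hk.
  set X := Cplus _ _.
  have jk : j != k by apply/eqP => h; rewrite h ltnn in hk.
  transitivity (Cplus (\csum_a (if a == j then Cmult (RtoC lam) X else RtoC 0))
    (\csum_a (if a == k then Cmult (RtoC lam) X else RtoC 0))).
    rewrite -csum_plus; apply: eq_bigr => a _.
    rewrite Cmult_assoc /udir /indic ![a == _]eq_sym; case: (eqVneq j a) => [ja|_].
      rewrite -ja [k == _]eq_sym (negbTE jk) Cplus_0_r; congr Cmult.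
      by rewrite /Cmult /Copp /RtoC /=; congr pair; ring.
    case: (k == a); rewrite ?Cplus_0_l.
      by congr Cmult; rewrite /Cmult /Copp /RtoC /=; congr pair; ring.
    rewrite -[RHS](Cmult_0_l X); congr Cmult.
    by rewrite /Cmult /Copp /RtoC /=; congr pair; ring.
  rewrite !(csum_delta _ (fun _ => _)) RtoC_mult C2E; ring.
have -> z : Copp (Cmult (RtoC lam) z) = Cmult (Copp (RtoC lam)) z by ring.
rewrite exchange_big -csum_scal; apply: eq_bigr => j _.
rewrite exchange_big -csum_scal; apply: eq_bigr => k _.
set X := Cplus _ _.
rewrite -(csum_delta j (fun _ => Cmult _ X)); apply: eq_bigr => a _.
rewrite Cmult_assoc /wdir /indic eq_sym; case: (a == j).
  by congr Cmult; rewrite /Cmult /Copp /RtoC /=; congr pair; ring.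
rewrite -[RHS](Cmult_0_l X); congr Cmult.
by rewrite /Cmult /Copp /RtoC /=; congr pair; ring.
Qed.

Lemma iterated_ext {N : nat} {n : 'I_N -> Z} {f g : ('I_N -> R) -> C} {v : C} :
  is_iterated_integral n f v -> (forall y, f y = g y) -> is_iterated_integral n g v.
Proof. by move=> h /functional_extensionality <-. Qed.

Lemma iterated_0 {N : nat} (n : 'I_N -> Z) :
  is_iterated_integral n (fun _ => RtoC 0) (RtoC 0).
Proof.
have h := iterated_Lint (nice_lipschitz (nice_const (RtoC 0))) (n := n).
have := iterated_scal _ _ (RtoC 0) _ _ h; by rewrite !Cmult_0_l.
Qed.

Lemma iterated_sum {N : nat} {n : 'I_N -> Z} {I : Type} (r : seq.seq I) (P : pred I)
    (f : I -> ('I_N -> R) -> C) (v : I -> C) :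
  (forall i, P i -> is_iterated_integral n (f i) (v i)) ->
  is_iterated_integral n (fun y => \big[Cplus/RtoC 0]_(i <- r | P i) f i y)
    (\big[Cplus/RtoC 0]_(i <- r | P i) v i).
Proof.
move=> H; elim: r => [|i r IH].
  by rewrite big_nil; apply: (iterated_ext (iterated_0 n)) => y; rewrite big_nil.
rewrite big_cons; case hP: (P i); last by apply: (iterated_ext IH) => y; rewrite big_cons hP.
by apply: (iterated_ext (iterated_plus _ _ _ _ _ _ (H i hP) IH)) => y; rewrite big_cons hP.
Qed.

Lemma cderive_continuous {f : R -> C} {t : R} {l : C} :
  cderive f t l -> continuous (U := C_R_NormedModule) f t.
Proof.
by move=> h; apply: (@ex_derive_continuous R_AbsRing C_R_NormedModule); exists l.
Qed.

(** * Integration by parts for the kernel, and the dependence on the regularization *)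

Section Moments.

Context {N : nat} (lam : R) (n : 'I_N -> Z).

Notation ydot eps x a := (logder lam eps x (udir 0 (indic a)) (ydir a)).

Lemma translate_flow (a : 'I_N) (s : R) (y : 'I_N -> R) :
  (fun l => y l + s * indic a l) = translate a s y.
Proof.
apply: functional_extensionality => l; rewrite /translate /indic.
by case: (l == a); ring.
Qed.

Lemma zero_flow (s : R) (x : 'I_N -> R) : (fun l => x l + s * 0) = x.
Proof. by apply: functional_extensionality => l; ring. Qed.

Lemma unif_deriv_kernel_y (eps : R) (x : 'I_N -> R) (a : 'I_N) : 0 < eps ->
  unif_deriv (fun s y => kernel lam eps x (translate a s y))
    (fun y => Cmult (ydot eps x a y) (kernel lam eps x y)).
Proof.
move=> he.
apply: (unif_deriv_eq (unif_deriv_kernel lam eps 0 x (fun _ => 0) (indic a) he)) => // s y.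
by rewrite translate_flow zero_flow Rmult_0_r Rplus_0_r.
Qed.

Lemma iterated_ydot (eps : R) (x : 'I_N -> R) (a : 'I_N) : 0 < eps ->
  is_iterated_integral n (fun y => Cmult (ydot eps x a y) (kernel lam eps x y))
    (Cmult (0, - IZR (n a)) (Lint n (kernel lam eps x))).
Proof.
move=> he; have [_ hl hp] := nice_kernel lam eps x he.
apply: (iterated_by_parts hl hp _ (unif_deriv_kernel_y _ _ _ he) (iterated_Lint hl)).
by apply: nice_lipschitz; apply: nice_mult; [exact: nice_logder | exact: nice_kernel].
Qed.

Lemma iterated_ydot2 (eps : R) (x : 'I_N -> R) (a : 'I_N) : 0 < eps ->
  is_iterated_integral n (fun y => Cmult
      (Cplus (Cmult (ydot eps x a y) (ydot eps x a y))
         (logder2 lam eps x (udir 0 (indic a)) (ydir a) y)) (kernel lam eps x y))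
    (Cmult (Copp (RtoC (IZR (n a) ^ 2))) (Lint n (kernel lam eps x))).
Proof.
move=> he; have hk := nice_kernel lam eps x he.
have hy : nice (ydot eps x a) by exact: nice_logder.
have [_ hl hp] := nice_mult hy hk.
have hd := unif_deriv_logder lam eps 0 x (fun _ => 0) (indic a) he.
have hd' : unif_deriv (fun s y => ydot eps x a (translate a s y))
    (logder2 lam eps x (udir 0 (indic a)) (ydir a)).
  apply: (unif_deriv_eq hd) => // s y.
  by rewrite translate_flow zero_flow Rmult_0_r Rplus_0_r.
have h := iterated_by_parts hl hp _
  (unif_deriv_mult hd' (unif_deriv_kernel_y _ x a he)) (iterated_ydot _ _ _ he).
have -> : Cmult (Copp (RtoC (IZR (n a) ^ 2))) (Lint n (kernel lam eps x)) =
   Cmult (0, - IZR (n a)) (Cmult (0, - IZR (n a)) (Lint n (kernel lam eps x))).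
  rewrite Cmult_assoc; congr Cmult.
  by rewrite /Cmult /Copp /RtoC /=; congr pair; ring.
have e0 : translate a 0 = id.
  apply: functional_extensionality => y; apply: functional_extensionality => l.
  by rewrite /translate; case: (l == a); ring.
apply: (iterated_ext (h _)) => [|y]; last by rewrite e0 /=; ring.
rewrite e0; apply: nice_lipschitz; apply: nice_plus; apply: nice_mult => //.
  exact: nice_logder2.
exact: nice_mult.
Qed.

Definition weight_sum : R := \big[Rplus/0]_(a < N) (INR a.+1 * IZR (n a)).

(** Changing [eps] amounts to translating each y_a in the imaginary direction at a speed equal to
    its one-based index. The [eps]-derivative is therefore a combination of the y-derivatives, whose
    integrals are already known. *)
Lemma logder_eps (eps : R) (x y : 'I_N -> R) :
  logder lam eps x (udir 1 (fun _ => 0)) (wdir 1 (fun _ => 0) (fun _ => 0)) y =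
  \big[Cplus/RtoC 0]_(a < N) Cmult (0, - INR a.+1) (ydot eps x a y).
Proof.
rewrite /logder (eq_bigr _ (fun a _ => Cmult_plus_distr_l _ _ _)) csum_plus.
have hs (c : 'I_N -> R) (j : 'I_N) :
    \csum_a (if a == j then (c a, 0) : C else RtoC 0) = (c j, 0).
  exact: (csum_delta j (fun a => (c a, 0) : C)).
congr Cplus.
  under [RHS]eq_bigr => a _ do rewrite big_distrr.
  rewrite exchange_big; apply: eq_bigr => j _ /=.
  under [RHS]eq_bigr => a _ do rewrite big_distrr.
  rewrite exchange_big; apply: eq_bigr => k hk /=.
  rewrite (eq_bigr (fun a => Cmult (Copp (Cmult (RtoC lam) (geo (uexp eps y j k))))
     (Cplus (if a == j then (INR a.+1, 0) : C else RtoC 0)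
       (if a == k then (- INR a.+1, 0) : C else RtoC 0)))); last first.
    move=> a _; rewrite /udir /indic ![a == _]eq_sym.
    set g := geo _; case: (j == a); case: (k == a);
      rewrite /Cmult /Cplus /Copp /RtoC /=; congr pair; ring.
  rewrite csum_scal csum_plus (hs (fun a => INR a.+1)) (hs (fun a => - INR a.+1)).
  rewrite /udir !S_INR; set g := geo _.
  by rewrite /Cmult /Cplus /Copp /RtoC /=; congr pair; ring.
under [RHS]eq_bigr => a _ do rewrite big_distrr.
rewrite [RHS]exchange_big; apply: eq_bigr => j _ /=.
under [RHS]eq_bigr => a _ do rewrite big_distrr.
rewrite exchange_big; apply: eq_bigr => k _ /=.
rewrite (eq_bigr (fun a => Cmult (Cmult (RtoC lam) (geo (wexp eps x y j k)))
   (if a == j then (- INR a.+1, 0) : C else RtoC 0))); last first.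
  move=> a _; rewrite /wdir /indic ![a == _]eq_sym.
  set g := geo _; case: (j == a);
    rewrite /Cmult /Cplus /Copp /RtoC /=; congr pair; ring.
rewrite csum_scal (hs (fun a => - INR a.+1)) /wdir; set g := geo _.
by rewrite /Cmult /Cplus /Copp /RtoC /=; congr pair; ring.
Qed.

Lemma cderive_Lint_eps (eps : R) (x : 'I_N -> R) : 0 < eps ->
  cderive (fun t => Lint n (kernel lam t x)) eps
    (Cmult (RtoC (- weight_sum)) (Lint n (kernel lam eps x))).
Proof.
move=> he.
apply: (cderive_iterated (f := fun t => kernel lam t x) (eta := eps / 2) (n := n)
  (f' := fun y => Cmult (logder lam eps x (udir 1 (fun _ => 0))
     (wdir 1 (fun _ => 0) (fun _ => 0)) y) (kernel lam eps x y))); first lra.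
- apply: (unif_deriv_eq (unif_deriv_kernel lam eps 1 x (fun _ => 0) (fun _ => 0) he)) => //.
  by move=> s y; rewrite !zero_flow Rmult_1_r.
- move=> s hs; apply: iterated_Lint; apply: nice_lipschitz; apply: nice_kernel.
  by have := Rabs_maj2 s; lra.
have h := iterated_sum (index_enum 'I_N) xpredT _ _ (fun a _ =>
  iterated_scal _ _ (0, - INR (nat_of_ord a).+1) _ _ (iterated_ydot eps x a he)).
have -> : Cmult (RtoC (- weight_sum)) (Lint n (kernel lam eps x)) =
   \big[Cplus/RtoC 0]_(a < N) Cmult (0, - INR a.+1) (Cmult (0, - IZR (n a)) (Lint n (kernel lam eps x))).
  have -> : - weight_sum = -1 * weight_sum by ring.
  rewrite RtoC_mult /weight_sum RtoC_sum -csum_scal Cmult_comm -csum_scal.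
  apply: eq_bigr => a _; set g := Lint _ _.
  by rewrite /Cmult /RtoC /=; congr pair; ring.
apply: (iterated_ext h) => y; rewrite logder_eps Cmult_comm -csum_scal.
by apply: eq_bigr => a _; rewrite [RHS]Cmult_comm -Cmult_assoc.
Qed.

Definition calP1 (x : 'I_N -> R) : C :=
  Cmult (Cexp (RtoC weight_sum)) (Lint n (kernel lam 1 x)).

(** The product of exp (eps * weight_sum) and the integral has derivative 0 on the positive
    half-line, so it keeps its value at [eps = 1], which is [calP1]. *)
Lemma Lint_eps (eps : R) (x : 'I_N -> R) : 0 < eps ->
  Lint n (kernel lam eps x) = Cmult (Cexp (RtoC (- (weight_sum * eps)))) (calP1 x).
Proof.
move=> he.
pose h t := Cmult (Cexp (Cplus (RtoC 0) (Cmult (RtoC t) (RtoC weight_sum))))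
  (Lint n (kernel lam t x)).
have dh t : 0 < t -> cderive h t (RtoC 0).
  move=> ht; apply: (cderive_eq (cderive_mult (cderive_Cexp (cderive_affine _ _ t))
    (cderive_Lint_eps t x ht))).
  by rewrite RtoC_opp; ring.
have hconst a b : 0 < a -> a < b -> h a = h b.
  move=> ha hab; apply: (eq_is_derive h a b _ hab) => t ht; apply: dh; lra.
have h1 : h eps = h 1.
  have [hlt|[->//|hgt]] := Rtotal_order eps 1; first exact: hconst.
  by rewrite (hconst 1 eps) //; lra.
have h2 : h 1 = calP1 x.
  by rewrite /h /calP1; congr Cmult; congr Cexp; ring.
rewrite -h2 -h1 /h Cmult_assoc -Cexp_add.
have -> : Cplus (RtoC (- (weight_sum * eps)))
   (Cplus (RtoC 0) (Cmult (RtoC eps) (RtoC weight_sum))) = RtoC 0.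
  by rewrite RtoC_opp RtoC_mult; ring.
by rewrite Cexp_0 Cmult_1_l.
Qed.

Lemma is_calP_calP1 (x : 'I_N -> R) : is_calP lam n x (calP1 x).
Proof.
exists (fun eps => Lint n (kernel lam eps x)); split.
  move=> eps he; apply: iterated_Lint; apply: nice_lipschitz; exact: nice_kernel.
apply: (filterlim_ext_loc (fun eps => Cmult (Cexp (RtoC (- (weight_sum * eps)))) (calP1 x))).
  exists (mkposreal 1 Rlt_0_1) => eps _ he; by rewrite Lint_eps.
(* The closed form makes sense, and is differentiable, at [eps = 0]; the one-sided limit is its
   value there. *)
have hd : cderive (fun eps => Cmult (Cexp (Cplus (RtoC 0)
   (Cmult (RtoC eps) (RtoC (- weight_sum))))) (calP1 x)) 0 _ :=
  cderive_mult (cderive_Cexp (cderive_affine _ _ 0)) (cderive_const _ _).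
have hc := cderive_continuous hd.
rewrite /continuous Cplus_0_flow Cexp_0 Cmult_1_l in hc.
move=> P /hc [d Hd]; exists d => t ht _.
have -> : RtoC (- (weight_sum * t)) = Cplus (RtoC 0) (Cmult (RtoC t) (RtoC (- weight_sum))).
  by rewrite -RtoC_mult -RtoC_plus; congr RtoC; ring.
exact: Hd t ht.
Qed.

Lemma is_calP_unique (x : 'I_N -> R) (p : C) : is_calP lam n x p -> p = calP1 x.
Proof.
move=> [I [hI lI]]; have [J [hJ lJ]] := is_calP_calP1 x.
apply: (filterlim_locally_unique (V := C_R_NormedModule) (F := at_right 0) I) => //.
apply: filterlim_ext_loc lJ.
exists (mkposreal 1 Rlt_0_1) => eps _ he; exact: iterated_unique (hJ eps he) (hI eps he).
Qed.

Lemma calPE (x : 'I_N -> R) : calP lam n x = calP1 x.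
Proof.
apply: (iota_unique (V := C_R_CompleteNormedModule)); last exact: is_calP_calP1.
by move=> p; exact: is_calP_unique.
Qed.

End Moments.

(** Both sides are operators applied to the kernel and divided by it. On the left stands the
    conjugate of H by Psi_0, written with sum_l e k l = i times the k-th sum of half cotangents; on
    the right - sum_a (d/dy_a - i lam s_a)^2 and the pair term. *)
Lemma pointwise_identity {N : nat} (lam : R) (x y : 'I_N -> R) : distinct_mod_2pi x ->
  let X k := logder lam 1 x (udir 0 (fun _ => 0)) (xdir k) y in
  let X2 k := logder2 lam 1 x (udir 0 (fun _ => 0)) (xdir k) y in
  let Y a := logder lam 1 x (udir 0 (indic a)) (ydir a) y in
  let Y2 a := logder2 lam 1 x (udir 0 (indic a)) (ydir a) y in
  let s a := / 2 * (INR N + 1) - INR (nat_of_ord a).+1 in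
  let e := halfcots (zpt x) in
  Cplus (Cplus (Copp (\csum_k (Cplus (Cmult (X k) (X k)) (X2 k))))
       (Cmult (Cmult (RtoC (2 * lam)) Ci) (\csum_k Cmult (\csum_l e k l) (X k))))
    (Cmult (RtoC (lam * lam)) (Cplus (\csum_k Cmult (\csum_l e k l) (\csum_l e k l))
       (\csum_k \csum_l (if k == l then RtoC 0 else
          Cminus (RtoC (/ 4)) (Cmult (e k l) (e k l)))))) =
  Cminus (\csum_a Cplus (Cplus (Copp (Cplus (Cmult (Y a) (Y a)) (Y2 a)))
       (Cmult (Cmult (RtoC (2 * lam)) Ci) (Cmult (RtoC (s a)) (Y a))))
       (RtoC (lam * lam * (s a * s a))))
    (Cmult (RtoC (gam lam))
      (\big[Cplus/RtoC 0]_(j < N) \big[Cplus/RtoC 0]_(k < N | (j < k)%N)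
        Cplus (geo (uexp 1 y j k)) (Cmult (geo (uexp 1 y j k)) (geo (uexp 1 y j k))))).
Proof.
move=> hx X X2 Y Y2 s e.
pose d := halfcots (xipt y).
pose A j k := geo (wexp 1 x y j k).
set U := \big[Cplus/RtoC 0]_(j < N) _.
have zn a b : a != b -> zpt x a <> zpt x b by exact: zpt_neq.
have xn a b : a != b -> xipt y a <> xipt y b by exact: xipt_neq.
have hA j k : A j k = Cdiv (zpt x k) (Cminus (xipt y j) (zpt x k)) by exact: geo_wexp.
have d0 (z : 'I_N -> C) a : halfcots z a a = RtoC 0 by rewrite /halfcots eqxx.
have HA a b k : a != b ->
    Cplus (Cmult (A a k) (A b k)) (Cmult (RtoC (/ 2)) (Cplus (A a k) (A b k))) =
    Cplus (Cmult (d a b) (A a k)) (Cmult (d b a) (A b k)).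
  move=> ab; rewrite !hA; apply: (cauchy_relation (zpt x) (xipt y)) => // ? ?.
  exact: xipt_zpt_neq.
have HB a b k : a != b ->
    Cplus (Cmult (A k a) (A k b)) (Cmult (RtoC (/ 2)) (Cplus (A k a) (A k b))) =
    Cplus (Cmult (Copp (e a b)) (A k a)) (Cmult (Copp (e b a)) (A k b)).
  move=> ab; rewrite !hA; apply: (cauchy_relation' (zpt x) zn (xipt y)) => // ? ?.
  exact: xipt_zpt_neq.
have := sum_identity A d e (d0 _) (d0 _) (fun a b => halfcots_opp _ xn a b)
  (fun a b => halfcots_opp _ zn a b) (halfcots_triple _ xn) (halfcots_triple _ zn) HA HB.
move=> /=; set Sc := \csum_k Cmult (\csum_j A j k) _.
set Sec := \csum_k Cmult (\csum_b e k b) (\csum_j A j k).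
set SE := \csum_k Cmult (\csum_b e k b) (\csum_b e k b).
set See := \csum_k \csum_l Cmult (e k l) (e k l).
set Sr := \csum_a Cmult (Cplus _ _) _.
set Sdd := \csum_a \csum_b Cmult (d a b) (d a b) => key.
pose M : C := \big[Cplus/RtoC 0]_(k < N) \big[Cplus/RtoC 0]_(l < N)
  (if k == l then RtoC 0 else RtoC (/ 4)).
pose T : C := \csum_j \csum_k Cplus (A j k) (Cmult (A j k) (A j k)).
have ii : Cmult Ci Ci = Copp (RtoC 1).
  by rewrite /Cmult /Ci /Copp /RtoC /=; congr pair; ring.
have L1 : \csum_k (Cplus (Cmult (X k) (X k)) (X2 k)) =
    Cplus (Cmult (Copp (RtoC (lam * lam))) Sc) (Cmult (Copp (RtoC lam)) T).
  rewrite csum_plus /Sc -csum_scal; congr Cplus.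
    apply: eq_bigr => k _; rewrite /X logder_x -/(A _ k) RtoC_mult.
    have -> a b : Cmult (Cmult (Cmult Ci a) b) (Cmult (Cmult Ci a) b) =
      Cmult (Cmult Ci Ci) (Cmult (Cmult a a) (Cmult b b)) by ring.
    rewrite ii -[\csum_j geo (wexp 1 x y j k)]/(\csum_j A j k).
    set q := \csum_j A j k; ring.
  rewrite /T exchange_big -csum_scal; apply: eq_bigr => k _; exact: logder2_x.
have L2 : \csum_k Cmult (\csum_l e k l) (X k) = Cmult (Cmult Ci (RtoC lam)) Sec.
  rewrite /Sec -csum_scal; apply: eq_bigr => k _; rewrite /X logder_x.
  rewrite -[\csum_j geo (wexp 1 x y j k)]/(\csum_j A j k).
  set q := \csum_j A j k; set r := \csum_l e k l; ring.
have L3 (f : 'I_N -> 'I_N -> C) (z : 'I_N -> C) : f = halfcots z ->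
    \csum_k \csum_l (if k == l then RtoC 0 else
      Cminus (RtoC (/ 4)) (Cmult (f k l) (f k l))) =
    Cplus M (Cmult (Copp (RtoC 1)) (\csum_k \csum_l Cmult (f k l) (f k l))).
  move=> ->; rewrite /M -csum_scal -csum_plus; apply: eq_bigr => k _.
  rewrite -csum_scal -csum_plus; apply: eq_bigr => l _.
  case: eqVneq => [->|_]; last by ring.
  rewrite d0; ring.
(* Completing the square: geo + geo^2 = (geo + 1/2)^2 - 1/4, and geo + 1/2 is the half cotangent
   [d j k]. *)
have hU : Cmult (RtoC 2) U = Cplus Sdd (Cmult (Copp (RtoC 1)) M).
  pose g j k := Cminus (Cmult (d j k) (d j k)) (RtoC (/ 4)).
  have -> : U = \big[Cplus/RtoC 0]_(j < N) \big[Cplus/RtoC 0]_(k < N | (j < k)%N) g j k.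
    apply: eq_bigr => j _; apply: eq_bigr => k hk.
    rewrite geo_uexp; last by apply/eqP => h; rewrite h ltnn in hk.
    rewrite -/d /g; have -> : RtoC (/ 4) = Cmult (RtoC (/ 2)) (RtoC (/ 2)).
      by rewrite -RtoC_mult; congr RtoC; field.
    set h := RtoC (/ 2); set u := d j k.
    have hh : RtoC 1 = Cplus h h by rewrite -RtoC_plus; congr RtoC; field.
    have -> : Cplus (Cminus u h) (Cmult (Cminus u h) (Cminus u h)) =
      Cplus (Cminus (Cmult u (RtoC 1)) (Cmult h (RtoC 1)))
        (Cmult (Cminus u h) (Cminus u h)) by ring.
    by rewrite hh; ring.
  rewrite csum_upper; last first.
    have dop j k : d k j = Copp (d j k) by exact: halfcots_opp.
    by move=> j k; rewrite /g (dop j k); ring.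
  have := L3 d _ (erefl _) => h3.
  transitivity (Cmult (Copp (RtoC 1)) (\csum_k \csum_l (if k == l then RtoC 0 else
      Cminus (RtoC (/ 4)) (Cmult (d k l) (d k l))))); last first.
    by rewrite h3 /Sdd; ring.
  rewrite -csum_scal; apply: eq_bigr => k _; rewrite -csum_scal; apply: eq_bigr => l _.
  by rewrite /g; case: eqVneq => _; ring.
have R1 : \csum_a Cplus (Cplus (Copp (Cplus (Cmult (Y a) (Y a)) (Y2 a)))
     (Cmult (Cmult (RtoC (2 * lam)) Ci) (Cmult (RtoC (s a)) (Y a))))
     (RtoC (lam * lam * (s a * s a))) =
   Cplus (Cmult (RtoC (lam * lam)) Sr) (Cmult (Copp (RtoC 1)) (\csum_a Y2 a)).
  rewrite /Sr -!csum_scal -csum_plus; apply: eq_bigr => a _.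
  rewrite /Y logder_y -/d -/(s a) !RtoC_mult.
  set D := \csum_b d a b; set R := \csum_k A a k.
  set u := Cminus (Cplus D R) _.
  have -> : Cmult (Cmult (Copp (Cmult Ci (RtoC lam))) u) (Cmult (Copp (Cmult Ci (RtoC lam))) u) =
    Cmult (Cmult Ci Ci) (Cmult (Cmult (RtoC lam) (RtoC lam)) (Cmult u u)) by ring.
  have -> : Cmult (Cmult (Cmult (RtoC 2) (RtoC lam)) Ci)
      (Cmult (RtoC (s a)) (Cmult (Copp (Cmult Ci (RtoC lam))) u)) =
    Cmult (Copp (Cmult Ci Ci)) (Cmult (Cmult (RtoC lam) (RtoC lam))
       (Cmult (RtoC 2) (Cmult (RtoC (s a)) u))) by ring.
  by rewrite ii /u C2E; ring.
have hY2 := logder2_y lam x y; rewrite -/U -/T in hY2.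
rewrite L1 L2 (L3 e _ (erefl _)) R1 hY2 -/See -/SE.
have hS : Sr = Cplus (Cplus (Cminus Sc (Cmult (RtoC 2) Sec)) (Cminus SE See)) Sdd.
  by rewrite key; ring.
(* Eliminating [Sdd] creates 2 lam^2 U, while the sum of the [Y2 a] contributes - 2 lam U; together
   they cancel gamma U. The constants [M] and the sums [T] agree on the two sides. *)
have hSdd : Sdd = Cplus (Cmult (RtoC 2) U) M by rewrite hU; ring.
rewrite hS hSdd /gam !RtoC_mult RtoC_minus.
have -> : Cmult (Cmult (Cmult (RtoC 2) (RtoC lam)) Ci) (Cmult (Cmult Ci (RtoC lam)) Sec) =
   Cmult (Cmult Ci Ci) (Cmult (RtoC 2) (Cmult (Cmult (RtoC lam) (RtoC lam)) Sec)) by ring.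
by rewrite ii; ring.
Qed.

(** * The ground state factor *)

Lemma cderive_prod {I : Type} (r : seq.seq I) (P : pred I) (f : I -> R -> C)
    (g : I -> C) (t : R) :
  (forall i, P i -> cderive (f i) t (Cmult (g i) (f i t))) ->
  cderive (fun s => \big[Cmult/RtoC 1]_(i <- r | P i) f i s) t
    (Cmult (\big[Cplus/RtoC 0]_(i <- r | P i) g i)
       (\big[Cmult/RtoC 1]_(i <- r | P i) f i t)).
Proof.
move=> H; elim: r => [|i r IH].
  rewrite !big_nil Cmult_0_l.
  by apply: (@is_derive_ext R_AbsRing C_R_NormedModule (fun _ => RtoC 1)) => [s|];
    [rewrite big_nil | exact: cderive_const].
rewrite !big_cons; case hP: (P i); last first.
  by apply: is_derive_ext IH => s; rewrite big_cons hP.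
apply: (is_derive_ext (fun s => Cmult (f i s) (\big[Cmult/RtoC 1]_(i <- r | P i) f i s))).
  by move=> s; rewrite big_cons hP.
apply: (cderive_eq (cderive_mult (H i hP) IH)); ring.
Qed.

Definition half_cot (r : R) : R := / 2 * (cos (r / 2) / sin (r / 2)).

Lemma sin_half_neq0 (r : R) : (forall m : Z, r <> 2 * PI * IZR m) -> sin (r / 2) <> 0.
Proof. by move=> h /sin_eq_0_0 [m hm]; apply: (h m); lra. Qed.

Lemma sin_half_neq0_inv (r : R) : sin (r / 2) <> 0 -> forall m : Z, r <> 2 * PI * IZR m.
Proof. by move=> h m hm; apply: h; apply: sin_eq_0_1; exists m; lra. Qed.

Lemma is_derive_Rpower_sin (lam r : R) : sin (r / 2) <> 0 ->
  is_derive (fun s => Rpower (Rabs (sin (s / 2))) lam) r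
    (lam * half_cot r * Rpower (Rabs (sin (r / 2))) lam).
Proof.
move=> h.
have hp : 0 < Rabs (sin (r / 2)) by exact: Rabs_pos_lt.
rewrite /Rpower /half_cot; auto_derive => //.
(* The derivative of the absolute value brings a second sign factor, and the two multiply to 1, so
   the formula is the same on both sides of a zero of the sine. *)
have -> : / Rabs (sin (r * / 2)) = sign (sin (r * / 2)) / sin (r * / 2).
  rewrite -/(Rdiv r 2); have [hlt|[h0|hgt]] := Rtotal_order (sin (r / 2)) 0.
  - by rewrite Rabs_left // sign_eq_m1 //; field.
  - by [].
  - by rewrite Rabs_pos_eq ?sign_eq_1 //; [field | lra].
rewrite -/(Rdiv r 2).
have hs : sign (sin (r / 2)) * sign (sin (r / 2)) = 1.
  have [hlt|[h0|hgt]] := Rtotal_order (sin (r / 2)) 0.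
  - by rewrite sign_eq_m1 //; ring.
  - by [].
  - by rewrite sign_eq_1 //; ring.
set e := exp _; set sg := sign _ in hs *.
transitivity (sg * sg * (lam * (/ 2 * (cos (r / 2) / sin (r / 2))) * e)).
  by field.
by rewrite hs; ring.
Qed.

(** Near [r] the phase is a constant factor, so every branch has the same logarithmic derivative. *)
Lemma cderive_branch (lam : R) (sigma : R -> C) (r : R) : is_phase sigma ->
  sin (r / 2) <> 0 ->
  cderive (fun s => Cmult (RtoC (Rpower (Rabs (sin (s / 2))) lam)) (sigma s)) r
    (Cmult (RtoC (lam * half_cot r))
       (Cmult (RtoC (Rpower (Rabs (sin (r / 2))) lam)) (sigma r))).
Proof.
move=> hs h; have [_ hl] := hs r (sin_half_neq0_inv r h).
apply: (is_derive_ext_loc (fun s => Cmult (RtoC (Rpower (Rabs (sin (s / 2))) lam)) (sigma r))).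
  by apply: filter_imp hl => s ->.
have d := cderive_pair (is_derive_Rpower_sin lam r h) (is_derive_const 0 r).
apply: (cderive_eq (cderive_mult d (cderive_const (sigma r) r))).
rewrite /zero /=; set u := Rpower _ _; set c := lam * _.
have -> : ((c * u, 0) : C) = Cmult (RtoC c) (RtoC u) by rewrite -RtoC_mult.
ring.
Qed.

Lemma locally_forall_ord (t : R) (N : nat) (P : 'I_N -> R -> Prop) :
  (forall j, locally t (P j)) -> locally t (fun s => forall j, P j s).
Proof.
elim: N P => [|N IH] P H; first by apply: filter_forall => s; case.
apply: filter_imp (filter_and _ _ (H ord0) (IH _ (fun j => H (lift ord0 j)))) => s [h0 h1] j.
by case: (unliftP ord0 j) => [i ->|->].
Qed.

(** Psi_0 is a product over pairs j < l, but only the pairs containing k depend on x_k; their other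
    members run once through all indices different from k. *)
Lemma sum_incident {N : nat} (u : 'I_N -> R) (k : 'I_N) :
  \big[Rplus/0]_(j < N) \big[Rplus/0]_(l < N | (j < l)%N)
    ((if j == k then u l else 0) + (if l == k then u j else 0)) =
  \big[Rplus/0]_(b < N) (if k == b then 0 else u b).
Proof.
have -> : \big[Rplus/0]_(j < N) \big[Rplus/0]_(l < N | (j < l)%N)
    ((if j == k then u l else 0) + (if l == k then u j else 0)) =
    \big[Rplus/0]_(j < N) \big[Rplus/0]_(l < N | (j < l)%N) (if j == k then u l else 0) +
    \big[Rplus/0]_(j < N) \big[Rplus/0]_(l < N | (j < l)%N) (if l == k then u j else 0).
  by rewrite -big_split; apply: eq_bigr => j _; exact: big_split.
rewrite (bigD1 k) //= [X in _ + X + _]big1; last first.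
  by move=> j /negbTE jk; rewrite big1 // => l _; rewrite jk.
rewrite Rplus_0_r eqxx big_mkcond /=.
rewrite [X in _ + X = _](eq_bigr (fun j : 'I_N => if (j < k)%N then u j else 0)); last first.
  move=> j _; rewrite big_mkcond (bigD1 k) //= eqxx big1 ?Rplus_0_r //.
  by move=> l /negbTE ->; case: ifP.
rewrite -big_split; apply: eq_bigr => b _ /=.
by rewrite -val_eqE /=; case: ltngtP => _; ring.
Qed.

Section GroundState.

Context {N : nat} (lam : R) (sigma : R -> C) (hsigma : is_phase sigma).

Definition upd (x : 'I_N -> R) (k : 'I_N) (t : R) : 'I_N -> R := [eta x with k |-> t].

Lemma upd_id (x : 'I_N -> R) (k : 'I_N) : upd x k (x k) = x.
Proof.
by apply: functional_extensionality => l; rewrite /upd /=; case: eqP => [->|].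
Qed.

Lemma updE (x : 'I_N -> R) (k : 'I_N) (s : R) :
  upd x k (x k + s) = fun l => x l + s * indic k l.
Proof.
apply: functional_extensionality => l; rewrite /upd /= /indic.
by case: eqP => [->|_]; ring.
Qed.

Lemma is_derive_upd (x : 'I_N -> R) (k l : 'I_N) :
  is_derive (fun t => upd x k t l) (x k) (indic k l).
Proof.
rewrite /upd /= /indic; case: eqP => _; [exact: is_derive_id | exact: is_derive_const].
Qed.

(** Multiplied by [lam], this is the logarithmic derivative of Psi_0 in x_k. *)
Definition logpsi (x : 'I_N -> R) (k : 'I_N) : R :=
  \big[Rplus/0]_(b < N) (if k == b then 0 else half_cot (x k - x b)).

Lemma half_cot_opp (r : R) : half_cot (- r) = - half_cot r.
Proof.
rewrite /half_cot; have -> : - r / 2 = - (r / 2) by field.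
by rewrite cos_neg sin_neg /Rdiv Rinv_opp; ring.
Qed.

Lemma distinct_sin (x : 'I_N -> R) (j k : 'I_N) : distinct_mod_2pi x -> j != k ->
  sin ((x j - x k) / 2) <> 0.
Proof. by move=> hx jk; apply: sin_half_neq0; apply: hx; exact/eqP. Qed.

Lemma cderive_Psi0 (x : 'I_N -> R) (k : 'I_N) : distinct_mod_2pi x ->
  cderive (fun t => Psi0 lam sigma (upd x k t)) (x k)
    (Cmult (RtoC (lam * logpsi x k)) (Psi0 lam sigma x)).
Proof.
move=> hx.
pose g (j l : 'I_N) := RtoC (lam * half_cot (x l - x j) * (indic k l - indic k j)).
have hf (j l : 'I_N) : (j < l)%N ->
   cderive (fun t => Cmult (RtoC (Rpower (Rabs (sin ((upd x k t l - upd x k t j) / 2))) lam))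
                        (sigma (upd x k t l - upd x k t j))) (x k)
    (Cmult (g j l) (Cmult (RtoC (Rpower (Rabs (sin ((upd x k (x k) l - upd x k (x k) j) / 2))) lam))
                        (sigma (upd x k (x k) l - upd x k (x k) j)))).
  move=> hjl; rewrite upd_id.
  have jl : l != j by apply/eqP => h; rewrite h ltnn in hjl.
  have dr := is_derive_minus _ _ _ _ _ (is_derive_upd x k l) (is_derive_upd x k j).
  have db := cderive_branch lam sigma (x l - x j) hsigma (distinct_sin x l j hx jl).
  have e : x l - x j = minus (upd x k (x k) l) (upd x k (x k) j) by rewrite upd_id.
  rewrite {1}e in db.
  have dc := @is_derive_comp R_AbsRing C_R_NormedModule
    (fun s => Cmult (RtoC (Rpower (Rabs (sin (s / 2))) lam)) (sigma s))
    (fun t => upd x k t l - upd x k t j) (x k) _ _ db dr.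
  apply: (cderive_eq dc).
  set z := Cmult (RtoC (Rpower _ _)) _; rewrite /g.
  rewrite /scal /= /prod_scal /scal /= /mult /minus /plus /opp /= /Cmult /=.
  by congr pair; ring.
have hp (j : 'I_N) := cderive_prod (index_enum 'I_N) (fun l => (j < l)%N) _ _ _ (hf j).
have hpp := cderive_prod (index_enum 'I_N) xpredT _ _ _ (fun j _ => hp j).
apply: (cderive_eq hpp); rewrite upd_id -/(Psi0 lam sigma x); congr Cmult.
have -> : RtoC (lam * logpsi x k) = \big[Cplus/RtoC 0]_(j < N)
   \big[Cplus/RtoC 0]_(l < N | (j < l)%N) g j l; last by [].
have hs : lam * logpsi x k =
    \big[Rplus/0]_(b < N) (if k == b then 0 else lam * half_cot (x k - x b)).
  rewrite /logpsi (big_morph (Rmult lam) (Rmult_plus_distr_l lam) (Rmult_0_r lam)).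
  by apply: eq_bigr => b _; case: ifP => _; ring.
rewrite hs -sum_incident RtoC_sum; apply: eq_bigr => j _.
rewrite RtoC_sum; apply: eq_bigr => l hjl; congr RtoC.
have jl : j != l by apply/eqP => h; rewrite h ltnn in hjl.
rewrite /indic; case: (eqVneq j k) => [<-|jk].
  rewrite eq_sym (negbTE jl); have -> : x l - x j = - (x j - x l) by ring.
  by rewrite half_cot_opp; ring.
by case: eqP => [->|_]; ring.
Qed.

Lemma is_derive_half_cot (r : R) : sin (r / 2) <> 0 ->
  is_derive half_cot r (- V r).
Proof.
move=> h; rewrite /half_cot /V; auto_derive => //.
rewrite -/(Rdiv r 2); have h2 := sin2_cos2 (r / 2); rewrite /Rsqr in h2.
set c := cos _ in h2 *; set s := sin _ in h h2 *.
transitivity (- (/ 4 * (s * s + c * c)) / (s * s)); first by field.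
by rewrite h2; field.
Qed.

Lemma is_derive_sum {I : Type} (r : seq.seq I) (P : pred I) (f : I -> R -> R)
    (g : I -> R) (t : R) :
  (forall i, P i -> is_derive (f i) t (g i)) ->
  is_derive (fun s => \big[Rplus/0]_(i <- r | P i) f i s) t
    (\big[Rplus/0]_(i <- r | P i) g i).
Proof.
move=> H; elim: r => [|i r IH].
  rewrite big_nil; apply: (is_derive_ext (fun _ => 0)) => [s|]; first by rewrite big_nil.
  exact: is_derive_const.
rewrite big_cons; case hP: (P i); last first.
  by apply: is_derive_ext IH => s; rewrite big_cons hP.
apply: (is_derive_ext (fun s => f i s + \big[Rplus/0]_(i <- r | P i) f i s)).
  by move=> s; rewrite big_cons hP.
exact: is_derive_plus (H i hP) IH.
Qed.

Lemma is_derive_logpsi (x : 'I_N -> R) (k : 'I_N) : distinct_mod_2pi x ->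
  is_derive (fun t => logpsi (upd x k t) k) (x k)
    (- \big[Rplus/0]_(b < N) (if k == b then 0 else V (x k - x b))).
Proof.
move=> hx; rewrite (big_morph Ropp Ropp_plus_distr Ropp_0).
apply: is_derive_sum => b _; case: (eqVneq k b) => [_|kb].
  by rewrite Ropp_0; exact: is_derive_const.
have dr := is_derive_minus _ _ _ _ _ (is_derive_upd x k k) (is_derive_upd x k b).
have dh := is_derive_half_cot (x k - x b) (distinct_sin x k b hx kb).
have e : x k - x b = minus (upd x k (x k) k) (upd x k (x k) b) by rewrite upd_id.
rewrite {1}e in dh.
have := @is_derive_comp R_AbsRing R_NormedModule half_cot
  (fun t => upd x k t k - upd x k t b) (x k) _ _ dh dr.
rewrite /indic eqxx [b == k]eq_sym (negbTE kb) /scal /= /mult /minus /plus /opp /=.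
by rewrite Ropp_0 Rplus_0_r Rmult_1_l.
Qed.

(** A second partial derivative requires the formula for the first on a whole neighbourhood. Only
    pairs containing k change, and each is controlled by a sine that does not vanish at x_k. *)
Lemma locally_distinct (x : 'I_N -> R) (k : 'I_N) : distinct_mod_2pi x ->
  locally (x k) (fun t => distinct_mod_2pi (upd x k t)).
Proof.
move=> hx.
have H (j : 'I_N) : locally (x k) (fun t => k <> j -> sin ((t - x j) / 2) <> 0).
  case: (eqVneq k j) => [<-|kj]; first by apply: filter_forall => t; case.
  have hc : continuous (fun t => sin ((t - x j) / 2)) (x k).
    by apply: (@ex_derive_continuous R_AbsRing R_NormedModule); auto_derive.
  have := hc (fun u => u <> 0) (open_neq 0 _ (distinct_sin x k j hx kj)).
  by rewrite /filtermap; apply: filter_imp => t ht _.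
apply: filter_imp (locally_forall_ord _ _ _ H) => t Ht i j ij m.
rewrite /upd /=; case: eqP => [ik|ik]; case: eqP => [jk|jk].
- by rewrite ik jk in ij.
- apply: sin_half_neq0_inv; apply: Ht; exact: not_eq_sym.
- move=> h; apply: (sin_half_neq0_inv _ (Ht i (not_eq_sym ik)) (- m)%Z).
  by rewrite opp_IZR; lra.
- exact: hx.
Qed.

End GroundState.

Lemma halfcots_zpt {N : nat} (x : 'I_N -> R) (k b : 'I_N) : distinct_mod_2pi x -> k != b ->
  halfcots (zpt x) k b = Cmult Ci (RtoC (half_cot (x k - x b))).
Proof.
move=> hx kb; have hs := distinct_sin x k b hx kb.
have hz := Cminus_neq0 _ _ (not_eq_sym (zpt_neq x k b hx kb)).
rewrite /halfcots (negbTE kb) /halfcot.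
suff -> : Cplus (zpt x b) (zpt x k) = Cmult (Cmult Ci (RtoC (half_cot (x k - x b))))
    (Cmult (RtoC 2) (Cminus (zpt x b) (zpt x k))).
  by have h2 := C2_neq0; field.
(* In terms of the mean m and the half difference h, the sum of the two points is 2 cos h exp (i m)
   and their difference is a multiple of sin h. *)
set h := (x k - x b) / 2 in hs; pose m := (x k + x b) / 2.
have -> : zpt x k = (cos (m + h), sin (m + h)).
  have -> : m + h = x k by rewrite /m /h; field.
  by rewrite /zpt /Cexp /= exp_0 !Rmult_1_l.
have -> : zpt x b = (cos (m - h), sin (m - h)).
  have -> : m - h = x b by rewrite /m /h; field.
  by rewrite /zpt /Cexp /= exp_0 !Rmult_1_l.
rewrite /half_cot -/h cos_plus sin_plus cos_minus sin_minus.
rewrite /Cmult /Cplus /Cminus /Copp /Ci /RtoC /=; congr pair; by field.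
Qed.

Lemma sum_halfcots_zpt {N : nat} (x : 'I_N -> R) (k : 'I_N) : distinct_mod_2pi x ->
  \csum_l halfcots (zpt x) k l = Cmult Ci (RtoC (logpsi x k)).
Proof.
move=> hx; rewrite /logpsi RtoC_sum -csum_scal; apply: eq_bigr => l _.
case: (eqVneq k l) => [<-|kl]; last exact: halfcots_zpt.
by rewrite /halfcots eqxx Cmult_0_r.
Qed.

Lemma V_halfcots {N : nat} (x : 'I_N -> R) (k l : 'I_N) : distinct_mod_2pi x -> k != l ->
  Cminus (RtoC (/ 4)) (Cmult (halfcots (zpt x) k l) (halfcots (zpt x) k l)) =
  RtoC (V (x k - x l)).
Proof.
move=> hx kl; rewrite halfcots_zpt // /half_cot /V.
have hs := distinct_sin x k l hx kl.
have h2 := sin2_cos2 ((x k - x l) / 2); rewrite /Rsqr in h2.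
set c := cos _ in h2 *; set s := sin _ in hs h2 *.
rewrite /Cmult /Cminus /Cplus /Copp /Ci /RtoC /=; congr pair; last by ring.
transitivity (/ 4 * (s * s + c * c) / (s * s)); first by field.
by rewrite h2; field.
Qed.

(** * Derivatives of the regularized integral in x *)

Section XDerivatives.

Context {N : nat} (lam : R) (n : 'I_N -> Z).

Notation xdot x k := (logder lam 1 x (udir 0 (fun _ => 0)) (xdir k)).
Notation xdot2 x k := (logder2 lam 1 x (udir 0 (fun _ => 0)) (xdir k)).
Notation weight := (Cexp (RtoC (weight_sum n))).

Definition mom1 (x : 'I_N -> R) (k : 'I_N) : C :=
  Lint n (fun y => Cmult (xdot x k y) (kernel lam 1 x y)).

Definition mom2 (x : 'I_N -> R) (k : 'I_N) : C :=
  Lint n (fun y => Cmult (Cplus (Cmult (xdot x k y) (xdot x k y)) (xdot2 x k y))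
                     (kernel lam 1 x y)).

Lemma iterated_mom1 (x : 'I_N -> R) (k : 'I_N) :
  is_iterated_integral n (fun y => Cmult (xdot x k y) (kernel lam 1 x y)) (mom1 x k).
Proof.
apply: iterated_Lint; apply: nice_lipschitz.
by apply: nice_mult; [apply: nice_logder; lra | apply: nice_kernel; lra].
Qed.

Lemma iterated_mom2 (x : 'I_N -> R) (k : 'I_N) :
  is_iterated_integral n (fun y =>
    Cmult (Cplus (Cmult (xdot x k y) (xdot x k y)) (xdot2 x k y)) (kernel lam 1 x y))
  (mom2 x k).
Proof.
apply: iterated_Lint; apply: nice_lipschitz.
have h := nice_logder lam 1 x (udir 0 (fun _ => 0)) (xdir k) Rlt_0_1.
apply: nice_mult; last by apply: nice_kernel; lra.
by apply: nice_plus; [exact: nice_mult | apply: nice_logder2; lra].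
Qed.

Lemma iterated_kernel1 (x : 'I_N -> R) :
  is_iterated_integral n (kernel lam 1 x) (Lint n (kernel lam 1 x)).
Proof. by apply: iterated_Lint; apply: nice_lipschitz; apply: nice_kernel; lra. Qed.

Lemma unif_deriv_kernel_x (x : 'I_N -> R) (k : 'I_N) :
  unif_deriv (fun s y => kernel lam 1 (upd x k (x k + s)) y)
    (fun y => Cmult (xdot x k y) (kernel lam 1 x y)).
Proof.
apply: (unif_deriv_eq (unif_deriv_kernel lam 1 0 x (indic k) (fun _ => 0) Rlt_0_1)) => // s y.
by rewrite zero_flow Rmult_0_r Rplus_0_r updE.
Qed.

Lemma unif_deriv_xdot (x : 'I_N -> R) (k : 'I_N) :
  unif_deriv (fun s y => xdot (upd x k (x k + s)) k y) (xdot2 x k).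
Proof.
apply: (unif_deriv_eq (unif_deriv_logder lam 1 0 x (indic k) (fun _ => 0) Rlt_0_1)) => // s y.
by rewrite zero_flow Rmult_0_r Rplus_0_r updE.
Qed.

Lemma cderive_calP1 (x : 'I_N -> R) (k : 'I_N) :
  cderive (fun t => calP1 lam n (upd x k t)) (x k) (Cmult weight (mom1 x k)).
Proof.
apply: cderive_scal.
apply: (cderive_iterated (n := n) (f := fun t => kernel lam 1 (upd x k t)) Rlt_0_1
  (unif_deriv_kernel_x x k)) => [s _|]; [exact: iterated_kernel1 | exact: iterated_mom1].
Qed.

Lemma cderive_mom1 (x : 'I_N -> R) (k : 'I_N) :
  cderive (fun t => mom1 (upd x k t) k) (x k) (mom2 x k).
Proof.
apply: (cderive_iterated (n := n)
  (f := fun t y => Cmult (xdot (upd x k t) k y) (kernel lam 1 (upd x k t) y)) Rlt_0_1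
  (unif_deriv_mult (unif_deriv_xdot x k) (unif_deriv_kernel_x x k))) => [s _|].
  exact: iterated_mom1.
rewrite Rplus_0_r upd_id; apply: (iterated_ext (iterated_mom2 x k)) => y; ring.
Qed.

End XDerivatives.

(** * The series of shifted integrals *)

(** The finite sum of nu u^nu with its exact remainder. The sequence [w] stands for the powers of
    [u]; only its recursion is used, since these appear as exponentials of multiples. *)
Lemma Cexp_pow_sum (w : nat -> C) (u : C) (M : nat) :
  w 0%N = RtoC 1 -> (forall m, w m.+1 = Cmult u (w m)) -> Cminus (RtoC 1) u <> RtoC 0 ->
  let g := Cdiv u (Cminus (RtoC 1) u) in
  sum_n (G := C_R_NormedModule) (fun m => Cmult (RtoC (INR m.+1)) (w m.+1)) M =
  Cplus (Cplus g (Cmult g g))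
    (Cmult (w M.+1) (Cmult (Cminus (Cmult (RtoC (INR M.+1)) u) (RtoC (INR M.+2)))
       (Cmult g (Cplus (RtoC 1) g)))).
Proof.
move=> w0 wS h g; elim: M => [|M IH].
  rewrite sum_O wS w0 /g -[INR 1]/1 -[INR 2]/2 C2E.
  by lazymatch goal with |- ?a = ?b => change (@eq C a b) end; field.
rewrite sum_Sn IH; change (@plus C_R_NormedModule) with Cplus.
rewrite (wS M.+1) (wS M) [INR M.+3]S_INR [INR M.+2]S_INR.
rewrite !RtoC_plus; set r := RtoC (INR M.+1); rewrite /g; set v := w M.
by lazymatch goal with |- ?a = ?b => change (@eq C a b) end; field.
Qed.

(** Squaring exp (- h) <= 1 / (1 + h) at h = (M + 1) / 2 gives quadratic decay, enough against the
    linear factor 2 M + 3 = (M + 1) + (M + 2) of the remainder. *)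
Lemma exp_lin_small (M : nat) : (2 * INR M + 3) * exp (- (INR M + 1)) <= 12 / (INR M + 1).
Proof.
have hM := pos_INR M.
set h := (INR M + 1) / 2.
have h1 : 1 + h <= exp h by exact: exp_ineq1_le.
have -> : - (INR M + 1) = - h + - h by rewrite /h; field.
rewrite exp_plus exp_Ropp.
have hp : 0 < 1 + h by rewrite /h; lra.
have h2 : / exp h <= / (1 + h) by apply: Rinv_le_contravar.
have h3 : 0 < / exp h by apply: Rinv_0_lt_compat; exact: exp_pos.
have h4 : / exp h * / exp h <= / (1 + h) * / (1 + h) by nra.
apply: Rle_trans (_ : (2 * INR M + 3) * (/ (1 + h) * / (1 + h)) <= _).
  by apply: Rmult_le_compat_l => //; lra.
have -> : / (1 + h) * / (1 + h) = 4 / ((INR M + 3) * (INR M + 3)).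
  by rewrite /h; field; lra.
have q : 0 < INR M + 3 by lra.
have -> : (2 * INR M + 3) * (4 / ((INR M + 3) * (INR M + 3))) =
   (4 * (2 * INR M + 3)) / ((INR M + 3) * (INR M + 3)) by field; lra.
apply/Rle_div_l; first by nra.
have -> : 12 / (INR M + 1) * ((INR M + 3) * (INR M + 3)) =
  12 * (INR M + 3) * (INR M + 3) / (INR M + 1) by field; lra.
have q1 : INR M + 1 > 0 by lra.
apply/(Rle_div_r _ _ _ q1); set m := INR M in hM *; nra.
Qed.

Lemma Cmod_Cexp_scal (m : nat) (u : C) : Re u <= -1 ->
  Cmod (Cexp (Cmult (RtoC (INR m)) u)) <= exp (- INR m).
Proof.
move=> hu; rewrite Cmod_Cexp.
have -> : Re (Cmult (RtoC (INR m)) u) = INR m * Re u by rewrite /Re /=; ring.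
have h := pos_INR m.
have [hlt|->] : INR m * Re u < - INR m \/ INR m * Re u = - INR m.
  by have : INR m * Re u <= - INR m by nra; case; auto.
  by left; exact: exp_increasing.
exact: Rle_refl.
Qed.

Section ShiftSeries.

Context {N : nat} (lam : R) (n : 'I_N -> Z) (j k : 'I_N) (hjk : (j < k)%N).

Lemma weight_sum_shiftE (nu : nat) :
  weight_sum (shiftE n nu j k) = weight_sum n + INR nu * (INR j - INR k).
Proof.
rewrite /weight_sum /shiftE INR_IZR_INZ.
have -> : IZR (Z.of_nat nu) * (INR j - INR k) = \big[Rplus/0]_(a < N)
    ((if a == j then IZR (Z.of_nat nu) * (INR a + 1) else 0) +
     (if a == k then - (IZR (Z.of_nat nu) * (INR a + 1)) else 0)).
  rewrite big_split /= (bigD1 j) //= eqxx big1; last by move=> i /negbTE ->.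
  rewrite (bigD1 k) //= eqxx big1; last by move=> i /negbTE ->.
  ring.
rewrite -big_split; apply: eq_bigr => a _; rewrite S_INR /=.
rewrite plus_IZR mult_IZR minus_IZR [a == j]eq_sym [a == k]eq_sym.
by case: (j == a); case: (k == a); ring.
Qed.

(** At eps = 1 the modulus of the multiplier is exp (nu (j - k)), exactly the change of exp
    (weight_sum) under the shift. The factor on the right is thus absorbed when passing to
    [calP1]. *)
Lemma iterated_shiftE (x : 'I_N -> R) (nu : nat) :
  is_iterated_integral n
    (fun y => Cmult (Cexp (Cmult (RtoC (INR nu)) (uexp 1 y j k))) (kernel lam 1 x y))
    (Cmult (Cexp (RtoC (INR nu * (INR j - INR k))))
       (Lint (shiftE n nu j k) (kernel lam 1 x))).
Proof.
have h := iterated_scal _ _ (Cexp (RtoC (INR nu * (INR j - INR k)))) _ _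
  (iterated_modulate _ n (fun l => Z.of_nat nu *
     ((if j == l then 1 else 0) - (if k == l then 1 else 0)))%Z _ _
     (iterated_kernel1 lam (shiftE n nu j k) x)).
apply: (iterated_ext h) => y; rewrite Cmult_assoc -Cexp_add; congr Cmult; congr Cexp.
have -> : \big[Rplus/0]_(l < N) (IZR (Z.of_nat nu *
     ((if j == l then 1 else 0) - (if k == l then 1 else 0)))%Z * y l) = INR nu * (y j - y k).
  transitivity (\big[Rplus/0]_(l < N) ((if l == j then INR nu * y l else 0) +
     (if l == k then - (INR nu * y l) else 0))).
    apply: eq_bigr => l _; rewrite mult_IZR minus_IZR -INR_IZR_INZ [l == j]eq_sym [l == k]eq_sym.
    by case: (j == l); case: (k == l); ring.
  rewrite big_split /= (bigD1 j) //= eqxx big1; last by move=> i /negbTE ->.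
  rewrite (bigD1 k) //= eqxx big1; last by move=> i /negbTE ->.
  ring.
by rewrite /uexp /Cplus /Cmult /RtoC /=; congr pair; ring.
Qed.

Definition mom_u (x : 'I_N -> R) : C :=
  Lint n (fun y => Cmult (Cplus (geo (uexp 1 y j k))
    (Cmult (geo (uexp 1 y j k)) (geo (uexp 1 y j k)))) (kernel lam 1 x y)).

Lemma iterated_mom_u (x : 'I_N -> R) :
  is_iterated_integral n (fun y => Cmult (Cplus (geo (uexp 1 y j k))
    (Cmult (geo (uexp 1 y j k)) (geo (uexp 1 y j k)))) (kernel lam 1 x y)) (mom_u x).
Proof.
apply: iterated_Lint; apply: nice_lipschitz.
have h := nice_geo_uexp 1 j k Rlt_0_1 hjk.
apply: nice_mult; last by apply: nice_kernel; lra.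
exact: nice_plus h (nice_mult h h).
Qed.

(** Each partial sum is the integral, for the unshifted [n], of the kernel times a partial sum of nu
    u^nu. The exact remainder is O(1 / (M + 1)) uniformly in [y], so no termwise limit theorem is
    required. *)
Lemma is_series_calP1 (x : 'I_N -> R) :
  is_series (K := R_AbsRing) (V := C_R_NormedModule)
    (fun m => Cmult (RtoC (INR m.+1)) (calP1 lam (shiftE n m.+1 j k) x))
    (Cmult (Cexp (RtoC (weight_sum n))) (mom_u x)).
Proof.
set c := Cexp _.
have hs M : is_iterated_integral n
    (fun y => Cmult c (Cmult (sum_n (G := C_R_NormedModule) (fun m => Cmult (RtoC (INR m.+1))
        (Cexp (Cmult (RtoC (INR m.+1)) (uexp 1 y j k)))) M) (kernel lam 1 x y)))
    (sum_n (G := C_R_NormedModule)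
      (fun m => Cmult (RtoC (INR m.+1)) (calP1 lam (shiftE n m.+1 j k) x)) M).
  have h1 m := iterated_scal _ _ (Cmult c (RtoC (INR m.+1))) _ _ (iterated_shiftE x m.+1).
  have e m : Cmult (RtoC (INR m.+1)) (calP1 lam (shiftE n m.+1 j k) x) =
      Cmult (Cmult c (RtoC (INR m.+1))) (Cmult (Cexp (RtoC (INR m.+1 * (INR j - INR k))))
       (Lint (shiftE n m.+1 j k) (kernel lam 1 x))).
    rewrite /calP1 weight_sum_shiftE RtoC_plus Cexp_add -/c; ring.
  elim: M => [|M IH].
    rewrite sum_O e; apply: (iterated_ext (h1 0%N)) => y; rewrite sum_O; ring.
  rewrite sum_Sn e; apply: (iterated_ext (iterated_plus _ _ _ _ _ _ IH (h1 M.+1))) => y.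
  rewrite sum_Sn; change (@plus C_R_NormedModule) with Cplus; ring.
have [|D [D0 hD]] := psi_geo_bound 0 1; first lra.
have [[B hB] _ _] := nice_kernel lam 1 x Rlt_0_1.
have hre y : Re (uexp 1 y j k) <= - (1) := uexp_neg j k 1 hjk Rlt_0_1.
have herr M : Cmod (Cminus (sum_n (G := C_R_NormedModule)
      (fun m => Cmult (RtoC (INR m.+1)) (calP1 lam (shiftE n m.+1 j k) x)) M)
      (Cmult c (mom_u x))) <= Cmod c * (12 * (D * (1 + D)) * Rabs B) / (INR M + 1).
  have hi := iterated_plus _ _ _ _ _ _ (hs M)
    (iterated_scal _ _ (Copp c) _ _ (iterated_mom_u x)).
  have -> : Cminus (sum_n (G := C_R_NormedModule)
      (fun m => Cmult (RtoC (INR m.+1)) (calP1 lam (shiftE n m.+1 j k) x)) M)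
      (Cmult c (mom_u x)) = Cplus (sum_n (G := C_R_NormedModule)
      (fun m => Cmult (RtoC (INR m.+1)) (calP1 lam (shiftE n m.+1 j k) x)) M)
      (Cmult (Copp c) (mom_u x)) by ring.
  apply: (iterated_bound _ _ _ _ _ hi) => y.
  set u := uexp 1 y j k.
  have hu : Re u <= -1 by have := hre y; rewrite -/u; lra.
  have hn : Cminus (RtoC 1) (Cexp u) <> RtoC 0 by apply: one_minus_Cexp_neq0; lra.
  rewrite (Cexp_pow_sum (fun m => Cexp (Cmult (RtoC (INR m)) u)) (Cexp u) M) //; last first.
  - by move=> m; rewrite -Cexp_add S_INR RtoC_plus; congr Cexp; ring.
  - by rewrite /= Cmult_0_l Cexp_0.
  rewrite -/(geo u); set q := Cexp (Cmult _ _); set r := Cmult (Cminus _ _) _.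
  have -> : Cplus (Cmult c (Cmult (Cplus (Cplus (geo u) (Cmult (geo u) (geo u))) (Cmult q r))
       (kernel lam 1 x y))) (Cmult (Copp c) (Cmult (Cplus (geo u) (Cmult (geo u) (geo u)))
       (kernel lam 1 x y))) = Cmult c (Cmult (Cmult q r) (kernel lam 1 x y)) by ring.
  have hg : Cmod (geo u) <= D by have [_] := hD u (hre y).
  have hq : Cmod q <= exp (- (INR M + 1)) by rewrite -S_INR; exact: Cmod_Cexp_scal.
  have hw : Cmod (Cexp u) <= 1.
    by rewrite Cmod_Cexp -exp_0; left; apply: exp_increasing; lra.
  have hM := pos_INR M.
  have hr : Cmod r <= (2 * INR M + 3) * (D * (1 + D)).
    apply: Cmod_mult_le.
      apply: Rle_trans (Cmod_triangle_sub _ _) _; rewrite Cmod_mult !Cmod_R.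
      rewrite !Rabs_pos_eq; try exact: pos_INR.
      by rewrite !S_INR; nra.
    apply: Cmod_mult_le => //; apply: Rle_trans (Cmod_triangle _ _) _.
    by rewrite Cmod_1; lra.
  have hqr : Cmod (Cmult q r) <= 12 / (INR M + 1) * (D * (1 + D)).
    apply: Rle_trans (Cmod_mult_le _ _ _ _ hq hr) _.
    rewrite -Rmult_assoc; apply: Rmult_le_compat_r; first nra.
    by rewrite Rmult_comm; exact: exp_lin_small.
  have := Cmod_mult_le _ _ _ _ (Rle_refl (Cmod c))
    (Cmod_mult_le _ _ _ _ hqr (Rle_trans _ _ _ (hB y) (Rle_abs B))).
  by move=> h; apply: Rle_trans h _; right; field; lra.
apply/filterlim_locally_ball_norm => eps.
set K0 := Cmod c * _ in herr.
have [M0 hM0] := INR_unbounded (Rabs K0 / eps).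
have he := cond_pos eps.
exists M0 => M /le_INR hM; rewrite /ball_norm norm_C.
apply: Rle_lt_trans (herr M) _.
have h1 : 0 < INR M + 1 by have := pos_INR M; lra.
apply/Rlt_div_l => //.
have h2 : Rabs K0 < INR M0 * eps by apply/Rlt_div_l; [|lra].
have := Rle_abs K0; nra.
Qed.

End ShiftSeries.

(** * Uniqueness of derivatives and sums, and assembly of the eigenvalue-type equation *)

Lemma cderive_unique {f : R -> C} {t : R} {l l' : C} :
  cderive f t l -> cderive f t l' -> l = l'.
Proof.
move=> h h'; rewrite [l]surjective_pairing [l']surjective_pairing.
rewrite -(is_derive_unique _ _ _ (cderive_fst h)) -(is_derive_unique _ _ _ (cderive_snd h)).
by rewrite (is_derive_unique _ _ _ (cderive_fst h')) (is_derive_unique _ _ _ (cderive_snd h')).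
Qed.

Lemma partial_unique {N : nat} {k : 'I_N} {f : ('I_N -> R) -> C} {x : 'I_N -> R} {l : C} :
  is_partial k f x l -> partial k f x = l.
Proof.
move=> h; apply: (iota_unique (V := C_R_CompleteNormedModule)) => // l' h'.
exact: cderive_unique h' h.
Qed.

Lemma is_series_Cmult (c : C) (a : nat -> C) (l : C) :
  is_series (K := R_AbsRing) (V := C_R_NormedModule) a l ->
  is_series (K := R_AbsRing) (V := C_R_NormedModule) (fun m => Cmult c (a m)) (Cmult c l).
Proof.
move=> h; apply/filterlim_locally_ball_norm => eps.
have hc := Cmod_ge_0 c.
have he : 0 < eps / (Cmod c + 1) by apply: Rdiv_lt_0_compat; [exact: cond_pos | lra].
have [M HM] := proj1 (filterlim_locally_ball_norm _ _) h (mkposreal _ he).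
exists M => m /HM; rewrite /ball_norm !norm_C /= => hb.
have -> : sum_n (G := C_R_NormedModule) (fun m => Cmult c (a m)) m =
    Cmult c (sum_n (G := C_R_NormedModule) a m).
  elim: m {hb} => [|m IH]; first by rewrite !sum_O.
  by rewrite !sum_Sn IH; change (@plus C_R_NormedModule) with Cplus; cring.
change (Cmod (Cminus (sum_n (G := C_R_NormedModule) a m) l) < eps / (Cmod c + 1)) in hb.
change (Cmod (Cminus (Cmult c (sum_n (G := C_R_NormedModule) a m)) (Cmult c l)) < eps).
set s := sum_n _ _ in hb *.
have -> : Cminus (Cmult c s) (Cmult c l) = Cmult c (Cminus s l) by ring.
rewrite Cmod_mult.
have -> : pos eps = (Cmod c + 1) * (eps / (Cmod c + 1)) by field; lra.
have := Cmod_ge_0 (Cminus s l); nra.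
Qed.

Lemma V_opp (r : R) : V (- r) = V r.
Proof.
rewrite /V; have -> : - r / 2 = - (r / 2) by field.
by rewrite sin_neg; congr (/ _); ring.
Qed.

Lemma csum_scal_r {I : finType} (P : pred I) (f : I -> C) (c : C) :
  \big[Cplus/RtoC 0]_(i | P i) Cmult (f i) c =
  Cmult (\big[Cplus/RtoC 0]_(i | P i) f i) c.
Proof. by rewrite big_distrl. Qed.

Section Assembly.

Context {N : nat} (lam : R) (sigma : R -> C) (hsigma : is_phase sigma) (n : 'I_N -> Z).

Notation weight := (Cexp (RtoC (weight_sum n))).

Definition total_V (x : 'I_N -> R) (k : 'I_N) : R :=
  \big[Rplus/0]_(b < N) (if k == b then 0 else V (x k - x b)).

Lemma FhatE (m : 'I_N -> Z) : Fhat lam sigma m =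
  fun x => Cmult (calP1 lam m x) (Psi0 lam sigma x).
Proof. by apply: functional_extensionality => x; rewrite /Fhat calPE. Qed.

Definition Fhat1 (x : 'I_N -> R) (k : 'I_N) : C :=
  Cmult (Cplus (Cmult weight (mom1 lam n x k))
           (Cmult (RtoC (lam * logpsi x k)) (calP1 lam n x))) (Psi0 lam sigma x).

Definition Fhat2 (x : 'I_N -> R) (k : 'I_N) : C :=
  Cmult (Cplus (Cplus (Cmult weight (mom2 lam n x k))
    (Cmult (RtoC (2 * lam * logpsi x k)) (Cmult weight (mom1 lam n x k))))
    (Cmult (RtoC (lam * lam * (logpsi x k * logpsi x k) - lam * total_V x k))
       (calP1 lam n x))) (Psi0 lam sigma x).

Lemma is_partial_Fhat (x : 'I_N -> R) (k : 'I_N) : distinct_mod_2pi x ->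
  is_partial k (Fhat lam sigma n) x (Fhat1 x k).
Proof.
move=> hx; rewrite FhatE.
apply: (cderive_eq (cderive_mult (cderive_calP1 lam n x k)
  (cderive_Psi0 lam sigma hsigma x k hx))).
by rewrite upd_id /Fhat1; cring.
Qed.

Lemma is_partial_Fhat1 (x : 'I_N -> R) (k : 'I_N) : distinct_mod_2pi x ->
  is_partial k (fun z => Fhat1 z k) x (Fhat2 x k).
Proof.
move=> hx.
have hl : cderive (fun t => RtoC (lam * logpsi (upd x k t) k)) (x k)
    (RtoC (lam * - total_V x k)).
  apply: cderive_pair; last exact: is_derive_const.
  exact: is_derive_scal (is_derive_logpsi x k hx).
apply: (cderive_eq (cderive_mult (cderive_plus
  (cderive_scal weight (cderive_mom1 lam n x k))
  (cderive_mult hl (cderive_calP1 lam n x k))) (cderive_Psi0 lam sigma hsigma x k hx))).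
rewrite !upd_id /Fhat2 RtoC_minus !RtoC_mult RtoC_opp C2E; cring.
Qed.

Lemma is_partial_partial_Fhat (x : 'I_N -> R) (k : 'I_N) : distinct_mod_2pi x ->
  is_partial k (partial k (Fhat lam sigma n)) x (Fhat2 x k).
Proof.
move=> hx; apply: is_derive_ext_loc (is_partial_Fhat1 x k hx).
(* Outside distinct points the value of [partial] is not known, so the replacement by [Fhat1] is
   made only near [x]. *)
apply: filter_imp (locally_distinct x k hx) => t ht.
by rewrite (partial_unique (is_partial_Fhat _ k ht)).
Qed.

Lemma is_shift_series_Fhat (x : 'I_N -> R) (j k : 'I_N) : (j < k)%N ->
  is_shift_series lam sigma n x j k
    (Cmult (Psi0 lam sigma x) (Cmult weight (mom_u lam n j k x))).
Proof.
move=> hjk; have := is_series_Cmult (Psi0 lam sigma x) _ _ (is_series_calP1 lam n j k hjk x).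
apply: is_series_ext => m; rewrite FhatE; cring.
Qed.

Lemma shift_seriesE (x : 'I_N -> R) (j k : 'I_N) : (j < k)%N ->
  shift_series lam sigma n x j k =
  Cmult (Psi0 lam sigma x) (Cmult weight (mom_u lam n j k x)).
Proof.
move=> hjk; apply: (iota_unique (V := C_R_CompleteNormedModule)); last first.
  exact: is_shift_series_Fhat.
move=> s hs; apply: (filterlim_locally_unique (V := C_R_NormedModule) _ _ _ hs).
exact: is_shift_series_Fhat.
Qed.

(** [pointwise_identity] multiplied by the kernel and integrated: in [y], first and second
    derivatives become - i n_a and - n_a^2, and the squares complete to (n_a + lam s_a)^2. *)
Lemma moment_identity (x : 'I_N -> R) : distinct_mod_2pi x ->
  let p := Lint n (kernel lam 1 x) in
  Cplus (Cplus (Copp (\csum_k mom2 lam n x k))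
       (Cmult (RtoC (- (2 * lam))) (\csum_k Cmult (RtoC (logpsi x k)) (mom1 lam n x k))))
    (Cmult (RtoC (lam * lam * \big[Rplus/0]_(k < N) (total_V x k - logpsi x k * logpsi x k))) p) =
  Cminus (Cmult (RtoC (En lam n)) p)
    (Cmult (RtoC (gam lam))
      (\big[Cplus/RtoC 0]_(j < N) \big[Cplus/RtoC 0]_(k < N | (j < k)%N) mom_u lam n j k x)).
Proof.
move=> hx p.
pose e := halfcots (zpt x).
pose s (a : 'I_N) := / 2 * (INR N + 1) - INR a.+1.
have h0 := iterated_kernel1 lam n x; rewrite -/p in h0.
have h2 := iterated_sum (index_enum 'I_N) xpredT _ _ (fun k _ => iterated_mom2 lam n x k).
have h1 := iterated_sum (index_enum 'I_N) xpredT _ _ (fun k _ =>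
  iterated_scal _ _ (\csum_l e k l) _ _ (iterated_mom1 lam n x k)).
pose W := Cmult (RtoC (lam * lam)) (Cplus (\csum_k Cmult (\csum_l e k l) (\csum_l e k l))
       (\csum_k \csum_l (if k == l then RtoC 0 else
          Cminus (RtoC (/ 4)) (Cmult (e k l) (e k l))))).
have hL := iterated_plus _ _ _ _ _ _ (iterated_plus _ _ _ _ _ _
   (iterated_scal _ _ (Copp (RtoC 1)) _ _ h2)
   (iterated_scal _ _ (Cmult (RtoC (2 * lam)) Ci) _ _ h1)) (iterated_scal _ _ W _ _ h0).
have hY := iterated_sum (index_enum 'I_N) xpredT _ _ (fun a _ =>
  iterated_plus _ _ _ _ _ _ (iterated_plus _ _ _ _ _ _
    (iterated_scal _ _ (Copp (RtoC 1)) _ _ (iterated_ydot2 lam n 1 x a Rlt_0_1))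
    (iterated_scal _ _ (Cmult (Cmult (RtoC (2 * lam)) Ci) (RtoC (s a))) _ _
       (iterated_ydot lam n 1 x a Rlt_0_1)))
    (iterated_scal _ _ (RtoC (lam * lam * (s a * s a))) _ _ h0)).
have hU := iterated_sum (index_enum 'I_N) xpredT _ _ (fun j _ =>
  iterated_sum (index_enum 'I_N) (fun k : 'I_N => (j < k)%N) _ _ (fun k hk =>
    iterated_mom_u lam n j k hk x)).
have hR := iterated_plus _ _ _ _ _ _ hY (iterated_scal _ _ (Copp (RtoC (gam lam))) _ _ hU).
(* Both sides are values of one iterated integral. The equality of the integrands, left open here,
   is proved last from [pointwise_identity]. *)
have key : _ = _ := iterated_unique _ _ _ _ _ hL (iterated_ext hR _).
rewrite -/p in key.
have eW : W = RtoC (lam * lam * \big[Rplus/0]_(k < N) (total_V x k - logpsi x k * logpsi x k)).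
  rewrite /W (RtoC_mult (lam * lam)) RtoC_sum -csum_plus; congr Cmult; apply: eq_bigr => k _.
  rewrite sum_halfcots_zpt // RtoC_minus Cplus_comm /Cminus; congr Cplus.
    rewrite /total_V RtoC_sum; apply: eq_bigr => l _; case: (eqVneq k l) => // kl.
    exact: V_halfcots.
  by rewrite /Cmult /Ci /Copp /RtoC /=; congr pair; ring.
have eE : Cmult (Cmult (RtoC (2 * lam)) Ci) (\csum_k Cmult (\csum_l e k l) (mom1 lam n x k)) =
    Cmult (RtoC (- (2 * lam))) (\csum_k Cmult (RtoC (logpsi x k)) (mom1 lam n x k)).
  rewrite -!csum_scal; apply: eq_bigr => k _; rewrite sum_halfcots_zpt // !Cmult_assoc.
  by congr Cmult; rewrite /Cmult /Ci /RtoC /=; congr pair; ring.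
have eN : Cmult (RtoC (En lam n)) p = \csum_a Cplus (Cplus
    (Cmult (Copp (RtoC 1)) (Cmult (Copp (RtoC (IZR (n a) ^ 2))) p))
    (Cmult (Cmult (Cmult (RtoC (2 * lam)) Ci) (RtoC (s a))) (Cmult (0, - IZR (n a)) p)))
    (Cmult (RtoC (lam * lam * (s a * s a))) p).
  rewrite /En RtoC_sum Cmult_comm -csum_scal; apply: eq_bigr => a _; rewrite -/(s a).
  by rewrite /Cmult /Cplus /Copp /Ci /RtoC /=; congr pair; ring.
move: key; rewrite eE eW -eN => key.
transitivity (Cplus (Cplus (Cmult (Copp (RtoC 1)) (\csum_k mom2 lam n x k))
       (Cmult (RtoC (- (2 * lam))) (\csum_k Cmult (RtoC (logpsi x k)) (mom1 lam n x k))))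
    (Cmult (RtoC (lam * lam * \big[Rplus/0]_(k < N) (total_V x k - logpsi x k * logpsi x k))) p)).
  ring.
rewrite key; last first.
  move=> y; set Kv := kernel lam 1 x y.
  have hp2 := congr1 (fun z => Cmult z Kv) (esym (pointwise_identity lam x y hx)).
  rewrite -eW; apply: etrans (etrans _ hp2) _; rewrite /=.
    rewrite /Cminus Cmult_plus_distr_r; congr Cplus.
      by rewrite -csum_scal_r; apply: eq_bigr => a _; rewrite -/(s a); ring.
    under eq_bigr => j _ do rewrite csum_scal_r.
    rewrite csum_scal_r; set u := bigop _ _ _; ring.
  rewrite !Cmult_plus_distr_r; congr Cplus; congr Cplus.
    rewrite csum_scal_r; set u := bigop _ _ _; ring.
  rewrite -[LHS]Cmult_assoc; congr Cmult.
  by rewrite -csum_scal_r; apply: eq_bigr => k _; rewrite -Cmult_assoc.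
have fin (a b g : C) : Cplus a (Cmult (Copp g) b) = Cminus a (Cmult g b) by ring.
exact: fin.
Qed.

Lemma total_V_upper (x : 'I_N -> R) :
  2 * \big[Rplus/0]_(j < N) \big[Rplus/0]_(k < N | (j < k)%N) V (x j - x k) =
  \big[Rplus/0]_(k < N) total_V x k.
Proof.
apply: RtoC_inj; rewrite RtoC_mult !RtoC_sum.
under eq_bigr => j _ do rewrite RtoC_sum.
rewrite csum_upper => [|j k]; last by rewrite -V_opp; congr (RtoC (V _)); ring.
by apply: eq_bigr => j _; rewrite RtoC_sum; apply: eq_bigr => k _; case: ifP.
Qed.

Lemma Ham_Fhat (x : 'I_N -> R) : distinct_mod_2pi x ->
  Ham lam (Fhat lam sigma n) x =
    Cminus (Cmult (RtoC (En lam n)) (Fhat lam sigma n x))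
      (Cmult (RtoC (gam lam))
         (\big[Cplus/RtoC 0]_(j < N) \big[Cplus/RtoC 0]_(k < N | (j < k)%N)
            shift_series lam sigma n x j k)).
Proof.
move=> hx.
have -> : \big[Cplus/RtoC 0]_(j < N) \big[Cplus/RtoC 0]_(k < N | (j < k)%N)
    shift_series lam sigma n x j k = Cmult (Cmult (Psi0 lam sigma x) weight)
     (\big[Cplus/RtoC 0]_(j < N) \big[Cplus/RtoC 0]_(k < N | (j < k)%N) mom_u lam n j k x).
  rewrite -csum_scal; apply: eq_bigr => j _; rewrite big_distrr.
  by apply: eq_bigr => k hk; rewrite shift_seriesE // Cmult_assoc.
have hF : Fhat lam sigma n x = Cmult (Cmult (Psi0 lam sigma x) weight) (Lint n (kernel lam 1 x)).
  by rewrite FhatE /calP1; ring.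
have h2 : \csum_k partial k (partial k (Fhat lam sigma n)) x =
   Cmult (Cmult (Psi0 lam sigma x) weight)
     (Cplus (Cplus (\csum_k mom2 lam n x k)
       (Cmult (RtoC (2 * lam)) (\csum_k Cmult (RtoC (logpsi x k)) (mom1 lam n x k))))
       (Cmult (RtoC (\big[Rplus/0]_(k < N)
          (lam * lam * (logpsi x k * logpsi x k) - lam * total_V x k)))
          (Lint n (kernel lam 1 x)))).
  set A := Cmult _ weight; rewrite RtoC_sum -csum_scal_r -[Cmult (RtoC (2 * lam)) _]csum_scal -!csum_plus -csum_scal.
  apply: eq_bigr => k _; rewrite (partial_unique (is_partial_partial_Fhat _ k hx)).
  by rewrite /Fhat2 /calP1 (RtoC_mult (2 * lam)) /A; ring.
(* Differentiating the half cotangents yields lam V for each ordered pair and the potential lam (lam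
   - 1) V, together the lam^2 V of [moment_identity]. *)
have hW : lam * lam * \big[Rplus/0]_(k < N) (total_V x k - logpsi x k * logpsi x k) =
    - (\big[Rplus/0]_(k < N) (lam * lam * (logpsi x k * logpsi x k) - lam * total_V x k)) +
    2 * lam * (lam - 1) *
      \big[Rplus/0]_(j < N) \big[Rplus/0]_(k < N | (j < k)%N) V (x j - x k).
  have -> (u : R) : 2 * lam * (lam - 1) * u = lam * (lam - 1) * (2 * u) by ring.
  rewrite total_V_upper; elim/big_rec3: _ => [|k a b c _ h]; first by ring.
  by rewrite Rmult_plus_distr_l h; ring.
have hm := moment_identity x hx; rewrite /= hW in hm.
have fin (A m2 m1 p U g en : C) (q v : R) :
    Cplus (Cplus (Copp m2) (Cmult (RtoC (- (2 * lam))) m1)) (Cmult (RtoC (- q + v)) p) =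
      Cminus (Cmult en p) (Cmult g U) ->
    Cplus (Copp (Cmult A (Cplus (Cplus m2 (Cmult (RtoC (2 * lam)) m1)) (Cmult (RtoC q) p))))
      (Cmult (RtoC v) (Cmult A p)) =
    Cminus (Cmult en (Cmult A p)) (Cmult g (Cmult A U)).
  move=> h; transitivity (Cmult A (Cminus (Cmult en p) (Cmult g U))); last by ring.
  by rewrite -h RtoC_plus !RtoC_opp; ring.
by rewrite /Ham h2 hF; apply: fin.
Qed.

End Assembly.

Theorem proposition1 (N : nat) (lam : R) (sigma : R -> C)
    (hN : (2 <= N)%N) (hlam : 0 < lam) (hsigma : is_phase sigma) :
  (* the limit (and the integrals) defining P_n exist *)
  (forall (n : 'I_N -> Z) (x : 'I_N -> R), is_calP lam n x (calP lam n x)) /\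
  (forall (n : 'I_N -> Z) (x : 'I_N -> R), distinct_mod_2pi x ->
     (* the partial derivatives in H and the series on the right-hand side exist *)
     (forall j : 'I_N,
        is_partial j (Fhat lam sigma n) x (partial j (Fhat lam sigma n) x) /\
        is_partial j (partial j (Fhat lam sigma n)) x
          (partial j (partial j (Fhat lam sigma n)) x)) /\
     (forall j k : 'I_N, (j < k)%N ->
        is_shift_series lam sigma n x j k (shift_series lam sigma n x j k)) /\
     Ham lam (Fhat lam sigma n) x =
       Cminus
         (Cmult (RtoC (En lam n)) (Fhat lam sigma n x))
         (Cmult (RtoC (gam lam))
            (\big[Cplus/RtoC 0]_(j < N) \big[Cplus/RtoC 0]_(k < N | (j < k)%N)
               shift_series lam sigma n x j k))).
Proof.
split=> [n x|n x hx]; first by rewrite calPE; exact: is_calP_calP1.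
split=> [j|].
  have h1 := is_partial_Fhat lam sigma hsigma n x j hx.
  have h2 := is_partial_partial_Fhat lam sigma hsigma n x j hx.
  by rewrite (partial_unique h1) (partial_unique h2).
split=> [j k hjk|]; last exact: Ham_Fhat.
by rewrite shift_seriesE //; exact: is_shift_series_Fhat.
Qed.
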